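(* Let $(k,\ell)$ be an exponent pair satisfying $k \leqslant \frac16$, $3k+4\ell \geqslant 1$ and $\ell^2+\ell+3-k(5-\ell)-9k^2>0$. For any $\varepsilon>0$ and $x$ sufficiently large, $$\sum_{n \leqslant x} \Lambda\left(\left\lfloor \frac{x}{n}\right\rfloor\right) = x\sum_{n=1}^\infty \frac{\Lambda(n)}{n(n+1)} + O_\varepsilon\left(x^{\frac{14(k+1)}{29k-\ell+30}+\varepsilon}\right).$$
   Context: $\Lambda$ is the von Mangoldt function and $\lfloor\cdot\rfloor$ is the integer part; $e(t)=e^{2i\pi t}$. The pair $(k,\ell)$ is fixed, so implied constants may depend on it. Exponent pair: a pair $(k,\ell)$ of real numbers with $0\leqslant k\leqslant \frac12\leqslant \ell\leqslant 1$ is an exponent pair if for all real $1\leqslant R<R_1\leqslant 2R$, all $T>0$ and all positive-valued $F\in C^\infty[R,2R]$ with $|F^{(j)}(t)|\asymp TR^{-j}$ for all integers $j\geqslant 0$ and all $t\in[R,2R]$, one has $\sum_{R<n\leqslant R_1}e(F(n))\ll T^kR^{\ell-k}+RT^{-1}$, the implied constant depending only on $k,\ell$ and on the constants implied in the conditions on $F^{(j)}$ (which may depend on $j$). *)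

(* Defs.v *)
From HB Require Import structures.
From mathcomp Require Import all_boot all_order all_algebra.
From mathcomp Require Import all_classical all_reals all_analysis.
From mathcomp Require Import complex.
Set Implicit Arguments.
Unset Strict Implicit.
Unset Printing Implicit Defensive.
Import Order.TTheory GRing.Theory Num.Theory.
Import numFieldNormedType.Exports.
Local Open Scope classical_set_scope.
Local Open Scope ring_scope.
Local Open Scope complex_scope.

(* An integer is of the form p ^ a with p prime and 0 < a iff it has exactly
   one prime divisor; see vonMangoldtX and vonMangoldt_neq0. *)
Definition vonMangoldt (R : realType) (n : nat) : R :=
  if primes n is [:: p] then ln p%:R else 0.

Lemma vonMangoldtX (R : realType) (p a : nat) :
  prime p -> (0 < a)%N -> vonMangoldt R (p ^ a) = ln p%:R.
Proof. by move=> pp a0; rewrite /vonMangoldt primesX// primes_prime. Qed.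

Lemma vonMangoldt_neq0 (R : realType) (n : nat) : vonMangoldt R n != 0 ->
  exists p a : nat, [/\ prime p, (0 < a)%N & n = (p ^ a)%N].
Proof.
rewrite /vonMangoldt.
case En : (primes n) => [|p [|q s]]; rewrite ?eqxx// => _.
have : p \in primes n by rewrite En mem_head.
rewrite mem_primes => /and3P[pp n0 pn].
exists p, (logn p n); split => //; first by rewrite logn_gt0 En mem_head.
rewrite {1}(prod_prime_decomp n0) prime_decompE En big_map big_seq1.
by [].
Qed.

Definition expe (R : realType) (t : R) : R[i] :=
  cos (2 * pi * t) +i* sin (2 * pi * t).

(* [dF j] is the j-th derivative of F on the closed interval [a, b],
   one-sided at the end points; its values outside [a, b] are irrelevant. *)
Definition smooth_on (R : realType) (a b : R) (F : R -> R)
    (dF : nat -> R -> R) : Prop :=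
  (forall t, t \in `[a, b] -> dF 0%N t = F t) /\
  (forall j t, t \in `[a, b] ->
     (fun u => (dF j u - dF j t) / (u - t)) @ within [set` `[a, b]] t^'
       --> dF j.+1 t).

(* [c] and [C] are the constants implied in |F^(j)| \asymp T X^-j; the constant
   K depends only on them and on k, l. *)
Definition exponent_pair (R : realType) (k l : R) : Prop :=
  [/\ 0 <= k, k <= 1 / 2, 1 / 2 <= l, l <= 1 &
  forall c C : nat -> R, (forall j, 0 < c j) ->
  exists K : R, forall (X X1 T : R) (F : R -> R) (dF : nat -> R -> R),
    1 <= X -> X < X1 -> X1 <= 2 * X -> 0 < T ->
    smooth_on X (2 * X) F dF ->
    (forall t, t \in `[X, 2 * X] -> 0 < F t) ->
    (forall j t, t \in `[X, 2 * X] ->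
       c j * (T * X ^- j) <= `|dF j t| <= C j * (T * X ^- j)) ->
    `|\sum_((Num.truncn X).+1 <= n < (Num.truncn X1).+1) expe (F n%:R)|
      <= (K * (T `^ k * X `^ (l - k) + X / T))%:C].

(* Main.v *)
Require Import Defs.
From HB Require Import structures.
From mathcomp Require Import all_boot all_order all_algebra.
From mathcomp Require Import all_classical all_reals all_analysis.
From mathcomp Require Import zify ring lra.
Set Implicit Arguments.
Unset Strict Implicit.
Unset Printing Implicit Defensive.
Import Order.TTheory GRing.Theory Num.Theory.
Import numFieldNormedType.Exports.
Local Open Scope classical_set_scope.
Local Open Scope ring_scope.

(** The exponent equals [14 / (29 + (1 - l) / (k + 1))], which is at least
    [28 / 59] because [k >= 0] and [l >= 1 / 2]. The sum is estimated with the
    exponent [28 / 59 + eps].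

    The integers [n <= x] are grouped by [d = floor (x / n)]. Those with [d]
    larger than [x ^ (31 / 59)] number [x ^ (28 / 59)]. The others contribute
    [Lambda (d) (floor (x / d) - floor (x / (d + 1)))], that is, the terms
    [x Lambda (d) / (d (d + 1))] of the main series, up to sums of
    [Lambda (d) psi (x / (d + e))] with [e = 0] or [1] and the sawtooth [psi]
    ([main_bound]). For [d <= x ^ (28 / 59)] these are bounded trivially, and on a
    block [(D, 2 D]] beyond that a factor [P = D / x ^ (28 / 59)] must be saved
    ([block_bound]).

    Since [Lambda] is nonnegative, an inequality of Erdos-Turan type
    ([erdos_turan]), obtained from translates of the Fejer kernel, reduces the
    question to the sums of [Lambda (d) e(h x / (d + e))] with [h < P]. Vaughan's
    identity ([vaughan]) with both cuts at [U = P ^ 2] splits them into two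
    kinds of sums. In type I sums, [d = n m] with [n <= U ^ 2] and [m] in an
    interval, van der Corput's second derivative test
    ([second_difference_test]) is applied to the sum over [m] ([type_one]).

    In type II sums, [d = n m] with [n] between [U] and about [sqrt D] and
    arbitrary coefficients. The sum over [m] is taken outside and its coefficients
    are removed by Cauchy's inequality, after the fractions [h / n] have been
    sorted into classes; what remains are sums over [m] of
    [e((h / n - h' / n') x / m)], roughly, for [h / n] and [h' / n'] in the same
    class. The integer [h n' - h' n] governs both their number, by the divisor
    bound, and their size, by the second derivative test. With about [H N / U]
    classes for [h] of size [H] and [n] of size [N], the diagonal terms dominate
    and [sqrt U = P] is saved ([type_two]). Both the range of [n] near [sqrt D]
    and the bound [U ^ 2] for type I sums leave room at [D = x ^ (31 / 59)].

    The sums are real: [cos] and [sin] of the same phase are treated together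
    through [gram_ce], or as [cos] with a shift of the phase. *)

(** * Real trigonometric sums *)

Section Trigonometry.
Context {R : realType}.
Implicit Types (t u : R).

(** Real and imaginary parts of the additive character [e(t)]. *)
Definition ce t : R := cos (2 * pi * t).
Definition se t : R := sin (2 * pi * t).

Lemma ce_norm t : `|ce t| <= 1. Proof. exact: cos_max. Qed.
Lemma se_norm t : `|se t| <= 1. Proof. exact: sin_max. Qed.
Lemma ce2Dse2 t : ce t ^+ 2 + se t ^+ 2 = 1. Proof. exact: cos2Dsin2. Qed.
Lemma ceN t : ce (- t) = ce t. Proof. by rewrite /ce mulrN cosN. Qed.
Lemma seN t : se (- t) = - se t. Proof. by rewrite /se mulrN sinN. Qed.
Lemma ceD t u : ce (t + u) = ce t * ce u - se t * se u.
Proof. by rewrite /ce mulrDr cosD. Qed.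
Lemma seD t u : se (t + u) = se t * ce u + ce t * se u.
Proof. by rewrite /se mulrDr sinD. Qed.
Lemma ceB t u : ce (t - u) = ce t * ce u + se t * se u.
Proof. by rewrite ceD ceN seN mulrN opprK. Qed.
Lemma ce0 : ce 0 = 1. Proof. by rewrite /ce mulr0 cos0. Qed.
Lemma se0 : se 0 = 0. Proof. by rewrite /se mulr0 sin0. Qed.

Lemma ce_natr (n : nat) : ce n%:R = 1.
Proof.
rewrite /ce mulr_natr -[_ *+ n]add0r mulrC mulr_natr.
by rewrite (periodicn (cosD2pi (R := R))) cos0.
Qed.

Lemma se_natr (n : nat) : se n%:R = 0.
Proof.
rewrite /se mulr_natr -[_ *+ n]add0r mulrC mulr_natr.
by rewrite (periodicn (sinD2pi (R := R))) sin0.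
Qed.

Lemma ceDn t (n : nat) : ce (t + n%:R) = ce t.
Proof. by rewrite ceD ce_natr se_natr mulr0 subr0 mulr1. Qed.

Lemma ceBn t (n : nat) : ce (t - n%:R) = ce t.
Proof. by rewrite -(ceDn _ n) subrK. Qed.

Lemma seE t : se t = ce (t - 1 / 4).
Proof.
rewrite /se /ce -cosBpihalf; congr cos.
by rewrite mulrBr; congr (_ - _); field.
Qed.

Lemma cos_sin_piquarter : cos (pi / 4) = sin (pi / 4) :> R.
Proof.
have e4 : pi / 4 - pi / 2 = - (pi / 4) :> R by lra.
by rewrite -[RHS]cosBpihalf e4 cosN.
Qed.

Lemma cos_piquarter_ge : 1 / 2 <= cos (pi / 4) :> R.
Proof.
have c0 : 0 <= cos (pi / 4) :> R.
  have := pi_gt0 R; rewrite cos_sin_piquarter => p0.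
  by apply: sin_ge0_pi; apply/andP; split; lra.
have c2 : 1 / 2 <= cos (pi / 4) ^+ 2 :> R.
  by have := cos2Dsin2 (pi / 4 : R); rewrite -cos_sin_piquarter; lra.
by nra.
Qed.

(** A weak form of Jordan's inequality: distances to the nearest integer bound
    [sin] from below, hence denominators of geometric sums. *)
Lemma sin_pi_ge t : 0 <= t <= 1 / 2 -> t <= sin (pi * t).
Proof.
move=> /andP[t0 t12].
have p0 : 0 < pi :> R := pi_gt0 R.
have p2 : 2 <= pi :> R := pi_ge2 R.
have mem u : 0 <= u -> u <= pi / 2 -> u \in `[(- (pi / 2)), pi / 2].
  by move=> u0 u1; rewrite in_itv /= u1 andbT; lra.
have s41 : 1 / 2 <= sin (pi / 4 : R) by rewrite -cos_sin_piquarter cos_piquarter_ge.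
(* the mean value theorem up to pi / 4, monotonicity of the sine beyond *)
case: (lerP (pi * t) (pi / 4)) => ht; last first.
  apply: (le_trans t12); apply: (le_trans s41).
  have pt2 : pi * t <= pi / 2 by have := ler_wpM2l (ltW p0) t12; lra.
  by rewrite ltW // ltr_sin ?mem //; lra.
have [->|tn0] := eqVneq t 0; first by rewrite mulr0 sin0.
have pt0 : 0 < pi * t by rewrite mulr_gt0 // lt_def tn0.
have [c /[!in_itv]/= /andP[c0 c1]] : exists2 c, c \in `]0, (pi * t)[ &
    sin (pi * t) - sin 0 = cos c * (pi * t - 0).
  apply: (@MVT R sin cos) => //.
  apply: continuous_subspaceT => u; exact: continuous_sin.
rewrite sin0 !subr0 => ->.
have hc : 1 / 2 <= cos c.
  apply: (le_trans cos_piquarter_ge).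
  by rewrite ltW // ltr_cos ?in_itv /=; lra.
have : 2 * t <= pi * t by rewrite ler_wpM2r.
by have := ler_wpM2r (ltW pt0) hc; lra.
Qed.

End Trigonometry.

(** * The second derivative test *)

Section KusminLandau.
Context {R : realType}.
Implicit Types (f g : nat -> R) (a b : nat).

(** Summation by parts against a nonincreasing weight: only the extreme values
    of the weight matter, because its increments have constant sign. *)
Lemma abel_telescope_bound g (S : nat -> R) (G B : R) a b : 0 <= G -> 0 <= B ->
  (forall m, (a <= m < b)%N -> `|g m| <= G) ->
  (forall m, (a <= m)%N -> (m.+1 < b)%N -> g m.+1 <= g m) ->
  (forall m, (a <= m <= b)%N -> `|S m| <= B) ->
  `|\sum_(a <= m < b) g m * (S m.+1 - S m)| <= 4 * (G * B).
Proof.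
move=> G0 B0 gG gmon SB.
case: (leqP b a) => [ba|ab].
  by rewrite big_geq// normr0 mulr_ge0 // mulr_ge0.
have [n] : exists n, b = (a + n.+1)%N by exists (b - a.+1)%N; lia.
move=> bE; subst b => {ab}.
suff : `|\sum_(a <= m < a + n.+1) g m * (S m.+1 - S m)
       - g (a + n)%N * S (a + n.+1)%N| <= (G + (g a - g (a + n)%N)) * B.
  have h1 : `|g a| <= G by apply: gG; lia.
  have h2 : `|g (a + n)%N| <= G by apply: gG; lia.
  move=> h3.
  have h4 : `|g (a + n)%N * S (a + n.+1)%N| <= G * B.
    by rewrite normrM ler_pM // SB //; lia.
  have h5 : (G + (g a - g (a + n)%N)) * B <= (3 * G) * B.
    rewrite ler_wpM2r //; move: h1 h2; rewrite !ler_norml.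
    by move=> /andP[? ?] /andP[? ?]; lra.
  move: h3 h4; rewrite !ler_norml.
  by move=> /andP[? ?] /andP[? ?]; apply/andP; split; lra.
elim: n gG gmon SB => [|n IH] gG gmon SB.
  rewrite addn0 addn1 big_nat1 subrr addr0.
  have -> : g a * (S a.+1 - S a) - g a * S a.+1 = - (g a * S a) by ring.
  by rewrite normrN normrM ler_pM // ?gG ?SB //; lia.
rewrite (addnS a n.+1) big_nat_recr /=; last by lia.
have -> u : u + g (a + n.+1)%N * (S (a + n.+1).+1 - S (a + n.+1)%N) -
  g (a + n.+1)%N * S (a + n.+1).+1 = (u - g (a + n)%N * S (a + n.+1)%N)
   + (g (a + n)%N - g (a + n.+1)%N) * S (a + n.+1)%N by ring.
apply: (le_trans (ler_normD _ _)).
have -> : (G + (g a - g (a + n.+1)%N)) * B = (G + (g a - g (a + n)%N)) * B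
   + (g (a + n)%N - g (a + n.+1)%N) * B by ring.
apply: lerD.
  apply: IH => m hm; [by apply: gG; lia| |by apply: SB; lia].
  by move=> hm2; apply: gmon; lia.
have gn : g (a + n.+1)%N <= g (a + n)%N by rewrite addnS; apply: gmon; lia.
rewrite normrM (ger0_norm (x := _ - _)) ?subr_ge0 //.
by rewrite ler_wpM2l ?subr_ge0 // SB //; lia.
Qed.

(** Partial summation, in the form used for the logarithmic weights of type I
    sums and for the samples of the sawtooth. *)
Lemma abel_sum_bound g (c : nat -> R) (G B : R) a b : 0 <= G -> 0 <= B ->
  (forall m, (a <= m < b)%N -> `|g m| <= G) ->
  (forall m, (a <= m)%N -> (m.+1 < b)%N -> g m <= g m.+1) ->
  (forall n, (a <= n <= b)%N -> `|\sum_(a <= m < n) c m| <= B) ->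
  `|\sum_(a <= m < b) g m * c m| <= 4 * (G * B).
Proof.
move=> G0 B0 gG gmon SB.
have -> : \sum_(a <= m < b) g m * c m = - \sum_(a <= m < b)
    (- g m) * (\sum_(a <= i < m.+1) c i - \sum_(a <= i < m) c i).
  rewrite -sumrN; apply: eq_big_nat => m /andP[am _].
  by rewrite big_nat_recr //=; ring.
rewrite normrN; apply: (@abel_telescope_bound (fun m => - g m)
  (fun m => \sum_(a <= i < m) c i)) => // m hm; first by rewrite normrN gG.
by move=> hm1; rewrite lerN2 gmon.
Qed.

Lemma sin_pi_ge_dist (t tau : R) : 0 < tau -> tau <= t <= 1 - tau ->
  tau <= sin (pi * t).
Proof.
move=> tau0 /andP[h1 h2].
case: (lerP t (1 / 2)) => ht.
  by apply: (le_trans h1); apply: sin_pi_ge; apply/andP; split; lra.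
have -> : sin (pi * t) = sin (pi * (1 - t)).
  by rewrite -[RHS]opprK -sinN -(sinDpi (R := R)); congr (sin _); ring.
have /andP H : 0 <= 1 - t /\ 1 - t <= 1 / 2 by lra.
by have := sin_pi_ge H; lra.
Qed.

(** The Kusmin-Landau inequality. The phases advance by steps that stay away
    from the integers, so that [ce (f m)] is, up to a telescoping term, the
    increment of [se \o f] times [cot] of the step; the cotangent is monotone,
    and summation by parts applies. *)
Lemma kusmin_landau f a b (tau : R) : 0 < tau -> tau <= 1 ->
  (forall m, (a <= m < b)%N -> tau <= f m.+1 - f m <= 1 - tau) ->
  (forall m, (a <= m)%N -> (m.+1 < b)%N -> f m.+1 - f m <= f m.+2 - f m.+1) ->
  `|\sum_(a <= m < b) ce (f m)| <= 3 / tau.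
Proof.
move=> tau0 tau1 hd hmon.
pose d m := f m.+1 - f m.
pose g m := cos (pi * d m) / sin (pi * d m).
have sd m : (a <= m < b)%N -> tau <= sin (pi * d m).
  by move=> hm; apply: sin_pi_ge_dist => //; exact: hd.
have step m : (a <= m < b)%N ->
    ce (f m) = 2^-1 * (g m * (se (f m.+1) - se (f m)))
             + 2^-1 * (ce (f m) - ce (f m.+1)).
  move=> hm; have s0 := lt_le_trans tau0 (sd m hm).
  have sn0 : sin (pi * d m) != 0 by rewrite gt_eqF.
  pose u := pi * (f m.+1 + f m).
  have e1 : 2 * pi * f m.+1 = u + pi * d m by rewrite /u /d; ring.
  have e2 : 2 * pi * f m = u - pi * d m by rewrite /u /d; ring.
  rewrite /ce /se e1 e2 /g sinB cosB sinD cosD; field.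
  exact: sn0.
rewrite (eq_big_nat _ _ step) big_split /= -!mulr_sumr.
have it0 : 1 <= tau^-1 by rewrite invf_ge1.
have h1 : `|\sum_(a <= m < b) g m * (se (f m.+1) - se (f m))| <= 4 * tau^-1.
  rewrite -[tau^-1]mulr1.
  apply: (@abel_telescope_bound g (fun m => se (f m))) => //.
  - by rewrite invr_ge0 ltW.
  - move=> m hm; rewrite /g normrM -[leRHS]mul1r ler_pM //; first exact: cos_max.
    have s0 := lt_le_trans tau0 (sd m hm).
    by rewrite normfV gtr0_norm // lef_pV2 ?posrE // sd.
  - move=> m am mb.
    have hm : (a <= m < b)%N by lia.
    have hm1 : (a <= m.+1 < b)%N by lia.
    have s0 := lt_le_trans tau0 (sd m hm).
    have s1 := lt_le_trans tau0 (sd m.+1 hm1).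
    rewrite /g ler_pdivrMr // mulrAC ler_pdivlMr //.
    rewrite -subr_ge0.
    have -> : cos (pi * d m) * sin (pi * d m.+1)
       - cos (pi * d m.+1) * sin (pi * d m) = sin (pi * (d m.+1 - d m)).
      by rewrite (mulrBr pi (d m.+1)) (sinB (pi * d m.+1)); ring.
    have dm := hmon m am mb.
    have /andP[h1 h2] := hd m hm; have /andP[h3 h4] := hd m.+1 hm1.
    have p0 : 0 < pi :> R := pi_gt0 R.
    apply: sin_ge0_pi; apply/andP; split.
      by rewrite mulr_ge0 ?(ltW p0) // subr_ge0.
    rewrite -[leRHS]mulr1 ler_pM2l // /d; lra.
  - by move=> m _; exact: se_norm.
have h2 : `|\sum_(a <= m < b) (ce (f m) - ce (f m.+1))| <= 2.
  case: (leqP b a) => [ba|ab]; first by rewrite big_geq// normr0.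
  under eq_bigr do rewrite -opprB.
  rewrite sumrN telescope_sumr 1?ltnW // normrN.
  have := ce_norm (f a); have := ce_norm (f b); rewrite !ler_norml.
  by move=> /andP[? ?] /andP[? ?]; apply/andP; split; lra.
move: h1 h2; rewrite !ler_norml => /andP[? ?] /andP[? ?].
by apply/andP; split; lra.
Qed.

End KusminLandau.

Section SecondDerivativeTest.
Context {R : realType}.
Implicit Types (f d : nat -> R) (a b c k n : nat).

Lemma nondecreasing_nat d a b m m' :
  (forall m, (a <= m)%N -> (m.+1 < b)%N -> d m <= d m.+1) ->
  (a <= m)%N -> (m <= m')%N -> (m' < b)%N -> d m <= d m'.
Proof.
move=> mon am mm'; have -> : m' = (m + (m' - m))%N by lia.
elim: (m' - m)%N => [|j IH] mb; first by rewrite addn0.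
by rewrite addnS; apply: (le_trans (IH _)); [lia|apply: mon; lia].
Qed.

Lemma threshold_split d (t : R) a b : (a <= b)%N ->
  (forall m, (a <= m)%N -> (m.+1 < b)%N -> d m <= d m.+1) ->
  exists c, [/\ (a <= c <= b)%N, (forall m, (a <= m < c)%N -> d m < t) &
                (forall m, (c <= m < b)%N -> t <= d m)].
Proof.
move=> ab mon.
have P : exists c, (a <= c)%N && ((b <= c)%N || (t <= d c)).
  by exists b; rewrite ab leqnn.
case: (ex_minnP P) => c /andP[ac hc] cmin; exists c; split.
- by rewrite ac cmin // ab leqnn.
- move=> m /andP[am mc]; rewrite ltNge; apply/negP => tm.
  by have := cmin m; rewrite am tm orbT => /(_ isT); lia.
- move=> m /andP[cm mb].
  have tc : t <= d c by case/orP: hc => //; lia.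
  by apply: (le_trans tc); apply: (nondecreasing_nat mon).
Qed.

Lemma ler_norm_sum_ce f a b : `|\sum_(a <= m < b) ce (f m)| <= (b - a)%:R.
Proof.
apply: (le_trans (ler_norm_sum _ _ _)).
rewrite -[leRHS]mulr1 mulr_natl -sumr_const_nat.
by apply: ler_sum => m _; exact: ce_norm.
Qed.

Section Test.
Variables (f : nat -> R) (s : R).
Hypothesis (s0 : 0 < s) (s1 : s <= 1).
Let d m := f m.+1 - f m.

Lemma step_growth a b : (forall m, (a <= m < b)%N -> s ^+ 2 <= d m.+1 - d m) ->
  (a < b)%N -> (b - a.+1)%:R * s ^+ 2 <= d b.-1 - d a.
Proof.
move=> hd ab; have bE : b = (a + (b - a.+1)).+1 by lia.
rewrite {2}bE /=; move: hd; rewrite {1}bE.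
elim: (b - a.+1)%N => [|j IH] hd; first by rewrite addn0 subrr mul0r.
have := hd (a + j)%N; rewrite addnS => /(_ _)/wrap[]; first lia.
have : j%:R * s ^+ 2 <= d (a + j)%N - d a by apply: IH => m hm; apply: hd; lia.
by rewrite -[in j.+1%:R]addn1 natrD mulrDl mul1r; lra.
Qed.

(** Steps increasing by at least [s ^ 2] leave any interval of length [s]
    within [1 / s + 1] terms. *)
Lemma ce_sum_short a b (u : R) : (a <= b)%N ->
  (forall m, (a <= m < b)%N -> s ^+ 2 <= d m.+1 - d m) ->
  (forall m, (a <= m < b)%N -> u <= d m <= u + s) ->
  `|\sum_(a <= m < b) ce (f m)| <= 2 / s.
Proof.
move=> ab hd hu; apply: (le_trans (ler_norm_sum_ce _ _ _)).
have is1 : 1 <= s^-1 by rewrite invf_ge1.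
case: (ltngtP a b) ab => // [{}ab|->] _; last first.
  by rewrite subnn mulr_ge0 // ltW // invr_gt0.
have := step_growth hd ab.
have /andP[_ h1] : u <= d b.-1 <= u + s by apply: hu; lia.
have /andP[h2 _] : u <= d a <= u + s by apply: hu; lia.
move=> h3; have {}h3 : (b - a.+1)%:R * s ^+ 2 <= s by lra.
have {}h3 : (b - a.+1)%:R <= s^-1.
  by rewrite -[leRHS]mul1r ler_pdivlMr // -(ler_pM2r s0) -mulrA mul1r.
have -> : (b - a = (b - a.+1) + 1)%N by lia.
by rewrite natrD; lra.
Qed.

(** On a block where the steps stay between consecutive integers, only the two
    ends, where the steps are within [s] of an integer, escape Kusmin-Landau. *)
Lemma ce_sum_unit_block a b k : (a <= b)%N ->
  (forall m, (a <= m < b)%N -> s ^+ 2 <= d m.+1 - d m) ->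
  (forall m, (a <= m < b)%N -> k%:R <= d m < k%:R + 1) ->
  `|\sum_(a <= m < b) ce (f m)| <= 7 / s.
Proof.
move=> ab hd hk.
have s20 : 0 <= s ^+ 2 by rewrite exprn_ge0 // ltW.
have mon m : (a <= m)%N -> (m.+1 < b)%N -> d m <= d m.+1.
  by move=> am mb; have := hd m; rewrite am /= => /(_ _)/wrap[]; [lia|lra].
have [c [c1 hc hc']] := threshold_split (k%:R + s) ab mon.
have cb : (c <= b)%N by lia.
have mon' m : (c <= m)%N -> (m.+1 < b)%N -> d m <= d m.+1.
  by move=> am mb; apply: mon => //; lia.
have [e [e1 he he']] := threshold_split (k%:R + 1 - s) cb mon'.
rewrite (big_cat_nat (n := c)) /=; [|lia|lia].
rewrite [X in _ + X](big_cat_nat (n := e)) /=; [|lia|lia].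
have p1 : `|\sum_(a <= m < c) ce (f m)| <= 2 / s.
  apply: (@ce_sum_short _ _ k%:R); [lia|by move=> m hm; apply: hd; lia|].
  move=> m hm; have := hc m hm; have := hk m.
  by move=> /(_ _)/wrap[]; [lia|move=> /andP[? ?] ?; apply/andP; split; lra].
have p3 : `|\sum_(e <= m < b) ce (f m)| <= 2 / s.
  apply: (@ce_sum_short _ _ (k%:R + 1 - s)).
  - lia.
  - by move=> m hm; apply: hd; lia.
  - move=> m hm; have := he' m hm; have := hk m.
    by move=> /(_ _)/wrap[]; [lia|move=> /andP[? ?] ?; apply/andP; split; lra].
have p2 : `|\sum_(c <= m < e) ce (f m)| <= 3 / s.
  under eq_bigr => m _ do rewrite -(ceBn _ (k * m)).
  apply: (@kusmin_landau _ (fun m => f m - (k * m)%:R)) => //.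
    move=> m hm; have := he m hm; have := hc' m.
    move=> /(_ _)/wrap[]; first lia.
    by rewrite /d mulnS natrD => ? ?; apply/andP; split; lra.
  move=> m cm me; have := mon' m cm; move=> /(_ _)/wrap[]; first lia.
  by rewrite /d !mulnS !natrD; lra.
apply: (le_trans (ler_normD _ _)).
have := ler_normD (\sum_(c <= m < e) ce (f m)) (\sum_(e <= m < b) ce (f m)).
by lra.
Qed.

Lemma ce_sum_blocks n a b k : (a <= b)%N ->
  (forall m, (a <= m < b)%N -> s ^+ 2 <= d m.+1 - d m) ->
  (forall m, (a <= m < b)%N -> k%:R <= d m < (k + n)%:R) ->
  `|\sum_(a <= m < b) ce (f m)| <= n%:R * (7 / s).
Proof.
elim: n a k => [|n IH] a k ab hd hk.
  have -> : a = b.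
    apply/eqP; rewrite eqn_leq ab leqNgt /=; apply/negP => ab'.
    by have := hk a; rewrite leqnn ab' addn0 => /(_ isT)/andP[]; lra.
  by rewrite big_geq // normr0 mul0r.
have s20 : 0 <= s ^+ 2 by rewrite exprn_ge0 // ltW.
have mon m : (a <= m)%N -> (m.+1 < b)%N -> d m <= d m.+1.
  by move=> am mb; have := hd m; rewrite am /= => /(_ _)/wrap[]; [lia|lra].
have [c [c1 hc hc']] := threshold_split (k%:R + 1) ab mon.
rewrite (big_cat_nat (n := c)) /=; [|lia|lia].
apply: (le_trans (ler_normD _ _)).
rewrite -addn1 addnC natrD mulrDl mul1r; apply: lerD.
  apply: (@ce_sum_unit_block _ _ k); [lia|by move=> m hm; apply: hd; lia|].
  move=> m hm; rewrite hc // andbT; have := hk m.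
  by move=> /(_ _)/wrap[]; [lia|case/andP].
apply: (IH c k.+1); [lia|by move=> m hm; apply: hd; lia|].
move=> m hm; rewrite -addn1 natrD hc' //= -addnA add1n.
by have := hk m; move=> /(_ _)/wrap[]; [lia|case/andP].
Qed.

End Test.

(** Van der Corput's second derivative test, with second differences instead of
    second derivatives: the steps of the phase sweep an interval of length at
    most [(b - a) * A * s ^ 2], and each unit interval that they cross costs
    [7 / s]. *)
Lemma second_difference_test f a b (A s : R) : 0 < s -> 1 <= A ->
  (forall m, (a <= m < b)%N ->
     s ^+ 2 <= f m.+2 - 2 * f m.+1 + f m <= A * s ^+ 2) ->
  `|\sum_(a <= m < b) ce (f m)| <= 14 * A * ((b - a)%:R * s + s^-1).
Proof.
move=> s0 A1 hf.
have is0 : 0 < s^-1 by rewrite invr_gt0.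
case: (leqP b a) => [ba|ab].
  by rewrite big_geq // normr0; apply: mulr_ge0; [lra|apply: addr_ge0;
     [apply: mulr_ge0; [|lra]|lra]].
case: (lerP s 1) => s1; last first.
  apply: (le_trans (ler_norm_sum_ce _ _ _)).
  have : 0 <= (b - a)%:R * (s - 1) by apply: mulr_ge0; [|lra].
  have h : 0 <= (b - a)%:R * s by apply: mulr_ge0; [|lra].
  have h2 : 0 <= (A - 1) * ((b - a)%:R * s) by apply: mulr_ge0; [lra|].
  have h3 : 0 <= A * s^-1 by apply: mulr_ge0; lra.
  lra.
pose K := (Num.truncn `|f a.+1 - f a|).+1.
pose f' m := f m + (K * m)%:R.
pose d m := f' m.+1 - f' m.
have dE m : d m.+1 - d m = f m.+2 - 2 * f m.+1 + f m.
  by rewrite /d /f' !mulnS !natrD; ring.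
have da : 0 <= d a.
  have := truncnS_gt `|f a.+1 - f a|; rewrite -/K ltr_norml.
  by move=> /andP[? _]; rewrite /d /f' mulnS natrD; lra.
have s20 : 0 <= s ^+ 2 by rewrite exprn_ge0 // ltW.
have hd m : (a <= m < b)%N -> s ^+ 2 <= d m.+1 - d m.
  by move=> hm; rewrite dE; have /andP[] := hf m hm.
have mon m : (a <= m)%N -> (m.+1 < b)%N -> d m <= d m.+1.
  by move=> am mb; have := hd m; rewrite am /= => /(_ _)/wrap[]; [lia|lra].
pose L := (b - a)%:R * (A * s ^+ 2).
have L0 : 0 <= L by rewrite /L mulr_ge0 // mulr_ge0 //; lra.
have dub m : (a <= m < b)%N -> d m <= d a + L.
  move=> hm; have -> : m = (a + (m - a))%N by lia.
  apply: (@le_trans _ _ (d a + (m - a)%:R * (A * s ^+ 2))); last first.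
    by rewrite lerD2l; apply: ler_wpM2r; [apply: mulr_ge0; lra|rewrite ler_nat; lia].
  have : (a + (m - a) < b)%N by lia.
  elim: (m - a)%N => [|j IH] hj; first by rewrite addn0 mul0r addr0.
  rewrite addnS -[j.+1]addn1 natrD mulrDl mul1r addrA.
  have h1 : d (a + j)%N <= d a + j%:R * (A * s ^+ 2) by apply: IH; lia.
  have := hf (a + j)%N; rewrite -dE => /(_ _)/wrap[]; first lia.
  by move=> /andP[_]; lra.
pose k := Num.truncn (d a).
pose n := (Num.truncn L).+2.
under eq_bigr => m _ do rewrite -(ceDn _ (K * m)).
have := @ce_sum_blocks f' s s0 s1 n a b k (ltnW ab) hd.
move=> /(_ _)/wrap[].
  move=> m hm; have /andP[k1 k2] := truncn_itv da.
  have := truncnS_gt L; have := dub m hm; rewrite -/(d m).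
  have dam : d a <= d m.
    by case/andP: hm => am mb; exact: (nondecreasing_nat mon (leqnn a) am mb).
  rewrite natrD /n -addn2 -[(Num.truncn L).+1]addn1 !natrD.
  move: k1 k2; rewrite -/k -addn1 natrD => k1 k2 h1 h2.
  by apply/andP; split; lra.
move=> h; apply: (le_trans h).
have nL : n%:R <= L + 2.
  rewrite /n -addn2 natrD lerD2r.
  by have /andP[] := truncn_itv L0.
apply: (@le_trans _ _ ((L + 2) * (7 / s))).
  by rewrite ler_wpM2r //; lra.
have -> : (L + 2) * (7 / s) = 7 * A * ((b - a)%:R * s) + 14 * s^-1.
  by rewrite /L; field; rewrite gt_eqF.
have h0 : 0 <= (b - a)%:R * s by apply: mulr_ge0; [|lra].
have h2 : 0 <= A * ((b - a)%:R * s) by apply: mulr_ge0; [lra|].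
have h3 : 0 <= (A - 1) * s^-1 by apply: mulr_ge0; lra.
lra.
Qed.

End SecondDerivativeTest.

(** * From the sawtooth to exponential sums *)

Section Fourier.
Context {R : realType}.
Implicit Types (t u v w : R).

(** The sawtooth function; on nonnegative reals [truncn] is the integer part. *)
Definition sawtooth t : R := t - (Num.truncn t)%:R - 1 / 2.

Definition natdist (i j : nat) := ((i - j) + (j - i))%N.

Definition harmonic_sum (n : nat) : R := \sum_(0 <= k < n) (k.+1%:R)^-1.

(** The squared modulus of an exponential sum, in real terms: it depends on the
    differences of the phases only. *)
Lemma gram_ce (I : Type) (r : seq I) (P : pred I) (a th : I -> R) :
  (\sum_(i <- r | P i) a i * ce (th i)) ^+ 2
    + (\sum_(i <- r | P i) a i * se (th i)) ^+ 2
  = \sum_(i <- r | P i) \sum_(j <- r | P j) a i * a j * ce (th i - th j).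
Proof.
rewrite !expr2 !big_distrlr /= -big_split /=; apply: eq_bigr => i _.
rewrite -big_split /=; apply: eq_bigr => j _.
by rewrite ceB; ring.
Qed.

Lemma ce_natdist (i j : nat) u :
  ce (i%:R * u - j%:R * u) = ce ((natdist i j)%:R * u).
Proof.
case: (leqP i j) => ij.
  have -> : natdist i j = (j - i)%N by rewrite /natdist; lia.
  by rewrite -ceN opprB natrB // mulrBl.
have -> : natdist i j = (i - j)%N by rewrite /natdist; lia.
by rewrite natrB 1?ltnW // mulrBl.
Qed.

(** At most [2 (n - h)] ordered pairs of integers below [n] are at distance [h]. *)
Lemma sum_natdist_le (F : nat -> R) (n : nat) : (forall h, 0 <= F h) ->
  \sum_(0 <= i < n) \sum_(0 <= j < n) F (natdist i j)
   <= 2 * \sum_(0 <= h < n) (n - h)%:R * F h.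
Proof.
move=> F0; elim: n => [|n IH]; first by rewrite !big_geq // mulr0.
rewrite big_nat_recr //=.
under eq_bigr do rewrite big_nat_recr //=.
rewrite big_split /=.
have e1 : \sum_(0 <= i < n) F (natdist i n) = \sum_(1 <= h < n.+1) F h.
  rewrite big_nat_rev /= big_add1 /=; apply: eq_big_nat => i hi.
  by rewrite /natdist; congr F; lia.
have e2 : \sum_(0 <= i < n.+1) F (natdist n i) = \sum_(0 <= h < n.+1) F h.
  rewrite big_nat_rev /=; apply: eq_big_nat => i hi.
  by rewrite /natdist; congr F; lia.
rewrite e1 e2.
have e3 : \sum_(0 <= h < n.+1) (n.+1 - h)%:R * F h
    = \sum_(0 <= h < n) (n - h)%:R * F h + \sum_(0 <= h < n.+1) F h.
  rewrite [LHS]big_nat_recr //= [X in _ = _ + X]big_nat_recr //= addrA.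
  rewrite -big_split /= subSnn mul1r; congr (_ + _).
  apply: eq_big_nat => i hi.
  by rewrite subSn; [rewrite -[(n - i).+1]addn1 (natrD _ (n - i)) mulrDl mul1r|lia].
rewrite e3 mulrDr.
have e4 : \sum_(1 <= h < n.+1) F h <= \sum_(0 <= h < n.+1) F h.
  by rewrite [leRHS]big_nat_recl // [leLHS]big_add1 /= lerDr.
lra.
Qed.

Lemma ce_progression v w (n : nat) :
  2 * sin (pi * v) * (\sum_(0 <= s < n) ce (w + s%:R * v))
   = se (w + (n%:R - 1 / 2) * v) - se (w - 1 / 2 * v).
Proof.
elim: n => [|n IH]; first by rewrite big_geq // mulr0 sub0r mulNr subrr.
rewrite big_nat_recr //= mulrDr IH -[n.+1]addn1 (natrD _ n 1).
have -> : w + (n%:R + 1 - 1 / 2) * v = (w + n%:R * v) + v / 2 by lra.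
have -> : w + (n%:R - 1 / 2) * v = (w + n%:R * v) - v / 2 by lra.
set z := w + n%:R * v.
have -> : sin (pi * v) = se (v / 2) by rewrite /se; congr sin; field.
by rewrite !seD seN ceN; ring.
Qed.

Lemma se_progression v w (n : nat) :
  2 * sin (pi * v) * (\sum_(0 <= s < n) se (w + s%:R * v))
   = ce (w - 1 / 2 * v) - ce (w + (n%:R - 1 / 2) * v).
Proof.
elim: n => [|n IH]; first by rewrite big_geq // mulr0 sub0r mulNr subrr.
rewrite big_nat_recr //= mulrDr IH -[n.+1]addn1 (natrD _ n 1).
have -> : w + (n%:R + 1 - 1 / 2) * v = (w + n%:R * v) + v / 2 by lra.
have -> : w + (n%:R - 1 / 2) * v = (w + n%:R * v) - v / 2 by lra.
set z := w + n%:R * v.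
have -> : sin (pi * v) = se (v / 2) by rewrite /se; congr sin; field.
by rewrite !ceD seN ceN; ring.
Qed.

Lemma sin_pi_frac_ge (h q : nat) : (0 < h)%N -> (2 * h <= q)%N ->
  h%:R / q%:R <= sin (pi * (h%:R / q%:R)) :> R.
Proof.
move=> h0 hq; apply: sin_pi_ge.
have q0 : 0 < q%:R :> R by rewrite ltr0n; lia.
apply/andP; split; first by rewrite divr_ge0.
by rewrite ler_pdivrMr // mul1r ler_pdivlMl // -natrM ler_nat.
Qed.

(** Orthogonality of the nontrivial characters of Z / q to the trivial one. *)
Lemma sum_ce_roots (h q : nat) t : (0 < h)%N -> (2 * h <= q)%N ->
  \sum_(0 <= s < q) ce (h%:R * (t - s%:R / q%:R)) = 0.
Proof.
move=> h0 hq.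
have q0 : 0 < q%:R :> R by rewrite ltr0n; lia.
have sn0 : 0 < sin (pi * (h%:R / q%:R)) :> R.
  by apply: lt_le_trans (sin_pi_frac_ge h0 hq); rewrite divr_gt0 // ltr0n.
have e : forall s, ce (h%:R * (t - s%:R / q%:R))
     = ce (- (h%:R * t) + s%:R * (h%:R / q%:R)).
  by move=> s; rewrite -ceN; congr ce; field; rewrite gt_eqF.
under eq_bigr do rewrite e.
have := ce_progression (h%:R / q%:R) (- (h%:R * t)) q.
have -> : - (h%:R * t) + (q%:R - 1 / 2) * (h%:R / q%:R)
   = (- (h%:R * t) - 1 / 2 * (h%:R / q%:R)) + h%:R :> R.
  by field; rewrite gt_eqF.
have seDn z : se (z + h%:R) = se z :> R.
  by rewrite seD ce_natr se_natr mulr0 addr0 mulr1.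
rewrite seDn subrr => /eqP; rewrite mulf_eq0 mulf_eq0 pnatr_eq0 /=.
by rewrite gt_eqF //= => /eqP.
Qed.

(** The Fejer kernel, normalised to take the value [1] at [0]. *)
Definition fejer (H : nat) u : R :=
  ((\sum_(0 <= j < H) ce (j%:R * u)) ^+ 2
   + (\sum_(0 <= j < H) se (j%:R * u)) ^+ 2) / H%:R ^+ 2.

Lemma fejer_ge0 H u : 0 <= fejer H u.
Proof. by rewrite divr_ge0 ?exprn_ge0 // addr_ge0 // sqr_ge0. Qed.

Lemma fejerE H u :
  fejer H u = (\sum_(0 <= i < H) \sum_(0 <= j < H) ce ((natdist i j)%:R * u))
              / H%:R ^+ 2.
Proof.
rewrite /fejer; congr (_ / _).
have := gram_ce (index_iota 0 H) xpredT (fun=> 1) (fun j => j%:R * u).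
under eq_bigr do rewrite mul1r.
under [X in _ + X ^+ 2 = _]eq_bigr do rewrite mul1r.
move=> ->; apply: eq_bigr => i _; apply: eq_bigr => j _.
by rewrite !mul1r ce_natdist.
Qed.

Lemma fejer_le1 H u : fejer H u <= 1.
Proof.
case: (posnP H) => [->|H0]; first by rewrite /fejer expr0n /= invr0 mulr0.
have h0 : 0 < H%:R ^+ 2 :> R by rewrite exprn_gt0 // ltr0n.
rewrite fejerE ler_pdivrMr // mul1r.
apply: (@le_trans _ _ (\sum_(0 <= i < H) \sum_(0 <= j < H) 1)).
  apply: ler_sum => i _; apply: ler_sum => j _.
  by have := ce_norm ((natdist i j)%:R * u); rewrite ler_norml => /andP[].
by rewrite !sumr_const_nat subn0 -mulrnA -natrX; rewrite mulnn.
Qed.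

Lemma fejerN H u : fejer H (- u) = fejer H u.
Proof.
by rewrite !fejerE; congr (_ / _); apply: eq_bigr => i _; apply: eq_bigr => j _;
  rewrite mulrN ceN.
Qed.

Lemma fejer_le H u : fejer H u * (H%:R * sin (pi * u)) ^+ 2 <= 1.
Proof.
case: (posnP H) => [->|H0]; first by rewrite mul0r expr0n mulr0.
have h0 : 0 < H%:R :> R by rewrite ltr0n.
rewrite /fejer exprMn mulrA divfK ?expf_neq0 ?gt_eqF //.
have := se_progression u 0 H; have := ce_progression u 0 H.
under eq_bigr do rewrite add0r.
under [X in _ -> 2 * sin _ * X = _ -> _]eq_bigr do rewrite add0r.
move=> c s.
rewrite mulrDl -!exprMn.
rewrite (mulrC (\sum_(0 <= j < H) ce _)) (mulrC (\sum_(0 <= j < H) se _)).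
move: c s; rewrite -!mulrA !add0r; set a := sin _ * _; set b := sin _ * _.
set x1 := (H%:R - 1 / 2) * u; set x2 := - (1 * (2^-1 * u)).
have := ce2Dse2 x1; have := ce2Dse2 x2.
have := sqr_ge0 (ce x1 + ce x2); have := sqr_ge0 (se x1 + se x2).
move=> h1 h2 h3 h4 c s.

have -> : a = (se x1 - se x2) / 2 by lra.
have -> : b = (ce x2 - ce x1) / 2 by lra.
lra.
Qed.

(** On a grid cell of width [1 / (4 H)] the kernel centred at the left end stays
    bounded below; this is how kernels detect the points of a cell. *)
Lemma fejer_ge H u : (0 < H)%N -> 0 <= u <= (4 * H%:R)^-1 -> 1 / 4 <= fejer H u.
Proof.
move=> H0 /andP[u0 u1].
have h0 : 0 < H%:R :> R by rewrite ltr0n.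
(* rotating the geometric sum to be symmetric brings its phases below 1 / 8 *)
pose c := (H%:R - 1) / 2 * u.
pose A := \sum_(0 <= j < H) ce (j%:R * u).
pose B := \sum_(0 <= j < H) se (j%:R * u).
have hC : \sum_(0 <= j < H) ce (j%:R * u - c) = A * ce c + B * se c.
  rewrite mulr_suml mulr_suml -big_split /=.
  by apply: eq_bigr => j _; rewrite ceB.
have hS : \sum_(0 <= j < H) se (j%:R * u - c) = B * ce c - A * se c.
  rewrite mulr_suml mulr_suml -sumrB.
  by apply: eq_bigr => j _; rewrite seD ceN seN mulrN.
have hR : A ^+ 2 + B ^+ 2 >= (\sum_(0 <= j < H) ce (j%:R * u - c)) ^+ 2.
  have e := ce2Dse2 c.
  have -> : A ^+ 2 + B ^+ 2 = (A * ce c + B * se c) ^+ 2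
      + (B * ce c - A * se c) ^+ 2.
    by rewrite -[A ^+ 2]mulr1 -[B ^+ 2]mulr1 -e; ring.
  by rewrite hC lerDl sqr_ge0.
have hL : H%:R / 2 <= \sum_(0 <= j < H) ce (j%:R * u - c).
  have -> : H%:R / 2 = \sum_(0 <= j < H) (1 / 2 : R).
    by rewrite sumr_const_nat subn0 mulr_natl mul1r.
  rewrite big_nat [leRHS]big_nat; apply: ler_sum => j /andP[_ jH].
  have -> : j%:R * u - c = (j%:R - (H%:R - 1) / 2) * u by rewrite /c; ring.
  set z := _ * u.
  have uH : u * (4 * H%:R) <= 1 by rewrite -ler_pdivlMr ?mulr_gt0 // mul1r.
  have hz : `|z| <= 1 / 8.
    rewrite /z normrM (ger0_norm u0).
    have hj : `|j%:R - (H%:R - 1) / 2| <= H%:R / 2 :> R.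
      have : j%:R + 1 <= H%:R :> R by rewrite natr1 ler_nat.
      have : 0 <= j%:R :> R by [].
      by rewrite ler_norml => ? ?; apply/andP; split; lra.
    by have := ler_wpM2r u0 hj; lra.
  have p0 : 0 < pi :> R := pi_gt0 R.
  rewrite -[ce z]/(cos (2 * pi * z)) -cos_norm normrM ger0_norm; last first.
    by rewrite mulr_ge0 // ltW.
  have hz1 : 2 * pi * `|z| <= pi / 4.
    by have := ler_wpM2l (ltW p0) hz; lra.
  apply: (le_trans cos_piquarter_ge).
  have z0 := normr_ge0 z.
  case: (ltrgtP (2 * pi * `|z|) (pi / 4)) hz1 => // [hlt _|-> //].
  have hz0 : 0 <= 2 * pi * `|z| by rewrite mulr_ge0 // mulr_ge0 // ltW.
  by rewrite ltW // ltr_cos ?in_itv /=; lra.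
rewrite /fejer ler_pdivlMr ?exprn_gt0 //; apply: le_trans hR.
have : (H%:R / 2) ^+ 2 <= (\sum_(0 <= j < H) ce (j%:R * u - c)) ^+ 2 :> R.
  by rewrite ler_pXn2r ?nnegrE //; apply: le_trans hL; lra.
by rewrite expr_div_n; lra.
Qed.

(** Only the constant frequency survives the summation of the translates of the
    kernel over a grid finer than its bandwidth. *)
Lemma fejer_partition H (t : R) : (0 < H)%N ->
  \sum_(0 <= s < 4 * H) fejer H (t - s%:R / (4 * H)%:R) = 4.
Proof.
move=> H0; have h0 : 0 < H%:R :> R by rewrite ltr0n.
under eq_bigr do rewrite fejerE.
rewrite -mulr_suml exchange_big /=.
under eq_bigr do rewrite exchange_big /=.
have -> : \sum_(0 <= i < H) \sum_(0 <= j < H) \sum_(0 <= s < 4 * H)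
     ce ((natdist i j)%:R * (t - s%:R / (4 * H)%:R))
   = \sum_(0 <= i < H) (4 * H)%:R.
  apply: eq_big_nat => i /andP[_ iH].
  rewrite (bigD1_seq i) /= ?mem_index_iota ?iota_uniq //.
  rewrite [X in _ + X]big1_seq ?addr0.
    rewrite /natdist subnn addn0.
    under eq_bigr do rewrite mul0r ce0.
    by rewrite sumr_const_nat subn0.
  move=> j; rewrite mem_index_iota => /andP[ji /andP[_ jH]].
  by apply: sum_ce_roots; rewrite /natdist; lia.
rewrite sumr_const_nat subn0 -mulr_natr natrM; field.
by rewrite gt_eqF.
Qed.

End Fourier.

Section FejerReach.
Context {R : realType}.

Lemma natr_gt0 (n : nat) : (0 < n)%N -> 0 < n%:R :> R.
Proof. by rewrite ltr0n. Qed.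

Lemma harmonic_sum_ge1 n : (0 < n)%N -> 1 <= harmonic_sum n :> R.
Proof.
case: n => // n _; rewrite /harmonic_sum big_nat_recl //= invr1 lerDl.
by apply: sumr_ge0 => i _; rewrite invr_ge0.
Qed.

Lemma harmonic_sum_rev n :
  \sum_(0 <= h < n) ((n - h)%:R)^-1 = harmonic_sum n :> R.
Proof.
rewrite big_nat_rev /=; apply: eq_big_nat => i hi.
by congr (_ %:R ^-1); lia.
Qed.

(** How far the kernel centred at a grid point [s / q] can reach a point of the
    cell [s0]: the product decays with the distance of the two cells, except
    when the point and the grid point are close modulo [1] only, where the
    kernel decays with the distance around the circle. *)
Lemma fejer_reach H (u : R) (s s0 : nat) (q := (4 * H)%N) : (0 < H)%N ->
  0 <= u < 1 -> (s < q)%N -> (s0 < q)%N -> s0%:R <= u * q%:R < s0%:R + 1 ->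
  `|u - s%:R / q%:R| * fejer H (u - s%:R / q%:R)
  <= 48 / (q%:R * (natdist s s0).+1%:R) + 64 / (q - natdist s s0)%:R ^+ 2.
Proof.
move=> H0 /andP[u0 u1] sq s0q /andP[us us1].
have q0 : 0 < q%:R :> R by apply: natr_gt0; rewrite /q; lia.
have qE : q%:R = 4 * H%:R :> R by rewrite /q natrM.
have qn0 : q%:R != 0 :> R by rewrite gt_eqF.
set x := u - s%:R / q%:R; set j := natdist s s0.
pose v : R := `|x|; pose V : R := v * q%:R.
have jq : (j < q)%N by rewrite /j /natdist; lia.
have xq : x * q%:R = u * q%:R - s%:R by rewrite /x mulrBl divfK.
have sq1 : s%:R + 1 <= q%:R :> R by rewrite natr1 ler_nat.
have VE : V = `|u * q%:R - s%:R| by rewrite -xq normrM (gtr0_norm q0).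
have [V1 V2] : V <= j%:R + 1 /\ j%:R <= V + 1.
  rewrite VE.
  rewrite /j /natdist; case: (leqP s s0) => h.
    have -> : ((s - s0) + (s0 - s) = s0 - s)%N by lia.
    rewrite natrB //.
    have : s%:R <= s0%:R :> R by rewrite ler_nat.
    by move=> hs; rewrite ger0_norm; [split; lra|lra].
  have -> : ((s - s0) + (s0 - s) = s - s0)%N by lia.
  rewrite natrB 1?ltnW //.
  have : s0%:R + 1 <= s%:R :> R by rewrite natr1 ler_nat.
  by move=> hs; rewrite ler0_norm; [split; lra|lra].
have uq1 : u * q%:R < q%:R by rewrite -[ltRHS]mul1r ltr_pM2r.
have uq0 : 0 <= u * q%:R by rewrite mulr_ge0.
have V0 : 0 <= V by rewrite mulr_ge0 // normr_ge0.
have Vq : V < q%:R.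
  rewrite VE ltr_norml.
  have : 0 <= s%:R :> R by [].
  by move=> ?; apply/andP; split; lra.
have v1 : v < 1 by rewrite -(ltr_pM2r q0) mul1r.
pose F := fejer H x.
have F0 : 0 <= F := fejer_ge0 _ _.
have F1 : F <= 1 := fejer_le1 _ _.
have Fsin : F * (H%:R * sin (pi * v)) ^+ 2 <= 1.
  have -> : F = fejer H v by rewrite /F /v; case: (ger0P x); rewrite ?fejerN.
  exact: fejer_le.
have v0 : 0 <= v := normr_ge0 _.
have h0 : 0 < H%:R :> R by apply: natr_gt0.
have far z : 0 <= z -> z <= sin (pi * v) -> F * (z * q%:R) ^+ 2 <= 16.
  move=> z0 zs.
  have : F * (H%:R * z) ^+ 2 <= F * (H%:R * sin (pi * v)) ^+ 2.
    rewrite ler_wpM2l // ler_pXn2r ?nnegrE ?mulr_ge0 ?ler_pM2l //.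
    exact: le_trans zs.
  by rewrite qE !exprMn; rewrite !exprMn in Fsin *; lra.
have j0 : 0 <= j%:R :> R by [].
have j1 : 0 < j.+1%:R :> R by apply: natr_gt0.
have pt1 : 0 <= 48 / (q%:R * j.+1%:R) :> R.
  by rewrite divr_ge0 // mulr_ge0 // ltW.
have qj0 : 0 < (q - j)%:R :> R by rewrite natr_gt0 // subn_gt0.
have pt2 : 0 <= 64 / (q - j)%:R ^+ 2 :> R by rewrite divr_ge0 // exprn_ge0 // ltW.
rewrite -/v -/F; case: (lerP v (1 / 2)) => hv.
  apply: (@le_trans _ _ (48 / (q%:R * j.+1%:R))); last by rewrite lerDl.
  have FV : F * V ^+ 2 <= 16 by apply: far => //; apply: sin_pi_ge; rewrite v0.
  rewrite ler_pdivlMr ?mulr_gt0 //.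
  have -> : v * F * (q%:R * j.+1%:R) = F * V * (j%:R + 1).
    by rewrite natr1 /V; ring.
  have FV0 : 0 <= F * V by rewrite mulr_ge0.
  case: (lerP (j%:R + 1) (3 * V)) => hj.
    by have := ler_wpM2l FV0 hj; move: FV; rewrite expr2; lra.
  have j2 : j%:R + 1 <= 3 :> R by lra.
  have FV1 : F * V <= V by rewrite -[leRHS]mul1r ler_wpM2r.
  have := ler_wpM2l FV0 j2; lra.
apply: (@le_trans _ _ (64 / (q - j)%:R ^+ 2)); last by rewrite lerDr.
have vF : v * F <= F by rewrite -[leRHS]mul1r ler_wpM2r // ltW.
apply: (le_trans vF); rewrite ler_pdivlMr ?exprn_gt0 //.
pose W := (1 - v) * q%:R.
have WE : W = q%:R - V by rewrite /W mulrBl mul1r.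
have FW : F * W ^+ 2 <= 16.
  apply: far; first lra.
  have -> : sin (pi * v) = sin (pi * (1 - v)).
    by rewrite -[RHS]opprK -sinN -(sinDpi (R := R)); congr (sin _); ring.
  by apply: sin_pi_ge; apply/andP; split; lra.
set i := (q - j)%:R in qj0 pt2 *.
have iE : i = q%:R - j%:R by rewrite /i natrB // ltnW.
have W0 : 0 <= W by rewrite WE; lra.
case: (lerP i (2 * W)) => hi.
  have : i ^+ 2 <= (2 * W) ^+ 2.
    by rewrite lerXn2r ?nnegrE //; lra.
  by move=> h; have := ler_wpM2l F0 h; rewrite exprMn; lra.
have i2 : i <= 2 by lra.
have : i ^+ 2 <= 2 ^+ 2 by rewrite lerXn2r ?nnegrE //; lra.
move=> h; have := ler_pM F0 (exprn_ge0 2 (ltW qj0)) F1 h; lra.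
Qed.

End FejerReach.

Section SmoothedSawtooth.
Context {R : realType}.

Section Sequence.
Variables (I : Type) (r : seq I) (w y : I -> R).
Hypothesis w0 : forall i, 0 <= w i.

(** The modulus of the weighted exponential sum of frequency [h], up to a factor
    [sqrt 2]. *)
Definition weyl_sum (h : nat) : R :=
  `|\sum_(i <- r) w i * ce (h%:R * y i)| + `|\sum_(i <- r) w i * se (h%:R * y i)|.

Let Tw := weyl_sum.

Lemma weyl_sum_ge0 h : 0 <= Tw h. Proof. by rewrite addr_ge0. Qed.

Lemma weyl_sum0 : Tw 0 = \sum_(i <- r) w i.
Proof.
rewrite /Tw /weyl_sum.
under eq_bigr do rewrite mul0r ce0 mulr1.
under [X in _ + `|X|]eq_bigr do rewrite mul0r se0 mulr0.
rewrite big1_eq normr0 addr0 ger0_norm //.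
refine (sumr_ge0 _ _) => i _; exact: w0.
Qed.

Lemma weyl_sum_shift h (z : R) :
  \sum_(i <- r) w i * ce (h%:R * (y i - z))
   = ce (h%:R * z) * (\sum_(i <- r) w i * ce (h%:R * y i))
   + se (h%:R * z) * (\sum_(i <- r) w i * se (h%:R * y i)).
Proof.
rewrite !mulr_sumr -big_split /=; apply: eq_bigr => i _.
by rewrite mulrBr ceB; ring.
Qed.

Variable H : nat.
Hypothesis H0 : (0 < H)%N.
Let q := (4 * H)%N.

Let h0 : 0 < H%:R :> R. Proof. exact: natr_gt0. Qed.
Let q0 : 0 < q%:R :> R. Proof. by apply: natr_gt0; rewrite /q; lia. Qed.

Let Z := Tw 0 / H%:R + \sum_(1 <= h < H) Tw h / h%:R.

Let Z0 : 0 <= Z.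
Proof.
rewrite addr_ge0 ?divr_ge0 ?weyl_sum_ge0 ?(ltW h0) //.
by refine (sumr_ge0 _ _) => h _; rewrite divr_ge0 ?weyl_sum_ge0.
Qed.

Let sum_TZ : (\sum_(0 <= h < H) Tw h) / H%:R <= Z.
Proof.
rewrite /Z big_ltn // mulrDl lerD2l mulr_suml big_nat [leRHS]big_nat.
apply: ler_sum => h /andP[h1 hH].
rewrite ler_wpM2l ?weyl_sum_ge0 // lef_pV2 ?posrE ?natr_gt0 //.
by rewrite ler_nat ltnW.
Qed.

Let expand (c : R) : \sum_(i <- r) w i * fejer H (y i - c)
  = (\sum_(0 <= a < H) \sum_(0 <= b < H)
       \sum_(i <- r) w i * ce ((natdist a b)%:R * (y i - c))) / H%:R ^+ 2.
Proof.
under eq_bigr do rewrite fejerE mulrA.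
rewrite -mulr_suml; congr (_ / _).
under eq_bigr do rewrite mulr_sumr.
rewrite exchange_big /=; apply: eq_bigr => a _.
under eq_bigr do rewrite mulr_sumr.
by rewrite exchange_big.
Qed.

(** Little weight accumulates near any point [c], because the nonnegative kernel
    is a trigonometric polynomial of degree less than [H]. *)
Lemma fejer_mass_le (c : R) :
  \sum_(i <- r) w i * fejer H (y i - c) <= 2 * Z.
Proof.
rewrite expand; apply: (@le_trans _ _
   ((\sum_(0 <= a < H) \sum_(0 <= b < H) Tw (natdist a b)) / H%:R ^+ 2)).
  rewrite ler_pM2r ?invr_gt0 ?exprn_gt0 //.
  apply: ler_sum => a _; apply: ler_sum => b _.
  rewrite weyl_sum_shift; apply: le_trans (ler_norm _) _.
  apply: le_trans (ler_normD _ _) _; rewrite !normrM.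
  by rewrite lerD // -[leRHS]mul1r ler_wpM2r // ?ce_norm ?se_norm.
rewrite ler_pdivrMr ?exprn_gt0 //.
apply: (le_trans (sum_natdist_le _ _)); first exact: weyl_sum_ge0.
rewrite -mulrA ler_pM2l // -ler_pdivrMr ?exprn_gt0 //.
apply: le_trans sum_TZ.
rewrite ler_pdivrMr ?exprn_gt0 // expr2 mulrA divfK ?gt_eqF //.
rewrite mulrC mulr_sumr; apply: ler_sum => h _.
by rewrite ler_wpM2r ?weyl_sum_ge0 // ler_nat leq_subr.
Qed.

Let g (s : nat) : R := s%:R / q%:R - 1 / 2.

(** The finite Fourier coefficients of the sampled sawtooth decay like those of
    the sawtooth itself. *)
Lemma sawtooth_coef_le (h : nat) (c : R) : (0 < h < H)%N ->
  `|\sum_(0 <= s < q) g s * ce (h%:R * (s%:R / q%:R) - c)|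
   <= 6 * (q%:R / h%:R).
Proof.
move=> /andP[hh0 hH].
have hr0 : 0 < h%:R :> R := natr_gt0 hh0.
have -> : 6 * (q%:R / h%:R) = 4 * (1 / 2 * (3 / (h%:R / q%:R))) :> R.
  by field; rewrite !gt_eqF.
have t4 : h%:R / q%:R <= 1 / 4 :> R.
  rewrite ler_pdivrMr // mulrC mulrA mulr1.
  by rewrite ler_pdivlMr // -natrM ler_nat /q; lia.
have t0 : 0 < h%:R / q%:R :> R by rewrite divr_gt0.
apply: abel_sum_bound => //.
- move=> s /andP[_ sq]; rewrite /g ler_norml.
  have : 0 <= s%:R / q%:R :> R by rewrite divr_ge0.
  have : s%:R / q%:R <= 1 :> R by rewrite ler_pdivrMr // mul1r ler_nat ltnW.
  by move=> ? ?; apply/andP; split; lra.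
- by move=> s _ _; rewrite /g lerD2r ler_pM2r ?invr_gt0 // ler_nat.
- move=> n _.
  apply: (@kusmin_landau _ (fun s => h%:R * (s%:R / q%:R) - c)) => //; first lra.
    move=> s _; have -> : h%:R * (s.+1%:R / q%:R) - c - (h%:R * (s%:R / q%:R) - c)
      = h%:R / q%:R :> R by rewrite -natr1; ring.
    by rewrite lexx /=; lra.
  by move=> s _ _; rewrite -!natr1; lra.
Qed.

Lemma sawtooth_mean : \sum_(0 <= s < q) g s = - (1 / 2).
Proof.
have E n : \sum_(0 <= s < n) (s%:R : R) = n%:R * (n%:R - 1) / 2.
  elim: n => [|n IH]; first by rewrite big_geq // mul0r mul0r.
  by rewrite big_nat_recr //= IH -natr1; field.
rewrite /g sumrB -mulr_suml E sumr_const_nat subn0 -[_ *+ q]mulr_natl.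
by field; rewrite gt_eqF.
Qed.

(** Convolving the samples of the sawtooth with the kernel leaves a trigonometric
    polynomial, whose coefficients are bounded by [sawtooth_coef_le]. *)
Lemma sawtooth_smoothed_le :
  `|\sum_(i <- r) w i * (\sum_(0 <= s < q) g s * fejer H (y i - s%:R / q%:R))|
   <= 100 * Z.
Proof.
have -> : \sum_(i <- r) w i * (\sum_(0 <= s < q) g s * fejer H (y i - s%:R / q%:R))
  = (\sum_(0 <= a < H) \sum_(0 <= b < H) \sum_(0 <= s < q)
      g s * \sum_(i <- r) w i * ce ((natdist a b)%:R * (y i - s%:R / q%:R)))
     / H%:R ^+ 2.
  under eq_bigr do rewrite mulr_sumr.
  rewrite exchange_big /=.
  under eq_bigr => s _.
    under eq_bigr do rewrite mulrCA.
    rewrite -mulr_sumr expand mulrA mulr_sumr.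
    under eq_bigr do rewrite mulr_sumr.
    over.
  rewrite -mulr_suml; congr (_ / _); rewrite exchange_big /=.
  by apply: eq_bigr => a _; rewrite exchange_big.
pose M h := if h is 0%N then Tw 0 / 2 else 12 * (q%:R / h%:R) * Tw h.
have M0 h : 0 <= M h.
  case: h => [|h]; first by rewrite mulr_ge0 ?weyl_sum_ge0.
  by rewrite mulr_ge0 ?weyl_sum_ge0 // mulr_ge0 // divr_ge0 //.
have inner h : (h < H)%N -> `|\sum_(0 <= s < q)
    g s * \sum_(i <- r) w i * ce (h%:R * (y i - s%:R / q%:R))| <= M h.
  move=> hH; case: h hH => [|h] hH.
    under eq_bigr => s _.
      under eq_bigr do rewrite mul0r ce0 mulr1.
      rewrite -weyl_sum0 mulrC.
      over.
    rewrite -mulr_sumr sawtooth_mean normrM normrN (ger0_norm (weyl_sum_ge0 _)).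
    by rewrite ger0_norm /M; lra.
  under eq_bigr => s _ do rewrite weyl_sum_shift mulrDr 2!(mulrA (g s)).
  rewrite big_split /= -!mulr_suml.
  apply: le_trans (ler_normD _ _) _; rewrite !normrM.
  have b1 := @sawtooth_coef_le h.+1 0 hH.
  have b2 := @sawtooth_coef_le h.+1 (1 / 4) hH.
  have {}b1 : `|\sum_(0 <= s < q) g s * ce (h.+1%:R * (s%:R / q%:R))|
     <= 6 * (q%:R / h.+1%:R).
    by move: b1; under eq_bigr do rewrite subr0.
  have {}b2 : `|\sum_(0 <= s < q) g s * se (h.+1%:R * (s%:R / q%:R))|
     <= 6 * (q%:R / h.+1%:R).
    by move: b2; under eq_bigr do rewrite -seE.
  have c1 := normr_ge0 (\sum_(i <- r) w i * ce (h.+1%:R * y i)).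
  have c2 := normr_ge0 (\sum_(i <- r) w i * se (h.+1%:R * y i)).
  apply: (le_trans (lerD (ler_wpM2r c1 b1) (ler_wpM2r c2 b2))).
  rewrite -mulrDr -/(weyl_sum _) -/Tw.
  apply: ler_wpM2r; first exact: weyl_sum_ge0.
  by rewrite ler_wpM2r ?divr_ge0 // ler_nat.
rewrite normrM normfV (ger0_norm (x := H%:R ^+ 2)) ?exprn_ge0 // ?(ltW h0).
rewrite ler_pdivrMr ?exprn_gt0 //.
apply: (@le_trans _ _ (\sum_(0 <= a < H) \sum_(0 <= b < H) M (natdist a b))).
  apply: (le_trans (ler_norm_sum _ _ _)); rewrite big_nat [leRHS]big_nat.
  apply: ler_sum => a /andP[_ aH].
  apply: (le_trans (ler_norm_sum _ _ _)); rewrite big_nat [leRHS]big_nat.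
  by apply: ler_sum => b /andP[_ bH]; apply: inner; rewrite /natdist; lia.
apply: (le_trans (sum_natdist_le _ M0)).
have : \sum_(0 <= h < H) (H - h)%:R * M h <= H%:R * \sum_(0 <= h < H) M h.
  rewrite mulr_sumr; apply: ler_sum => h _.
  by rewrite ler_wpM2r // ler_nat leq_subr.
have : \sum_(0 <= h < H) M h <= 48 * H%:R * Z.
  rewrite /Z big_ltn // mulrDr [X in _ <= X + _](_ : _ = 48 * Tw 0); last first.
    by field; rewrite gt_eqF.
  apply: lerD; first by rewrite /M; have := weyl_sum_ge0 0; rewrite -/(Tw 0); lra.
  rewrite mulr_sumr big_nat [leRHS]big_nat; apply: ler_sum => h /andP[h1 hH].
  have hr : 0 < h%:R :> R := natr_gt0 h1.
  rewrite /M; case: h h1 hH hr => // h _ _ hr; rewrite /q natrM.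
  by rewrite le_eqVlt; apply/orP; left; apply/eqP; field; rewrite gt_eqF.
move=> e1 e2.
have := ler_wpM2l (ltW h0) e1.
have HZ : 0 <= H%:R ^+ 2 * Z by rewrite mulr_ge0 // exprn_ge0 //.
rewrite expr2 in HZ *; lra.
Qed.

End Sequence.
End SmoothedSawtooth.

Section ErdosTuran.
Context {R : realType}.
Variables (I : Type) (r : seq I) (w : I -> R).
Hypothesis w0 : forall i, 0 <= w i.

(** The smoothing error at a point comes from the grid points within its reach.
    The weight of a cell is at most [fejer_mass_le], and summing [fejer_reach]
    over all pairs of cells costs one logarithm. *)
Lemma erdos_turan_unit (y : I -> R) (H : nat) : (0 < H)%N ->
  (forall i, 0 <= y i < 1) ->
  `|\sum_(i <- r) w i * (y i - 1 / 2)|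
  <= 500 * harmonic_sum (4 * H)
     * (weyl_sum r w y 0 / H%:R + \sum_(1 <= h < H) weyl_sum r w y h / h%:R).
Proof.
move=> H0 y01; set Z := _ + \sum_(1 <= h < H) _; pose q := (4 * H)%N.
have q0 : 0 < q%:R :> R by apply: natr_gt0; rewrite /q; lia.
have h0 : 0 < H%:R :> R by apply: natr_gt0.
pose F s i := fejer H (y i - s%:R / q%:R).
pose g s : R := s%:R / q%:R - 1 / 2.
pose cell i := Num.truncn (y i * q%:R).
have yq i : 0 <= y i * q%:R by rewrite mulr_ge0 //; case/andP: (y01 i).
have cellP i : (cell i)%:R <= y i * q%:R < (cell i)%:R + 1.
  by rewrite natr1; exact: truncn_itv.
have cellq i : (cell i < q)%N.
  have /andP[c1 _] := cellP i; rewrite -(ltr_nat R); apply: (le_lt_trans c1).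
  by rewrite -[ltRHS]mul1r ltr_pM2r //; case/andP: (y01 i).
pose G j : R := 48 / (q%:R * j.+1%:R) + 64 / (q - j)%:R ^+ 2.
have G0 j : 0 <= G j by rewrite addr_ge0 // divr_ge0 // ?mulr_ge0 // exprn_ge0.
have F0 s i : 0 <= F s i by exact: fejer_ge0.
(* the translates of the kernel have sum 4, so the sawtooth is its smoothing
   plus an average of differences *)
have split_sum : \sum_(i <- r) w i * (y i - 1 / 2)
   = 4^-1 * \sum_(i <- r) w i * (\sum_(0 <= s < q) g s * F s i)
   + 4^-1 * \sum_(i <- r) w i *
       (\sum_(0 <= s < q) (y i - s%:R / q%:R) * F s i).
  rewrite -mulrDr -big_split /= mulr_sumr; apply: eq_bigr => i _.
  rewrite -mulrDr -big_split /= mulrCA; congr (_ * _).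
  under eq_bigr => s _.
    rewrite -mulrDl (_ : g s + _ = y i - 1 / 2); last by rewrite /g; ring.
    over.
  by rewrite -mulr_sumr fejer_partition //; field.
have main := sawtooth_smoothed_le r y w0 H0.
have cell_own i : 1 / 4 <= F (cell i) i.
  apply: fejer_ge => //; have /andP[c1 c2] := cellP i.
  have -> : y i - (cell i)%:R / q%:R = (y i * q%:R - (cell i)%:R) / q%:R.
    by field; rewrite gt_eqF.
  rewrite -natrM -/q; apply/andP; split; first by rewrite divr_ge0 // subr_ge0.
  by rewrite ler_pdivrMr // mulVf ?gt_eqF //; lra.
have err i : `|\sum_(0 <= s < q) (y i - s%:R / q%:R) * F s i|
    <= 4 * \sum_(0 <= c < q) (\sum_(0 <= s < q) G (natdist s c)) * F c i.
  apply: (@le_trans _ _ (\sum_(0 <= s < q) G (natdist s (cell i)))).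
    apply: (le_trans (ler_norm_sum _ _ _)); rewrite big_nat [leRHS]big_nat.
    apply: ler_sum => s /andP[_ sq]; rewrite normrM (ger0_norm (F0 _ _)).
    exact: fejer_reach.
  have S0 c : 0 <= \sum_(0 <= s < q) G (natdist s c).
    by refine (sumr_ge0 _ _) => s _; exact: G0.
  rewrite [X in _ <= _ * X](bigD1_seq (cell i)) /= ?mem_index_iota ?iota_uniq ?cellq //.
  rewrite mulrDr -[leLHS]addr0; apply: lerD.
    have := ler_wpM2l (S0 (cell i)) (cell_own i); lra.
  by rewrite mulr_ge0 //; refine (sumr_ge0 _ _) => c _; rewrite mulr_ge0.
have total : `|\sum_(i <- r) w i *
       (\sum_(0 <= s < q) (y i - s%:R / q%:R) * F s i)|
    <= 4 * ((\sum_(0 <= c < q) \sum_(0 <= s < q) G (natdist s c)) * (2 * Z)).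
  apply: (le_trans (ler_norm_sum _ _ _)).
  apply: (@le_trans _ _ (\sum_(i <- r) w i *
     (4 * \sum_(0 <= c < q) (\sum_(0 <= s < q) G (natdist s c)) * F c i))).
    apply: ler_sum => i _; rewrite normrM (ger0_norm (w0 i)).
    by rewrite ler_wpM2l.
  under eq_bigr do rewrite mulrCA mulr_sumr.
  rewrite -mulr_sumr ler_pM2l // exchange_big /= mulr_suml.
  apply: ler_sum => c _.
  under eq_bigr do rewrite mulrCA.
  rewrite -mulr_sumr; apply: ler_wpM2l; last exact: fejer_mass_le.
  by refine (sumr_ge0 _ _) => s _; exact: G0.
have sumG : \sum_(0 <= c < q) \sum_(0 <= s < q) G (natdist s c)
    <= 224 * harmonic_sum q.
  rewrite exchange_big /=; apply: (le_trans (sum_natdist_le _ G0)).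
  apply: (@le_trans _ _ (2 * \sum_(0 <= h < q)
      (48 * (h.+1%:R)^-1 + 64 * ((q - h)%:R)^-1))).
    rewrite ler_pM2l // big_nat [leRHS]big_nat; apply: ler_sum => h /andP[_ hq].
    have qh0 : 0 < (q - h)%:R :> R by rewrite natr_gt0 // subn_gt0.
    have hq0 : 0 < h.+1%:R :> R by rewrite natr_gt0.
    rewrite /G mulrDr; apply: lerD; last first.
      by rewrite le_eqVlt; apply/orP; left; apply/eqP; field; rewrite gt_eqF.
    have -> : (q - h)%:R * (48 / (q%:R * h.+1%:R))
      = 48 * (h.+1%:R)^-1 * ((q - h)%:R / q%:R) :> R.
      by field; rewrite !gt_eqF.
    rewrite -[leRHS]mulr1 ler_wpM2l ?mulr_ge0 ?invr_ge0 //.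
    by rewrite ler_pdivrMr // mul1r ler_nat leq_subr.
  rewrite big_split /= -!mulr_sumr harmonic_sum_rev -/(harmonic_sum q).
  lra.
have Z0 : 0 <= Z.
  rewrite addr_ge0 ?divr_ge0 ?weyl_sum_ge0 ?(ltW h0) //.
  by refine (sumr_ge0 _ _) => h _; rewrite divr_ge0 ?weyl_sum_ge0.
have L1 : 1 <= harmonic_sum q :> R by apply: harmonic_sum_ge1; rewrite /q; lia.
have e1 := ler_wpM2r Z0 sumG.
have e2 := ler_wpM2r Z0 L1.
rewrite split_sum; apply: (le_trans (ler_normD _ _)).
rewrite !normrM (ger0_norm (x := 4^-1)) ?invr_ge0 //.
rewrite -/Z in main.
move: main total; rewrite -/q -/Z.
set A := `|_|; set B := `|_|; set S := \sum_(0 <= c < q) _ in e1 *.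
set L := harmonic_sum _ in e1 e2 *.
move=> main total; lra.
Qed.

(** The Erdos-Turan inequality for the sawtooth, with nonnegative weights: the
    sum is controlled by finitely many exponential sums, up to the contribution
    [1 / H] of the trivial frequency. *)
Lemma erdos_turan (y : I -> R) (H : nat) : (0 < H)%N ->
  (forall i, 0 <= y i) ->
  `|\sum_(i <- r) w i * sawtooth (y i)|
  <= 500 * harmonic_sum (4 * H)
     * ((\sum_(i <- r) w i) / H%:R + \sum_(1 <= h < H) weyl_sum r w y h / h%:R).
Proof.
move=> H0 y0; pose u i := y i - (Num.truncn (y i))%:R.
have u01 i : 0 <= u i < 1.
  by have /andP[h1 h2] := truncn_itv (y0 i); rewrite /u -natr1 in h2 *;
    apply/andP; split; lra.
have ws h : weyl_sum r w u h = weyl_sum r w y h.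
  rewrite /weyl_sum; congr (_ + _); congr (Num.norm _); apply: eq_bigr => i _; congr (_ * _).
    by rewrite mulrBr -natrM ceBn.
  by rewrite !seE mulrBr -natrM addrAC ceBn.
have := erdos_turan_unit H0 u01.
rewrite ws weyl_sum0 //.
by under [X in _ <= _ * (_ + X) -> _]eq_bigr do rewrite ws.
Qed.

End ErdosTuran.

(** * Vaughan's identity *)

Section Arithmetic.
Context {R : realType}.
Implicit Types (b c d m n p : nat).

Lemma vonMangoldt_ge0 n : 0 <= vonMangoldt R n.
Proof.
rewrite /vonMangoldt; case: (primes n) => [|p [|? ?]] //.
by case: p => [|p]; [rewrite ln0|rewrite ln_ge0 // ler1n].
Qed.

Lemma vonMangoldt_le n : (0 < n)%N -> vonMangoldt R n <= ln n%:R.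
Proof.
move=> n0; have ln0 : 0 <= ln n%:R :> R by rewrite ln_ge0 // ler1n.
rewrite /vonMangoldt; case E : (primes n) => [|p [|? ?]] //.
have : p \in primes n by rewrite E mem_head.
rewrite mem_primes => /and3P[pp _ pn].
by rewrite ler_ln ?posrE ?ltr0n ?(prime_gt0 pp) // ler_nat dvdn_leq.
Qed.

Definition moebius n : R :=
  if (0 < n)%N && all (fun p => logn p n <= 1)%N (primes n)
  then (- 1) ^+ size (primes n) else 0.

Lemma moebius_norm n : `|moebius n| <= 1.
Proof.
rewrite /moebius; case: ifP => _; last by rewrite normr0.
by rewrite normrX normrN1 expr1n.
Qed.

Lemma moebius1 : moebius 1 = 1.
Proof. by rewrite /moebius. Qed.

Lemma primes_prime_mul p c : prime p -> (0 < c)%N -> ~~ (p %| c)%N ->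
  perm_eq (primes (p * c)) (p :: primes c).
Proof.
move=> pp c0 pc; apply: uniq_perm.
- exact: primes_uniq.
- by rewrite /= primes_uniq andbT mem_primes pp c0 (negbTE pc).
- by move=> q; rewrite primesM ?(prime_gt0 pp) // primes_prime // !inE.
Qed.

Lemma moebius_prime_mul p c : prime p -> (0 < c)%N -> ~~ (p %| c)%N ->
  moebius (p * c) = - moebius c.
Proof.
move=> pp c0 pc; have P := primes_prime_mul pp c0 pc.
rewrite /moebius muln_gt0 prime_gt0 // c0 /= (perm_size P) (perm_all _ P) /=.
have -> : (logn p (p * c) <= 1)%N.
  by rewrite lognM ?(prime_gt0 pp) // logn_prime // eqxx lognE pp c0 (negbTE pc).
have -> : all (fun q => logn q (p * c) <= 1)%N (primes c)
        = all (fun q => logn q c <= 1)%N (primes c).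
  apply: eq_in_all => q; rewrite mem_primes => /and3P[qp _ qc].
  rewrite lognM ?(prime_gt0 pp) // logn_prime //.
  by case: eqVneq => // qE; rewrite -qE qc in pc.
by rewrite andTb; case: (all _ _); rewrite ?oppr0 ?exprS ?mulN1r.
Qed.

Lemma moebius_prime_mul0 p c : prime p -> (0 < c)%N -> (p %| c)%N ->
  moebius (p * c) = 0.
Proof.
move=> pp c0 pc; rewrite /moebius; case: ifP => // /andP[_ /allP] /(_ p).
rewrite mem_primes pp muln_gt0 prime_gt0 // c0 dvdn_mulr // => /(_ isT).
rewrite lognM ?(prime_gt0 pp) // logn_prime // eqxx add1n ltnS leqn0.
by rewrite lognE pp c0 pc.
Qed.

(** Cancellation under the pairing [c <-> p * c] of the divisors, for any prime
    [p] dividing [m]. *)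
Lemma sum_moebius_divisors m : (0 < m)%N ->
  \sum_(b <- divisors m) moebius b = (m == 1%N)%:R.
Proof.
move=> m0; case: eqVneq => [->|m1]; first by rewrite big_seq1 moebius1.
pose p := pdiv m.
have pp : prime p by apply: pdiv_prime; lia.
have pm : (p %| m)%N := pdiv_dvd m.
have mE : m = (p * (m %/ p))%N by rewrite mulnC divnK.
set m' := (m %/ p)%N in mE.
have m'0 : (0 < m')%N by case: (posnP m') mE m0 => // ->; rewrite muln0 => ->.
rewrite (bigID (fun b => p %| b)%N) /=.
have e1 : perm_eq [seq b <- divisors m | (p %| b)%N]
                  (map (muln p) (divisors m')).
  apply: uniq_perm.
  - by rewrite filter_uniq // divisors_uniq.
  - rewrite map_inj_uniq ?divisors_uniq // => x y /eqP.
    by rewrite eqn_pmul2l ?(prime_gt0 pp) // => /eqP.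
  - move=> b; rewrite mem_filter -dvdn_divisors //; apply/idP/mapP.
      move=> /andP[/dvdnP[c ->] h]; exists c; last by rewrite mulnC.
      rewrite -dvdn_divisors //; move: h; rewrite {1}mE mulnC.
      by rewrite dvdn_pmul2l // prime_gt0.
    move=> [c]; rewrite -dvdn_divisors // => cm ->.
    by rewrite dvdn_mulr //= {1}mE dvdn_pmul2l // prime_gt0.
have e2 : perm_eq [seq b <- divisors m | ~~ (p %| b)%N]
                  [seq b <- divisors m' | ~~ (p %| b)%N].
  apply: uniq_perm; rewrite ?filter_uniq ?divisors_uniq // => b.
  rewrite !mem_filter -!dvdn_divisors //; case: (boolP (p %| b)%N) => //= pb.
  by rewrite mE Gauss_dvdr // coprime_sym prime_coprime.
rewrite -big_filter (perm_big _ e1) -[X in _ + X]big_filter (perm_big _ e2) /=.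
rewrite big_map big_filter (bigID (fun b => p %| b)%N) /=.
rewrite [X in X + _ + _]big_seq_cond big1 ?add0r; last first.
  move=> c /andP[]; rewrite -dvdn_divisors // => cm pc.
  by rewrite moebius_prime_mul0 // (dvdn_gt0 m'0 cm).
rewrite -big_split /= big_seq_cond big1 // => c /andP[].
rewrite -dvdn_divisors // => cm pc.
by rewrite moebius_prime_mul // ?addNr // (dvdn_gt0 m'0 cm).
Qed.

Lemma sum_vonMangoldt_divisors m : (0 < m)%N ->
  \sum_(c <- divisors m) vonMangoldt R c = ln m%:R.
Proof.
elim/ltn_ind: m => m IH m0.
case: (eqVneq m 1%N) => [->|m1]; first by rewrite big_seq1 ln1.
pose p := pdiv m.
have pp : prime p by apply: pdiv_prime; lia.
have p1 : (1 < p)%N := prime_gt1 pp.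
have pm : (p %| m)%N := pdiv_dvd m.
have mE : m = (p * (m %/ p))%N by rewrite mulnC divnK.
set m' := (m %/ p)%N in mE.
have m'0 : (0 < m')%N by case: (posnP m') mE m0 => // ->; rewrite muln0 => ->.
have m'm : (m' < m)%N by rewrite mE ltn_Pmull.
have m'd : (m' %| m)%N by rewrite mE dvdn_mull.
rewrite (bigID (fun c => c %| m')%N) /=.
have -> : \sum_(c <- divisors m | (c %| m')%N) vonMangoldt R c = ln m'%:R.
  rewrite -IH // -big_filter; apply: perm_big; apply: uniq_perm.
  - by rewrite filter_uniq // divisors_uniq.
  - exact: divisors_uniq.
  - move=> c; rewrite mem_filter -!dvdn_divisors //.
    by case: (boolP (c %| m')%N) => //= cm; rewrite (dvdn_trans cm).
have lp : (0 < logn p m)%N by rewrite logn_gt0 mem_primes pp m0.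
have lm : logn p m = (logn p m').+1.
  by rewrite {1}mE lognM ?(prime_gt0 pp) // logn_prime // eqxx.
rewrite -[X in _ + X]big_filter (bigD1_seq (p ^ logn p m)%N) /=; last first.
- by rewrite filter_uniq // divisors_uniq.
- by rewrite mem_filter -dvdn_divisors // pfactor_dvdnn pfactor_dvdn // lm ltnn.
rewrite vonMangoldtX // big1_seq ?addr0.
  by rewrite mE natrM lnM ?posrE ?ltr0n ?(prime_gt0 pp) // addrC.
move=> c /andP[cp]; rewrite mem_filter -dvdn_divisors // => /andP[cm' cm].
apply/eqP/negPn/negP => /vonMangoldt_neq0[q [a [qp a0 cE]]].
subst c; case: (eqVneq q p) => [qE|qp'].
  subst q; rewrite pfactor_dvdn // in cm; rewrite pfactor_dvdn // in cm'.
  by case/negP: cp; apply/eqP; congr (_ ^ _)%N; lia.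
case/negP: cm'; rewrite mE Gauss_dvdr // in cm.
by rewrite coprimeXl // prime_coprime // dvdn_prime2.
Qed.

(** Summation over products: a sum over [m] and its divisors, rearranged by the
    complementary divisor. *)
Lemma sum_divisors_exchange (G : nat -> R) (F : nat -> nat -> R) (K : nat) :
  (forall m, (K <= m)%N -> G m = 0) ->
  \sum_(1 <= m < K) G m * (\sum_(c <- divisors m) F c (m %/ c)%N)
  = \sum_(1 <= c < K) \sum_(1 <= n < K) F c n * G (c * n)%N.
Proof.
move=> GK.
have divE m (f : nat -> R) : (0 < m < K)%N ->
    \sum_(c <- divisors m) f c = \sum_(1 <= c < K | (c %| m)%N) f c.
  move=> /andP[m0 mK]; rewrite -[RHS]big_filter; apply: perm_big; apply: uniq_perm.
  - exact: divisors_uniq.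
  - by rewrite filter_uniq // iota_uniq.
  - move=> c; rewrite mem_filter mem_index_iota -dvdn_divisors //.
    case: (boolP (c %| m)%N) => //= cm.
    have := dvdn_leq m0 cm; have := dvdn_gt0 m0 cm; lia.
transitivity (\sum_(1 <= m < K) \sum_(1 <= c < K)
   (if (c %| m)%N then F c (m %/ c)%N * G m else 0)).
  apply: eq_big_nat => m hm; rewrite divE // mulr_sumr big_mkcond /=.
  by apply: eq_bigr => c _; case: ifP => _ //; rewrite mulrC.
rewrite exchange_big /=; apply: eq_big_nat => c /andP[c0 cK].
transitivity (\sum_(1 <= n < K) \sum_(1 <= m < K)
   (if m == (c * n)%N then F c n * G m else 0)).
  rewrite exchange_big /=; apply: eq_big_nat => m /andP[m0 mK].
  case: (boolP (c %| m)%N) => [/dvdnP[n mE]|cm]; last first.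
    rewrite big1 // => n _; case: eqP => // mE.
    by case/negP: cm; rewrite mE dvdn_mulr.
  have n0 : (0 < n)%N by case: n mE => // mE; rewrite mE in m0.
  rewrite (bigD1_seq n) ?iota_uniq //=; last first.
    rewrite mem_index_iota n0 /=; apply: leq_ltn_trans mK.
    by rewrite mE leq_pmulr.
  rewrite mE mulnC eqxx mulKn // big1 ?addr0 // => n' n'n.
  by rewrite eqn_pmul2l // eq_sym (negbTE n'n).
apply: eq_big_nat => n /andP[n0 nK].
case: (leqP K (c * n)) => cn.
  rewrite (GK _ cn) mulr0 big_nat big1 // => m /andP[_ mK].
  by case: eqP => // mE; rewrite mE ltnNge cn in mK.
rewrite (bigD1_seq (c * n)%N) ?iota_uniq //=; last first.
  by rewrite mem_index_iota cn muln_gt0 c0 n0.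
by rewrite eqxx big1 ?addr0 // => m' /negbTE ->.
Qed.

Definition moebius_tail (U m : nat) : R :=
  \sum_(b <- divisors m | (U < b)%N) moebius b.

(** Vaughan's identity, summed against a function [G]. *)
Lemma vaughan (G : nat -> R) (U K : nat) : (U < K)%N ->
  (forall m, (m <= U)%N -> G m = 0) -> (forall m, (K <= m)%N -> G m = 0) ->
  \sum_(1 <= d < K) vonMangoldt R d * G d
  = \sum_(1 <= b < U.+1) moebius b * (\sum_(1 <= m < K) ln m%:R * G (b * m)%N)
  - \sum_(1 <= b < U.+1) \sum_(1 <= c < U.+1) moebius b * vonMangoldt R c *
       (\sum_(1 <= m < K) G (b * c * m)%N)
  + \sum_(U.+1 <= c < K) \sum_(U.+1 <= m < K)
       vonMangoldt R c * moebius_tail U m * G (c * m)%N.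
Proof.
move=> UK GU GK.
pose L c : R := if (U < c)%N then vonMangoldt R c else 0.
pose L' c : R := if (U < c)%N then 0 else vonMangoldt R c.
pose mu' b : R := if (U < b)%N then 0 else moebius b.
have GKb b m : (0 < b)%N -> (K <= m)%N -> G (b * m)%N = 0.
  by move=> b0 mK; apply: GK; apply: (leq_trans mK); rewrite leq_pmull.
have step1 d : (0 < d)%N -> vonMangoldt R d * G d
  = G d * (\sum_(c <- divisors d) L c * (\sum_(b <- divisors (d %/ c)) moebius b)).
  move=> d0; case: (leqP d U) => dU; first by rewrite GU // mulr0 mul0r.
  rewrite mulrC; congr (_ * _).
  rewrite (bigD1_seq d) /= ?divisors_uniq //; last by rewrite -dvdn_divisors.
  rewrite divnn d0 sum_moebius_divisors // mulr1 /L dU.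
  rewrite big1_seq ?addr0 // => c /andP[cd]; rewrite -dvdn_divisors // => cdvd.
  have c0 := dvdn_gt0 d0 cdvd.
  rewrite sum_moebius_divisors; last by rewrite divn_gt0 // dvdn_leq.
  case: eqP => [e|_]; last by rewrite mulr0.
  by case/eqP: cd; rewrite -(divnK cdvd) e mul1n.
have trunc (f h : nat -> R) : (forall b, (U < b)%N -> f b = 0) ->
    \sum_(1 <= b < K) f b * h b = \sum_(1 <= b < U.+1) f b * h b.
  move=> f0; rewrite (big_cat_nat (n := U.+1)) //= [X in _ + X]big_nat.
  by rewrite [X in _ + X]big1 ?addr0 // => b /andP[Ub _]; rewrite f0 // mul0r.
rewrite (eq_big_nat _ _ (F2 := fun d => G d * (\sum_(c <- divisors d)
   L c * (\sum_(b <- divisors (d %/ c)) moebius b)))); last first.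
  by move=> d /andP[d0 _]; exact: step1.
rewrite (sum_divisors_exchange (fun c n => L c * \sum_(b <- divisors n) moebius b) GK).
have split_mu n : \sum_(b <- divisors n) moebius b
   = moebius_tail U n + \sum_(b <- divisors n) mu' b.
  rewrite (bigID (fun b => U < b)%N) /=; congr (_ + _).
  by rewrite big_mkcond; apply: eq_bigr => b _; rewrite /mu' if_neg.
under eq_bigr => c _ do under eq_bigr do rewrite split_mu mulrDr mulrDl.
under eq_bigr => c _ do rewrite big_split /=.
rewrite big_split /= addrC; congr (_ + _); last first.
  rewrite (big_cat_nat (n := U.+1)) //= big_nat big1 ?add0r; last first.
    move=> c /andP[c0 cU]; rewrite big1 // => n _.
    by rewrite /L ltnNge -ltnS cU !mul0r.
  apply: eq_big_nat => c /andP[cU _].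
  rewrite (big_cat_nat (n := U.+1)) //= big_nat big1 ?add0r; last first.
    move=> n /andP[n0 nU]; rewrite /moebius_tail big_seq_cond big1 ?mulr0 ?mul0r //.
    move=> b /andP[]; rewrite -dvdn_divisors // => bn Ub.
    by have := dvdn_leq n0 bn; lia.
  by apply: eq_bigr => n _; rewrite /L cU.
(* the divisors b <= U of n, opened up *)
transitivity (\sum_(1 <= c < K) \sum_(1 <= b < K) \sum_(1 <= n < K)
    L c * mu' b * G (b * c * n)%N).
  apply: eq_big_nat => c /andP[c0 cK].
  transitivity (\sum_(1 <= m < K) G (c * m)%N *
      (\sum_(b <- divisors m) L c * mu' b)).
    by apply: eq_bigr => n _; rewrite -mulr_sumr mulrC.
  rewrite (@sum_divisors_exchange (fun m => G (c * m)%N)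
    (fun b _ => L c * mu' b) K (fun m => @GKb c m c0)).
  apply: eq_bigr => b _; apply: eq_bigr => n _.
  by congr (_ * G _); lia.
have LE c : L c = vonMangoldt R c - L' c.
  by rewrite /L /L'; case: ifP; rewrite ?subr0 ?subrr.
transitivity (\sum_(1 <= c < K) \sum_(1 <= b < K) \sum_(1 <= n < K)
    vonMangoldt R c * mu' b * G (b * c * n)%N
  - \sum_(1 <= c < K) \sum_(1 <= b < K) \sum_(1 <= n < K)
    L' c * mu' b * G (b * c * n)%N).
  rewrite -sumrB; apply: eq_bigr => c _; rewrite -sumrB; apply: eq_bigr => b _.
  by rewrite -sumrB; apply: eq_bigr => n _; rewrite LE; ring.
congr (_ - _).
  rewrite exchange_big /=.
  transitivity (\sum_(1 <= b < K) mu' b *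
      (\sum_(1 <= m < K) ln m%:R * G (b * m)%N)).
    apply: eq_big_nat => b /andP[b0 bK].
    transitivity (mu' b * \sum_(1 <= m < K) G (b * m)%N *
        (\sum_(c <- divisors m) vonMangoldt R c)).
      rewrite (@sum_divisors_exchange (fun m => G (b * m)%N)
        (fun c _ => vonMangoldt R c) K (fun m => @GKb b m b0)) mulr_sumr.
      apply: eq_bigr => c _; rewrite mulr_sumr; apply: eq_bigr => n _.
      by rewrite mulnA; ring.
    congr (_ * _); apply: eq_big_nat => m /andP[m0 _].
    by rewrite sum_vonMangoldt_divisors // mulrC.
  rewrite trunc; last by move=> b Ub; rewrite /mu' Ub.
  by apply: eq_big_nat => b /andP[_ bU]; rewrite /mu' ltnNge -ltnS bU.
transitivity (\sum_(1 <= b < K) mu' b * (\sum_(1 <= c < K) L' c *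
    (\sum_(1 <= m < K) G (b * c * m)%N))).
  rewrite exchange_big /=; apply: eq_bigr => b _.
  rewrite mulr_sumr; apply: eq_bigr => c _.
  by rewrite !mulr_sumr; apply: eq_bigr => n _; ring.
rewrite trunc; last by move=> b Ub; rewrite /mu' Ub.
apply: eq_big_nat => b /andP[_ bU]; rewrite trunc; last first.
  by move=> c Uc; rewrite /L' Uc.
rewrite mulr_sumr; apply: eq_big_nat => c /andP[_ cU].
have Ub : (U < b)%N = false by rewrite ltnNge -ltnS bU.
have Uc : (U < c)%N = false by rewrite ltnNge -ltnS cU.
by rewrite /mu' /L' Ub Uc mulrA.
Qed.

End Arithmetic.

(** * Divisors and harmonic sums *)

Section DivisorBound.
Context {R : realType}.

Lemma size_divisors_primepow (p a m : nat) : prime p -> (0 < m)%N ->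
  (size (divisors (p ^ a * m)) <= a.+1 * size (divisors m))%N.
Proof.
move=> pp m0.
have pam0 : (0 < p ^ a * m)%N by rewrite muln_gt0 expn_gt0 prime_gt0.
pose s := [seq (p ^ i * d)%N | i <- iota 0 a.+1, d <- divisors m].
have -> : (a.+1 * size (divisors m) = size s)%N.
  by rewrite size_allpairs size_iota.
apply: uniq_leq_size; first exact: divisors_uniq.
move=> d; rewrite -dvdn_divisors // => dn; apply/allpairsP.
have d0 := dvdn_gt0 pam0 dn.
exists (minn a (logn p d), (d %/ p ^ minn a (logn p d))%N) => /=.
have pd : (p ^ minn a (logn p d) %| d)%N by rewrite pfactor_dvdn // geq_minr.
split; last by rewrite mulnC divnK.
- by rewrite -/(iota 0 a.+1) mem_iota add0n ltnS geq_minl.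
- rewrite -dvdn_divisors //.
  have [h|h] := leqP a (logn p d).
    rewrite (minn_idPl h) in pd *.
    by rewrite -(@dvdn_pmul2l (p ^ a)) ?expn_gt0 ?prime_gt0 // mulnC divnK.
  rewrite (minn_idPr (ltnW h)) in pd *.
  (* once its power of p is removed, the divisor is prime to p *)
  have cop : coprime (d %/ p ^ logn p d) (p ^ a).
    rewrite coprime_sym coprimeXl // prime_coprime //; apply/negP => pdd.
    have : (p ^ (logn p d).+1 %| d)%N.
      by rewrite expnS -[X in (_ %| X)%N](divnK pd) dvdn_mul.
    by rewrite pfactor_dvdn // ltnn.
  rewrite -(Gauss_dvdr _ cop); apply: dvdn_trans dn.
  by rewrite -[X in (_ %| X)%N](divnK pd) dvdn_mulr.
Qed.

(** The divisor bound. An exact power [p ^ a] of a large prime contributes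
    [a + 1 <= 2 ^ a <= p ^ (a * eta)], and each of the boundedly many small primes
    costs a constant. *)
Lemma divisor_bound (eta : R) : 0 < eta ->
  exists2 C : R, 0 < C &
    forall n, (0 < n)%N -> (size (divisors n))%:R <= C * n%:R `^ eta.
Proof.
move=> eta0.
pose rho : R := 2 `^ eta.
have rho1 : 1 < rho.
  by rewrite /rho -[ltLHS](powRr0 2) /powR pnatr_eq0 /= ltr_expR
    ltr_pM2r ?ln_gt0 ?ltr1n.
pose c0 : R := 1 + (rho - 1)^-1.
have ir0 : 0 < (rho - 1)^-1 by rewrite invr_gt0 subr_gt0.
have c01 : 1 <= c0 by rewrite lerDl ltW.
have bern a : a.+1%:R <= c0 * rho ^+ a.
  have b : 1 + a%:R * (rho - 1) <= rho ^+ a.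
    elim: a => [|a IH]; first by rewrite mul0r addr0.
    have r0 : 0 <= a%:R * (rho - 1) * (rho - 1).
      by rewrite -mulrA mulr_ge0 // mulr_ge0 // subr_ge0 ltW.
    have rp : 0 <= rho by rewrite powR_ge0.
    by have := ler_wpM2l rp IH; rewrite -natr1 exprS; lra.
  apply: (@le_trans _ _ (c0 * (1 + a%:R * (rho - 1)))); last first.
    by rewrite ler_wpM2l // (le_trans _ c01).
  have e : (rho - 1)^-1 * (rho - 1) = 1 by rewrite mulVf // subr_eq0 gt_eqF.
  have -> : c0 * (1 + a%:R * (rho - 1)) = 1 + (rho - 1)^-1 + a%:R * (rho - 1)
      + a%:R * ((rho - 1)^-1 * (rho - 1)) by rewrite /c0; ring.
  have r1 : 0 <= a%:R * (rho - 1) by rewrite mulr_ge0 // subr_ge0 ltW.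
  by rewrite e mulr1 -natr1; lra.
pose B := (Num.truncn (2 `^ eta^-1 : R)).+1.
have big_prime p : (B <= p)%N -> 2 <= p%:R `^ eta :> R.
  move=> Bp; have h : 2 `^ eta^-1 <= p%:R :> R.
    by apply: le_trans (_ : B%:R <= _); [exact/ltW/truncnS_gt|rewrite ler_nat].
  have := ge0_ler_powR (ltW eta0) (powR_ge0 _ _) (ler0n R p) h.
  by rewrite -powRrM mulVf ?gt_eqF // powRr1.
have small_prime p : prime p -> rho <= p%:R `^ eta.
  by move=> pp; apply: (ge0_ler_powR (ltW eta0)); rewrite ?nnegrE ?ler_nat ?prime_gt1.
suff H n : (0 < n)%N -> (size (divisors n))%:R
    <= c0 ^+ count (fun p => p < B)%N (primes n) * n%:R `^ eta.
  exists (c0 ^+ B); first by rewrite exprn_gt0 // (lt_le_trans _ c01).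
  move=> n n0; apply: (le_trans (H n n0)).
  rewrite ler_wpM2r ?powR_ge0 // ler_weXn2l //.
  rewrite -size_filter -[B in (_ <= B)%N](size_iota 0).
  apply: uniq_leq_size; first by rewrite filter_uniq // primes_uniq.
  by move=> p; rewrite mem_filter mem_iota add0n => /andP[].
elim/ltn_ind: n => n IH n0.
case: (eqVneq n 1%N) => [->|n1]; first by rewrite powR1 mulr1.
pose p := pdiv n.
have pp : prime p by apply: pdiv_prime; lia.
pose a := logn p n; pose m := (n %/ p ^ a)%N.
have nE : n = (p ^ a * m)%N by rewrite mulnC divnK // pfactor_dvdnn.
have a0 : (0 < a)%N by rewrite logn_gt0 mem_primes pp n0 pdiv_dvd.
have pa1 : (1 < p ^ a)%N by rewrite -(exp1n a) ltn_exp2r // prime_gt1.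
have m0 : (0 < m)%N by rewrite divn_gt0 ?(ltnW pa1) // (dvdn_leq n0 (pfactor_dvdnn _ _)).
have mn : (m < n)%N by rewrite nE ltn_Pmull.
have pm : ~~ (p %| m)%N.
  apply/negP => pm; have : (p ^ a.+1 %| n)%N.
    by rewrite nE expnSr dvdn_pmul2l // (ltnW pa1).
  by rewrite pfactor_dvdn // ltnn.
have Pn : perm_eq (primes n) (p :: primes m).
  apply: uniq_perm; first exact: primes_uniq.
    by rewrite /= primes_uniq andbT mem_primes pp m0 (negbTE pm).
  by move=> q; rewrite nE primesM ?(ltnW pa1) // primesX // primes_prime // !inE.
rewrite (permP Pn) /= nE natrM powRM // natrX.
have -> : (p%:R ^+ a : R) `^ eta = (p%:R `^ eta) ^+ a.
  by rewrite -powR_mulrn // -powRrM mulrC powRrM powR_mulrn // powR_ge0.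
apply: (@le_trans _ _ (a.+1%:R * (size (divisors m))%:R)).
  by rewrite -natrM ler_nat size_divisors_primepow.
have C0 k : 0 <= c0 ^+ k by rewrite exprn_ge0 // (le_trans _ c01).
rewrite exprD -mulrACA; apply: ler_pM => //; last exact: IH.
have pe0 : 0 <= p%:R `^ eta :> R := powR_ge0 _ _.
case: (ltnP p B) => pB /=.
  apply: (le_trans (bern a)); rewrite expr1 ler_wpM2l ?(le_trans _ c01) //.
  by apply: lerXn2r; rewrite ?nnegrE ?powR_ge0 // small_prime.
rewrite mul1r; apply: (@le_trans _ _ (2 ^+ a)).
  by rewrite -natrX ler_nat ltn_expl.
by apply: lerXn2r; rewrite ?nnegrE // big_prime.
Qed.

Lemma harmonic_sum_le (n : nat) : (0 < n)%N -> harmonic_sum n <= 1 + ln n%:R :> R.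
Proof.
case: n => // n _; rewrite /harmonic_sum.
elim: n => [|n IH]; first by rewrite big_nat1 ln1 addr0 invr1.
rewrite big_nat_recr //=.
apply: (le_trans (lerD IH (lexx _))); rewrite -addrA lerD2l.
have n1 : 0 < n.+1%:R :> R by rewrite ltr0n.
have n2 : 0 < n.+2%:R :> R by rewrite ltr0n.
have := @le_ln1Dx R (- n.+2%:R^-1).
have -> : 1 - n.+2%:R^-1 = n.+1%:R / n.+2%:R :> R.
  have -> : n.+1%:R = n.+2%:R - 1 :> R by rewrite -(natr1 n.+1) addrK.
  by field; rewrite gt_eqF.
rewrite ln_div ?posrE // => /(_ _)/wrap[].
  by rewrite ltrN2 invf_lt1 // ltr1n.
by move: (_^-1) (ln _) (ln _) => z u v; lra.
Qed.

Lemma ln_le_powR (eta x : R) : 0 < eta -> 0 < x -> ln x <= eta^-1 * x `^ eta.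
Proof.
move=> eta0 x0; rewrite ler_pdivlMl // -ln_powR.
by apply/ltW/ln_sublinear/powR_gt0.
Qed.

End DivisorBound.

(** * Type II sums *)

Section Phases.
Context {R : realType}.

Definition cubic (u : R) := u * (u + 1) * (u + 2).

Lemma second_difference_inv (u : R) : 0 < u ->
  (u + 2)^-1 - 2 * (u + 1)^-1 + u^-1 = 2 / cubic u.
Proof.
move=> u0; rewrite /cubic; field.
by rewrite !gt_eqF //; lra.
Qed.

Lemma cubic_gt0 (u : R) : 0 < u -> 0 < cubic u.
Proof. by move=> u0; rewrite /cubic !mulr_gt0 //; lra. Qed.

Lemma cubic_bounds (m al : R) : 3 <= m -> 0 <= al <= 1 ->
  m ^+ 3 <= cubic (m + al) <= 8 * m ^+ 3.
Proof.
move=> m3 /andP[a0 a1].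
have m0 : 0 <= m by lra.
have -> : 8 * m ^+ 3 = (2 * m) * (2 * m) * (2 * m) by rewrite !exprS expr0; ring.
have -> : m ^+ 3 = m * m * m by rewrite !exprS expr0; ring.
rewrite /cubic; apply/andP; split.
  by rewrite ler_pM ?mulr_ge0 //; [apply: ler_pM => //; lra|lra].
apply: ler_pM; [by rewrite mulr_ge0; lra|lra| |lra].
by apply: ler_pM; lra.
Qed.

(** The shift of the denominators has little influence: it changes the second
    difference by a factor [1 + O (1 / m)]. *)
Lemma cubic_inv_close (m al al' : R) : 3 <= m -> 0 <= al <= 1 -> 0 <= al' <= 1 ->
  `|(cubic (m + al))^-1 - (cubic (m + al'))^-1|
  <= `|al - al'| * (24 / m) * (cubic (m + al))^-1.
Proof.
move=> m3 ha ha'.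
have [/andP[a0 a1] /andP[a0' a1']] := (ha, ha').
have m0 : 0 < m by lra.
have p0 : 0 < cubic (m + al) by apply: cubic_gt0; lra.
have p0' : 0 < cubic (m + al') by apply: cubic_gt0; lra.
set p := cubic _ in p0 *; set p' := cubic _ in p0' *.
have -> : p^-1 - p'^-1 = (p' - p) / p' * p^-1 by field; rewrite !gt_eqF.
rewrite normrM (ger0_norm (x := p^-1)) ?invr_ge0 ?(ltW p0) //.
apply: ler_wpM2r; first by rewrite invr_ge0 ltW.
rewrite normrM normfV (gtr0_norm p0') ler_pdivrMr //.
pose q := (m + al) ^+ 2 + (m + al) * (m + al') + (m + al') ^+ 2
  + 3 * ((m + al) + (m + al')) + 2.
have -> : p' - p = - (al - al') * q by rewrite /p /p' /q /cubic; ring.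
rewrite normrM normrN -!mulrA; apply: ler_wpM2l; first exact: normr_ge0.
have q0 : 0 <= q.
  by rewrite /q; do !apply: addr_ge0; try lra; rewrite ?sqr_ge0 // mulr_ge0; lra.
rewrite ger0_norm //.
have qle : q <= 3 * (m + 1) ^+ 2 + 6 * (m + 1) + 2.
  have h1 : (m + al) ^+ 2 <= (m + 1) ^+ 2 by rewrite lerXn2r ?nnegrE; lra.
  have h2 : (m + al') ^+ 2 <= (m + 1) ^+ 2 by rewrite lerXn2r ?nnegrE; lra.
  have h3 : (m + al) * (m + al') <= (m + 1) ^+ 2.
    by rewrite expr2; apply: ler_pM; lra.
  by rewrite /q; lra.
have ple : m ^+ 3 <= p' by have /andP[] := cubic_bounds m3 ha'.
apply: (le_trans qle).
apply: (@le_trans _ _ (24 * (m^-1 * m ^+ 3))).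
  have -> : m^-1 * m ^+ 3 = m ^+ 2 by field; rewrite gt_eqF.
  have : 3 * m <= m ^+ 2 by rewrite expr2 ler_wpM2r // ltW.
  by rewrite sqrrD; lra.
by rewrite ler_pM2l // ler_pM2l ?invr_gt0.
Qed.

(** The second difference of the phase attached to two pairs [(h, n)] and
    [(h', n')] has the exact order predicted by [rho = h / n - h' / n']. *)
Lemma phase_second_difference (x m A al A' al' rho : R) (f : R -> R) :
  0 < x -> 3 <= m -> 0 <= al <= 1 -> 0 <= al' <= 1 -> 0 <= A' -> 0 < rho ->
  A - A' = rho -> A' * (`|al - al'| * (24 / m)) <= rho / 2 ->
  (forall j, f j = x * (A / (m + j + al) - A' / (m + j + al'))) ->
  x * rho / (8 * m ^+ 3) <= f 2 - 2 * f 1 + f 0 <= 3 * (x * rho / m ^+ 3).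
Proof.
move=> x0 m3 ha ha' A0 r0 Ar small fdef.
have [/andP[a0 a1] /andP[a0' a1']] := (ha, ha').
have m0 : 0 < m by lra.
set g := (cubic (m + al))^-1; set g' := (cubic (m + al'))^-1.
have m30 : 0 < m ^+ 3 by rewrite exprn_gt0.
have fE : f 2 - 2 * f 1 + f 0 = 2 * x * (rho * g + A' * (g - g')).
  have e1 := @second_difference_inv (m + al) ltac:(lra).
  have e2 := @second_difference_inv (m + al') ltac:(lra).
  have s1 j : m + j + al = m + al + j by ring.
  have s2 j : m + j + al' = m + al' + j by ring.
  rewrite -/g in e1; rewrite -/g' in e2.
  have -> : f 2 - 2 * f 1 + f 0 =
     x * (A * ((m + al + 2)^-1 - 2 * (m + al + 1)^-1 + (m + al)^-1)
        - A' * ((m + al' + 2)^-1 - 2 * (m + al' + 1)^-1 + (m + al')^-1)).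
    by rewrite !fdef !s1 !s2 !addr0; ring.
  by rewrite e1 e2 -Ar; ring.
have /andP[c1 c2] := cubic_bounds m3 ha.
have p0 : 0 < cubic (m + al) by apply: cubic_gt0; lra.
have g0 : 0 < g by rewrite invr_gt0.
have gup : g <= (m ^+ 3)^-1 by rewrite lef_pV2 ?posrE.
have glo : (8 * m ^+ 3)^-1 <= g by rewrite lef_pV2 ?posrE // mulr_gt0.
have close : `|A' * (g - g')| <= rho / 2 * g.
  rewrite normrM (ger0_norm A0).
  have := ler_wpM2l A0 (cubic_inv_close m3 ha ha').
  move=> h; apply: (le_trans h); rewrite mulrA.
  by apply: ler_wpM2r => //; exact: ltW.
rewrite fE; move: close; rewrite ler_norml => /andP[k1 k2].
have xr0 : 0 < x * rho by rewrite mulr_gt0.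
have d1 : x * (rho / 2 * g) <= x * (rho * g + A' * (g - g')).
  by rewrite ler_pM2l //; lra.
have d2 : x * (rho * g + A' * (g - g')) <= x * (3 * (rho / 2) * g).
  by rewrite ler_pM2l //; lra.
have d3 := ler_wpM2l (ltW xr0) glo.
have d4 := ler_wpM2l (ltW xr0) gup.
by apply/andP; split; lra.
Qed.

End Phases.

Section Pairs.
Context {R : realType}.

Lemma norm_sub_le (u v w : R) : 0 <= u -> u <= w -> 0 <= v -> v <= w ->
  `|u - v| <= w.
Proof. by move=> *; rewrite ler_norml; apply/andP; split; lra. Qed.

(** The phase [h x / (d + e)] at [d = m n]; both [e = 0] and [e = 1] occur. *)
Definition phase (x : R) (e h n m : nat) : R := x * h%:R / (m * n + e)%:R.

Definition pair_const : R := 14 * (24 * 256).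

Lemma pair_const_ge0 : 0 <= pair_const.
Proof. by do !apply: mulr_ge0; exact: ler0n. Qed.

(** For distinct fractions [h / n] and [h' / n'], the integer [h n' - h' n]
    determines the size of the second difference of the phase; the shift [e]
    perturbs it negligibly since [m] is much larger than [H]. *)
Lemma pair_sum_bound (x s : R) (e H N D D' h h' n n' a b : nat) :
  0 < x -> (e <= 1)%N -> (0 < H)%N -> (0 < N)%N -> (768 * H * N <= D)%N ->
  (D' <= 2 * D)%N ->
  (H <= h < 2 * H)%N -> (H <= h' < 2 * H)%N ->
  (N <= n < 2 * N)%N -> (N <= n' < 2 * N)%N ->
  (forall m, (a <= m < b)%N -> (D < m * n <= D')%N && (D < m * n' <= D')%N) ->
  (0 < natdist (h * n') (h' * n))%N ->
  0 < s ->
  s ^+ 2 = x * (natdist (h * n') (h' * n))%:R * N%:R / (256 * D%:R ^+ 3) ->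
  `|\sum_(a <= m < b) ce (phase x e h n m - phase x e h' n' m)|
   <= pair_const * ((b - a)%:R * s + s^-1).
Proof.
move=> x0 e1 H0 N0 HND DD hh hh' hn hn' hm r0 s0 s2.
wlog hlt : h h' n n' hh hh' hn hn' hm r0 s2 / (h' * n < h * n')%N.
  move=> W; case: (ltnP (h' * n) (h * n')) => [hlt|hle].
    exact: (W h h' n n').
  have hlt : (h * n' < h' * n)%N.
    by rewrite ltn_neqAle hle andbT; apply/eqP => E; move: r0;
      rewrite /natdist E subnn.
  have sym : natdist (h' * n) (h * n') = natdist (h * n') (h' * n).
    by rewrite /natdist addnC.
  have := W h' h n' n hh' hh hn' hn.
  rewrite sym => /(_ _ r0 s2 hlt)/wrap[]; first by move=> m /hm; rewrite andbC.
  by under eq_bigr do rewrite -ceN opprB.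
set r := natdist _ _ in r0 s2.
have rE : r%:R = h%:R * n'%:R - h'%:R * n%:R :> R.
  rewrite /r /natdist; have -> : (h * n' - h' * n + (h' * n - h * n') = h * n' - h' * n)%N by lia.
  by rewrite natrB ?(ltnW hlt) // !natrM.
clearbody r.
have N0r : 0 < N%:R :> R by rewrite ltr0n.
have D0r : 0 < D%:R :> R by rewrite ltr0n; lia.
have H0r : 0 < H%:R :> R by rewrite ltr0n.
have n0r : 0 < n%:R :> R by rewrite ltr0n; lia.
have n0r' : 0 < n'%:R :> R by rewrite ltr0n; lia.
have nN : N%:R <= n%:R :> R by rewrite ler_nat; case/andP: hn.
have nN' : N%:R <= n'%:R :> R by rewrite ler_nat; case/andP: hn'.
have nN2 : n%:R <= 2 * N%:R :> R.
  by rewrite -natrM ler_nat; case/andP: hn => _ /ltnW.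
have nN2' : n'%:R <= 2 * N%:R :> R.
  by rewrite -natrM ler_nat; case/andP: hn' => _ /ltnW.
have hH' : h'%:R <= 2 * H%:R :> R.
  by rewrite -natrM ler_nat; case/andP: hh' => _ /ltnW.
have r1 : 1 <= r%:R :> R by rewrite ler1n.
pose rho : R := h%:R / n%:R - h'%:R / n'%:R.
have rhoE : rho = r%:R / (n%:R * n'%:R).
  by rewrite /rho rE; field; rewrite !gt_eqF.
have nn0 : 0 < n%:R * n'%:R :> R by rewrite mulr_gt0.
have rho0 : 0 < rho by rewrite rhoE divr_gt0 // ltr0n.
have rho_lo : r%:R / (4 * N%:R ^+ 2) <= rho.
  rewrite rhoE ler_wpM2l // lef_pV2 ?posrE ?mulr_gt0 ?exprn_gt0 //.
  have -> : 4 * N%:R ^+ 2 = (2 * N%:R) * (2 * N%:R) :> R by ring.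
  by rewrite ler_pM.
have rho_up : rho <= r%:R / N%:R ^+ 2.
  by rewrite rhoE ler_wpM2l // lef_pV2 ?posrE ?exprn_gt0 // expr2 ler_pM.
rewrite /pair_const; apply: second_difference_test => //; first by lra.
move=> m mab; have /andP[/andP[m1 m2] /andP[m3 m4]] := hm m mab.
have mlo : D%:R <= 2 * N%:R * m%:R :> R.
  rewrite -!natrM ler_nat; apply: (leq_trans (ltnW m1)).
  by rewrite mulnC leq_mul //; case/andP: hn => _ /ltnW.
have mup : N%:R * m%:R <= 2 * D%:R :> R.
  rewrite -!natrM ler_nat; apply: leq_trans DD; apply: leq_trans m2.
  by rewrite mulnC leq_mul //; case/andP: hn.
have mH : 384 * H%:R <= m%:R :> R.
  have : 768 * H%:R * N%:R <= D%:R :> R by rewrite -!natrM ler_nat.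
  move=> h1; have h2 := le_trans h1 mlo.
  by rewrite -(ler_pM2r N0r) in h2 *; rewrite -(ler_pM2l N0r); lra.
have H1r : 1 <= H%:R :> R by rewrite ler1n.
have m3r : 3 <= m%:R :> R by lra.
have m0r : 0 < m%:R :> R by lra.
have er : e%:R <= 1 :> R by rewrite lern1.
have al_le (k : nat) : N%:R <= k%:R :> R -> 0 < k%:R :> R ->
    0 <= (e%:R / k%:R : R) <= N%:R^-1.
  move=> Nk k0; rewrite divr_ge0 //=.
  apply: (@le_trans _ _ (1 * k%:R^-1)); first by rewrite ler_wpM2r ?invr_ge0.
  by rewrite mul1r lef_pV2 ?posrE.
have N1 : N%:R^-1 <= 1 :> R by rewrite invf_le1 ?ler1n.
have /andP[al0 al1] := al_le n nN n0r.
have /andP[al0' al1'] := al_le n' nN' n0r'.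
have pE (j : nat) k l : 0 < l%:R :> R -> phase x e k l (m + j)
    = x * ((k%:R / l%:R) / (m%:R + j%:R + e%:R / l%:R)).
  move=> l0; rewrite /phase natrD natrM natrD.
  have p0 : 0 < (m%:R + j%:R) * l%:R + e%:R :> R.
    by rewrite ltr_wpDr // mulr_gt0 // ltr_wpDr.
  have -> : m%:R + j%:R + e%:R / l%:R = ((m%:R + j%:R) * l%:R + e%:R) / l%:R :> R.
    by field; rewrite gt_eqF.
  by field; rewrite !gt_eqF.
pose f (j : R) : R := x * ((h%:R / n%:R) / (m%:R + j + e%:R / n%:R)
   - (h'%:R / n'%:R) / (m%:R + j + e%:R / n'%:R)).
have fE (j : nat) : phase x e h n (m + j) - phase x e h' n' (m + j) = f j%:R.
  by rewrite !pE // /f mulrBr.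
have small : h'%:R / n'%:R * (`|e%:R / n%:R - e%:R / n'%:R| * (24 / m%:R))
    <= rho / 2.
  have d1 : `|e%:R / n%:R - e%:R / n'%:R| <= N%:R^-1 :> R.
    exact: norm_sub_le.
  have d2 : h'%:R / n'%:R <= 2 * H%:R / N%:R :> R.
    by rewrite ler_pM ?invr_ge0 // lef_pV2 ?posrE.
  have d3 : 24 / m%:R <= (16 * H%:R)^-1 :> R.
    rewrite ler_pdivrMr // mulrC ler_pdivlMr ?mulr_gt0 //; lra.
  have d4 : `|e%:R / n%:R - e%:R / n'%:R| * (24 / m%:R)
      <= N%:R^-1 * (16 * H%:R)^-1 :> R.
    by rewrite ler_pM // divr_ge0.
  apply: (@le_trans _ _ (2 * H%:R / N%:R * (N%:R^-1 * (16 * H%:R)^-1))).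
    by apply: ler_pM => //; rewrite ?divr_ge0 // mulr_ge0 // divr_ge0.
  have -> : 2 * H%:R / N%:R * (N%:R^-1 * (16 * H%:R)^-1)
     = 1 / (4 * N%:R ^+ 2) / 2 :> R by field; rewrite !gt_eqF.
  rewrite ler_pM2r //; apply: le_trans rho_lo.
  by rewrite ler_pM2r // invr_gt0 mulr_gt0 // exprn_gt0.
have A1 : 0 <= (e%:R / n%:R : R) <= 1 by rewrite al0 (le_trans al1).
have A2 : 0 <= (e%:R / n'%:R : R) <= 1 by rewrite al0' (le_trans al1').
have A3 : 0 <= h'%:R / n'%:R :> R by rewrite divr_ge0.
have := phase_second_difference x0 m3r A1 A2 A3 rho0 erefl small
  (f := f) (fun=> erefl).
have := fE 0%N; have := fE 1%N; have := fE 2%N.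
rewrite addn0 addn1 addn2 => -> -> -> /andP[lo up].
have xr0 : 0 < x * rho by rewrite mulr_gt0.
have N30 : 0 < N%:R ^+ 3 :> R by rewrite exprn_gt0.
have D30 : 0 < D%:R ^+ 3 :> R by rewrite exprn_gt0.
have m30 : 0 < m%:R ^+ 3 :> R by rewrite exprn_gt0.
have c1 : N%:R ^+ 3 * m%:R ^+ 3 <= 8 * D%:R ^+ 3 :> R.
  have -> : 8 * D%:R ^+ 3 = (2 * D%:R) ^+ 3 :> R by ring.
  by rewrite -exprMn; apply: lerXn2r; rewrite ?nnegrE // mulr_ge0.
have c2 : D%:R ^+ 3 <= 8 * (N%:R ^+ 3 * m%:R ^+ 3) :> R.
  have -> : 8 * (N%:R ^+ 3 * m%:R ^+ 3) = (2 * N%:R * m%:R) ^+ 3 :> R by ring.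
  by apply: lerXn2r; rewrite ?nnegrE // mulr_ge0.
apply/andP; split.
  apply: le_trans lo; rewrite s2.
  apply: (@le_trans _ _ (x * (r%:R / (4 * N%:R ^+ 2)) / (8 * m%:R ^+ 3))); last first.
    by rewrite ler_pM2r ?invr_gt0 ?mulr_gt0 // ler_pM2l.
  rewrite ler_pdivrMr ?mulr_gt0 // [leRHS]mulrAC ler_pdivlMr ?mulr_gt0 //.
  have -> : x * (r%:R / (4 * N%:R ^+ 2)) * (256 * D%:R ^+ 3)
     = x * r%:R / N%:R ^+ 2 * (8 * (8 * D%:R ^+ 3)) :> R by field; rewrite gt_eqF.
  have -> : x * r%:R * N%:R * (8 * m%:R ^+ 3)
     = x * r%:R / N%:R ^+ 2 * (8 * (N%:R ^+ 3 * m%:R ^+ 3)) by field; rewrite gt_eqF.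
  rewrite ler_wpM2l //; last by rewrite ler_pM2l.
  by rewrite divr_ge0 ?exprn_ge0 // mulr_ge0 // ltW.
apply: (le_trans up); rewrite s2.
apply: (@le_trans _ _ (3 * (x * (r%:R / N%:R ^+ 2) / m%:R ^+ 3))).
  by rewrite ler_pM2l // ler_pM2r ?invr_gt0 // ler_pM2l.
have -> : 24 * 256 * (x * r%:R * N%:R / (256 * D%:R ^+ 3))
   = 3 * (x * r%:R * N%:R * (8 / D%:R ^+ 3)) :> R by field; rewrite gt_eqF.
have -> : 3 * (x * (r%:R / N%:R ^+ 2) / m%:R ^+ 3)
   = 3 * (x * r%:R * N%:R / (N%:R ^+ 3 * m%:R ^+ 3)) :> R by field; rewrite !gt_eqF.
rewrite ler_pM2l // ler_wpM2l //; first by rewrite !mulr_ge0 // ltW.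
by rewrite ler_pdivlMr // mulrC ler_pdivrMr ?mulr_gt0.
Qed.

End Pairs.

Section Counting.
Context {R : realType}.

Lemma sqr_sum_le (I : Type) (r : seq I) (z : I -> R) :
  (\sum_(i <- r) z i) ^+ 2 <= (size r)%:R * \sum_(i <- r) z i ^+ 2.
Proof.
rewrite expr2 big_distrlr /=.
apply: (@le_trans _ _ (\sum_(i <- r) \sum_(j <- r) (z i ^+ 2 + z j ^+ 2) / 2)).
  apply: ler_sum => i _; apply: ler_sum => j _.
  by have := sqr_ge0 (z i - z j); rewrite sqrrB; lra.
have -> : \sum_(i <- r) \sum_(j <- r) (z i ^+ 2 + z j ^+ 2) / 2
   = \sum_(i <- r) ((size r)%:R * z i ^+ 2 + \sum_(j <- r) z j ^+ 2) / 2.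
  apply: eq_bigr => i _; rewrite -mulr_suml big_split /=; congr ((_ + _) / _).
  by rewrite big_const_seq count_predT iter_addr_0 mulr_natl.
rewrite -mulr_suml big_split /= -mulr_sumr big_const_seq count_predT iter_addr_0.
by rewrite -[_ *+ size r]mulr_natl; lra.
Qed.

Lemma double_range_gt0 (N n : nat) : (N <= n < 2 * N)%N -> (0 < N)%N.
Proof. by case: N. Qed.

(** Each value [v] near [u] is a product [h * n] in at most [E] ways, if [E]
    bounds the number of divisors. *)
Lemma count_products_near (H N u rad : nat) (E : R) :
  (0 < H)%N -> (0 < N)%N -> 0 <= E ->
  (forall v, (0 < v <= 4 * H * N)%N -> (size (divisors v))%:R <= E) ->
  \sum_(H <= h < 2 * H) \sum_(N <= n < 2 * N)
     ((natdist u (h * n) <= rad)%N%:R : R) <= (2 * rad).+1%:R * E.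
Proof.
move=> H0 N0 E0 HE.
apply: (@le_trans _ _ (\sum_(H <= h < 2 * H) \sum_(N <= n < 2 * N)
   \sum_(0 <= i < (2 * rad).+1) ((u + i == h * n + rad)%N%:R : R))).
  apply: ler_sum => h _; apply: ler_sum => n _.
  case: leqP => [near|_]; last by refine (sumr_ge0 _ _).
  rewrite (bigD1_seq (h * n + rad - u)%N) ?iota_uniq //=; last first.
    by rewrite mem_index_iota; move: near; rewrite /natdist; lia.
  have -> : (u + (h * n + rad - u) = h * n + rad)%N.
    by move: near; rewrite /natdist; lia.
  by rewrite eqxx lerDl; refine (sumr_ge0 _ _).
under eq_bigr => h _ do rewrite exchange_big /=.
rewrite exchange_big /=.
have -> : (2 * rad).+1%:R * E = \sum_(0 <= i < (2 * rad).+1) E.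
  by rewrite sumr_const_nat subn0 mulr_natl.
apply: ler_sum => i _.
case: (leqP (u + i) rad) => [small|big].
  rewrite big_nat big1 // => h /andP[h1 _]; rewrite big_nat big1 // => n /andP[n1 _].
  case: eqP => // eq; have : (0 < h * n)%N by rewrite muln_gt0; lia.
  by lia.
pose v := (u + i - rad)%N.
have vE h n : (u + i == h * n + rad)%N = (v == h * n)%N.
  by apply/eqP/eqP; rewrite /v; lia.
have v0 : (0 < v)%N by rewrite /v; lia.
case: (leqP v (4 * H * N)) => vub; last first.
  rewrite big_nat big1 // => h /andP[h1 h2]; rewrite big_nat big1 // => n /andP[n1 n2].
  rewrite vE; case: eqP => // eq; have : (h * n <= (2 * H) * (2 * N))%N.
    by rewrite leq_mul // ltnW.
  by rewrite -eq; lia.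
apply: le_trans (HE v _); last by rewrite v0.
apply: (@le_trans _ _ (\sum_(H <= h < 2 * H) ((h %| v)%N%:R : R))).
  rewrite big_nat [leRHS]big_nat; apply: ler_sum => h /andP[h1 _].
  have h0 : (0 < h)%N by apply: leq_trans h1.
  case: (boolP (h %| v)%N) => [hv|hv]; last first.
    rewrite big1 // => n _; rewrite vE; case: eqP => // eq.
    by case/negP: hv; rewrite eq dvdn_mulr.
  have [inn|nin] := boolP ((v %/ h)%N \in index_iota N (2 * N)).
    rewrite (bigD1_seq (v %/ h)%N) ?iota_uniq //= vE mulnC divnK // eqxx.
    rewrite big1 ?addr0 // => n nn; rewrite vE; case: eqP => // eq.
    by case/eqP: nn; rewrite eq mulKn.
  rewrite big1_seq // => n /andP[_ nin']; rewrite vE; case: eqP => // eq.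
  by case/negP: nin; rewrite eq mulKn.
rewrite -natr_sum ler_nat.
rewrite -(big_map (fun h => (h %| v)%N : nat) xpredT id) -sumnE sumn_count.
rewrite -size_filter.
apply: uniq_leq_size; first by rewrite filter_uniq // iota_uniq.
by move=> d; rewrite mem_filter -dvdn_divisors // => /andP[].
Qed.

End Counting.

Section Cauchy.
Context {R : realType}.

Lemma sum_by_class (T : eqType) (ks : seq T) (cl : T -> nat) (nq : nat)
    (F : nat -> T -> R) : (forall k, k \in ks -> (cl k < nq)%N) ->
  \sum_(0 <= q < nq) \sum_(k <- ks | cl k == q) F q k
   = \sum_(k <- ks) F (cl k) k.
Proof.
move=> hcl; under eq_bigr do rewrite big_mkcond.
rewrite exchange_big /=; apply: eq_big_seq => k kks.
rewrite (bigD1_seq (cl k)) ?iota_uniq ?mem_index_iota ?hcl //= eqxx.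
by rewrite big1 ?addr0 // => q qk; rewrite eq_sym (negbTE qk).
Qed.

(** Cauchy's inequality eliminates the unknown coefficients [b]; splitting the
    inner sum into classes first confines the squared sum to pairs of the same
    class. *)
Lemma bilinear_cauchy (T : eqType) (ks : seq T) (cl : T -> nat) (nq M : nat)
    (v th : nat -> T -> R) (b : nat -> R) (c : R) :
  (forall k, k \in ks -> (cl k < nq)%N) -> (forall m, `|b m| <= 1) ->
  (\sum_(0 <= m < M) b m * \sum_(k <- ks) v m k * ce (th m k + c)) ^+ 2
  <= M%:R * nq%:R * \sum_(k <- ks) \sum_(k' <- ks | cl k' == cl k)
       `|\sum_(0 <= m < M) v m k * v m k' * ce (th m k - th m k')|.
Proof.
move=> hcl b1; apply: (le_trans (sqr_sum_le _ _)).
rewrite size_iota subn0 -mulrA ler_wpM2l //.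
apply: (@le_trans _ _ (\sum_(0 <= m < M) nq%:R *
   \sum_(k <- ks) \sum_(k' <- ks | cl k' == cl k)
      v m k * v m k' * ce (th m k - th m k'))).
  apply: ler_sum => m _.
  apply: (@le_trans _ _ ((\sum_(k <- ks) v m k * ce (th m k + c)) ^+ 2)).
    rewrite exprMn -[leRHS]mul1r ler_wpM2r ?sqr_ge0 //.
    by rewrite -real_normK ?num_real // exprn_ile1.
  have -> : \sum_(k <- ks) v m k * ce (th m k + c)
     = \sum_(0 <= q < nq) \sum_(k <- ks | cl k == q) v m k * ce (th m k + c).
    by rewrite (sum_by_class (fun _ k => v m k * ce (th m k + c)) hcl).
  apply: (le_trans (sqr_sum_le _ _)); rewrite size_iota subn0 ler_wpM2l //.
  rewrite -(sum_by_class (fun q k => \sum_(k' <- ks | cl k' == q)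
      v m k * v m k' * ce (th m k - th m k')) hcl).
  apply: ler_sum => q _.
  have := gram_ce ks (fun k => cl k == q) (v m) (fun k => th m k + c).
  under [X in _ = X -> _]eq_bigr => k _ do under eq_bigr => k' _ do
    rewrite opprD addrACA subrr addr0.
  by move=> <-; rewrite lerDl sqr_ge0.
rewrite -mulr_sumr ler_wpM2l // exchange_big /=.
apply: ler_sum => k _; rewrite exchange_big /=; apply: ler_sum => k' _.
exact: ler_norm.
Qed.

(** The number of pairs of fractions with [|h n' - h' n| <= rad]: the product
    [h n'] and the difference determine [h' n], hence [h'] and [n] up to the
    divisor bound. *)
Lemma count_close_pairs (H N rad : nat) (E : R) :
  (0 < H)%N -> (0 < N)%N -> 0 <= E ->
  (forall v, (0 < v <= 4 * H * N)%N -> (size (divisors v))%:R <= E) ->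
  \sum_(H <= h < 2 * H) \sum_(N <= n < 2 * N)
    \sum_(H <= h' < 2 * H) \sum_(N <= n' < 2 * N)
     ((natdist (h * n') (h' * n) <= rad)%N%:R : R)
   <= (H * N)%:R * ((2 * rad).+1%:R * E).
Proof.
move=> H0 N0 E0 HE.
have -> : (H * N)%:R * ((2 * rad).+1%:R * E)
   = \sum_(H <= h < 2 * H) \sum_(N <= n < 2 * N) ((2 * rad).+1%:R * E).
  rewrite !sumr_const_nat -mulrnA -[RHS]mulr_natl; congr (_%:R * _); lia.
apply: ler_sum => h _.
under eq_bigr do rewrite exchange_big /=.
rewrite exchange_big /=.
apply: ler_sum => n' _; rewrite exchange_big /=.
by apply: count_products_near.
Qed.

Definition in_block (D D' d : nat) : bool := (D < d <= D')%N.

Lemma pair_sum_bound_uniform (x s1 sR : R) (e H N D D' h h' n n' M rad : nat) :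
  0 < x -> (e <= 1)%N -> (0 < H)%N -> (0 < N)%N -> (768 * H * N <= D)%N ->
  (D' <= 2 * D)%N -> (2 * D < N * M)%N ->
  (H <= h < 2 * H)%N -> (H <= h' < 2 * H)%N ->
  (N <= n < 2 * N)%N -> (N <= n' < 2 * N)%N ->
  0 < s1 -> s1 ^+ 2 = x * N%:R / (256 * D%:R ^+ 3) ->
  0 < sR -> sR ^+ 2 = x * rad%:R * N%:R / (256 * D%:R ^+ 3) ->
  (natdist (h * n') (h' * n) <= rad)%N ->
  `|\sum_(0 <= m < M | in_block D D' (m * n) && in_block D D' (m * n'))
      ce (phase x e h n m - phase x e h' n' m)|
  <= (natdist (h * n') (h' * n) <= 0)%N%:R * M%:R
     + pair_const * (M%:R * sR + s1^-1).
Proof.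
move=> x0 e1 H0 N0 HND DD NM hh hh' hn hn' s10 s1E sR0 sRE rle.
have kappa0 : 0 <= pair_const :> R := pair_const_ge0.
have D0 : 0 < D%:R :> R by rewrite ltr0n; apply: leq_trans HND; rewrite !muln_gt0 H0 N0.
have last0 : 0 <= pair_const * (M%:R * sR + s1^-1).
  by rewrite mulr_ge0 // addr_ge0 ?invr_ge0 ?mulr_ge0 // ltW.
case: leqP => [r0|r0].
  rewrite mul1r; apply: (@le_trans _ _ M%:R); last by rewrite lerDl.
  apply: (le_trans (ler_norm_sum _ _ _)); rewrite big_mkcond /=.
  apply: (@le_trans _ _ (\sum_(0 <= m < M) 1)); last by rewrite sumr_const_nat subn0.
  by apply: ler_sum => m _; case: ifP => // _; exact: ce_norm.
rewrite mul0r add0r.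
set r := natdist _ _ in rle r0.
have n0 : (0 < n)%N by case/andP: hn => + _; apply: leq_trans.
have n0' : (0 < n')%N by case/andP: hn' => + _; apply: leq_trans.
pose a := maxn (D %/ n).+1 (D %/ n').+1.
pose b := minn (D' %/ n).+1 (D' %/ n').+1.
have abE m : in_block D D' (m * n) && in_block D D' (m * n') = (a <= m < b)%N.
  rewrite /in_block /a /b geq_max leq_min !ltnS -!ltn_divLR // !leq_divRL //.
  by rewrite andbACA.
have bM : (b <= M)%N.
  rewrite geq_min; apply/orP; left; rewrite ltn_divLR //.
  apply: (leq_ltn_trans DD); apply: (leq_trans NM); rewrite mulnC leq_mul //.
  by case/andP: hn.
have -> : \sum_(0 <= m < M | in_block D D' (m * n) && in_block D D' (m * n'))
      ce (phase x e h n m - phase x e h' n' m)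
   = \sum_(a <= m < b) ce (phase x e h n m - phase x e h' n' m).
  rewrite -big_filter; apply: perm_big; apply: uniq_perm.
  - by rewrite filter_uniq // iota_uniq.
  - exact: iota_uniq.
  - move=> m; rewrite mem_filter !mem_index_iota abE /=.
    case: (boolP (a <= m < b)%N) => //= /andP[_ mb].
    exact: leq_trans bM.
pose s := Num.sqrt (x * r%:R * N%:R / (256 * D%:R ^+ 3)).
have r0r : 1 <= r%:R :> R by rewrite ler1n.
have den0 : 0 < 256 * D%:R ^+ 3 :> R.
  by apply: mulr_gt0; [rewrite ltr0n|exact: exprn_gt0].
have xrN : 0 < x * r%:R * N%:R by rewrite !mulr_gt0 // ltr0n.
have wpos : 0 < x * r%:R * N%:R / (256 * D%:R ^+ 3) by exact: divr_gt0.
have s0 : 0 < s by rewrite sqrtr_gt0.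
have sE : s ^+ 2 = x * r%:R * N%:R / (256 * D%:R ^+ 3).
  exact: (sqr_sqrtr (ltW wpos)).
have sq_le (u w : R) : 0 < u -> 0 < w -> u ^+ 2 <= w ^+ 2 -> u <= w.
  by move=> u0 w0; rewrite ler_pXn2r // nnegrE ltW.
have ssR : s <= sR.
  apply: sq_le => //; rewrite sE sRE ler_pM2r ?invr_gt0 // ler_pM2r ?ltr0n //.
  by rewrite ler_pM2l // ler_nat.
have s1s : s1 <= s.
  apply: sq_le => //; rewrite sE s1E ler_pM2r ?invr_gt0 // ler_pM2r ?ltr0n //.
  by rewrite -[leLHS]mulr1 ler_pM2l.
have := @pair_sum_bound R x s e H N D D' h h' n n' a b x0 e1 H0 N0 HND DD
  hh hh' hn hn'.
move=> /(_ _ r0 s0 sE)/wrap[]; first by move=> m; rewrite -abE.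
move=> hb; apply: (le_trans hb); rewrite -/pair_const ler_wpM2l //; apply: lerD.
  rewrite ler_pM // ?(ltW s0) // ler_nat.
  by apply: leq_trans bM; rewrite leq_subr.
by rewrite lef_pV2 ?posrE.
Qed.

End Cauchy.

Section TypeTwo.
Context {R : realType}.

Definition type_two_const : R := 18 * (1 + 3 * 8 * (pair_const * 17)).

(** Two fractions of the same class differ by at most [H / (N Q)]. *)
Lemma class_close (Q H N h n h' n' : nat) :
  (0 < H)%N -> (0 < Q)%N ->
  (N <= n < 2 * N)%N -> (N <= n' < 2 * N)%N ->
  ((Q * h * N) %/ (n * H) = (Q * h' * N) %/ (n' * H))%N ->
  (natdist (h * n') (h' * n) <= (4 * H * N) %/ Q)%N.
Proof.
move=> H0 Q0 hn hn'; rewrite leq_divRL //.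
wlog : h n h' n' hn hn' / (h' * n <= h * n')%N.
  move=> W; case: (leqP (h' * n) (h * n')) => [le|/ltnW le] E.
    exact: W.
  have -> : natdist (h * n') (h' * n) = natdist (h' * n) (h * n').
    by rewrite /natdist addnC.
  exact: W.
move=> le E; have -> : natdist (h * n') (h' * n) = (h * n' - h' * n)%N.
  by rewrite /natdist; lia.
have N0 : (0 < N)%N := double_range_gt0 hn.
have [/andP[n1 n2] /andP[n1' n2']] := (hn, hn').
have nH : (0 < n * H)%N by rewrite muln_gt0 H0 andbT (leq_trans N0).
have nH' : (0 < n' * H)%N by rewrite muln_gt0 H0 andbT (leq_trans N0).
set q := (_ %/ _)%N in E.
have k1 : (Q * h * N < q.+1 * (n * H))%N by rewrite -ltn_divLR.
have k2 : (q * (n' * H) <= Q * h' * N)%N by rewrite -leq_divRL // -E.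
have k3 : (Q * h * N * n' <= q.+1 * (n * H) * n')%N by rewrite leq_mul // ltnW.
have k4 : (q * (n' * H) * n <= Q * h' * N * n)%N by rewrite leq_mul.
have k5 : (N * ((h * n' - h' * n) * Q) <= n * n' * H)%N.
  rewrite mulnBl mulnBr leq_subLR.
  have -> : (N * (h * n' * Q) = Q * h * N * n')%N by lia.
  have -> : (N * (h' * n * Q) = Q * h' * N * n)%N by lia.
  apply: (leq_trans k3).
  have -> : (q.+1 * (n * H) * n' = q * (n' * H) * n + n * n' * H)%N by lia.
  by rewrite leq_add2r.
rewrite -(leq_pmul2l N0); apply: (leq_trans k5).
have -> : (N * (4 * H * N) = (2 * N) * (2 * N) * H)%N by lia.
by rewrite leq_mul // leq_mul // ltnW.
Qed.

(** Bilinear (type II) sums. The numbers [h / n] are sorted into [Q = H N / r]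
    classes; in a class, the integers [h n' - h' n] are [O (r)], hence there are
    [O (H N r)] pairs up to the divisor bound, and the second derivative test
    handles all of them but the [O (H N)] diagonal ones. *)
Lemma type_two (x E c : R) (e H N D D' M r : nat) (a : nat -> nat -> R)
    (b : nat -> R) :
  0 < x -> (e <= 1)%N -> (0 < H)%N -> (0 < r)%N -> (r <= N)%N ->
  (768 * H * N <= D)%N -> (D' <= 2 * D)%N ->
  (2 * D < N * M)%N -> (N * M <= 3 * D)%N ->
  r%:R ^+ 3 * x * N%:R <= D%:R ^+ 3 -> r%:R ^+ 2 * D%:R * N%:R <= x ->
  0 <= E ->
  (forall v, (0 < v <= 4 * H * N)%N -> (size (divisors v))%:R <= E) ->
  (forall h n, `|a h n| <= 1) -> (forall m, `|b m| <= 1) ->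
  (\sum_(H <= h < 2 * H) \sum_(N <= n < 2 * N)
     \sum_(0 <= m < M | in_block D D' (m * n))
       a h n * b m * ce (phase x e h n m + c)) ^+ 2
  <= type_two_const * E * (D%:R * H%:R) ^+ 2 / r%:R.
Proof.
move=> x0 e1 H0 r0 rN HND DD NM NM3 hr1 hr2 E0 HE a1 b1.
have N0 : (0 < N)%N := leq_trans r0 rN.
have D0 : (0 < D)%N by apply: leq_trans HND; rewrite !muln_gt0 H0 N0.
pose Q := ((H * N) %/ r)%N.
have rHN : (r <= H * N)%N by apply: (leq_trans rN); rewrite leq_pmull.
have Q0 : (0 < Q)%N by rewrite divn_gt0.
pose rad := ((4 * H * N) %/ Q)%N.
have rad8 : (rad <= 8 * r)%N.
  have : (H * N < Q.+1 * r)%N by rewrite -ltn_divLR.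
  have : (Q.+1 * r <= 2 * Q * r)%N by rewrite leq_mul2r; apply/orP; right; lia.
  move=> h1 h2; have h3 : (4 * H * N <= 8 * r * Q)%N by nia.
  by rewrite -(mulnK (8 * r) Q0) leq_div2r.
have rad1 : (1 <= rad)%N.
  rewrite /rad divn_gt0 //; apply: (leq_trans (leq_div _ _)).
  by rewrite -mulnA leq_pmull.
pose ks := [seq (h, n) | h <- index_iota H (2 * H), n <- index_iota N (2 * N)].
have ksP k : k \in ks -> (H <= k.1 < 2 * H)%N /\ (N <= k.2 < 2 * N)%N.
  by case/allpairsP => -[h n] /= [h1 h2 ->] /=; rewrite -!mem_index_iota.
pose cl (k : nat * nat) := ((Q * k.1 * N) %/ (k.2 * H))%N.
have clP k : k \in ks -> (cl k < 2 * Q)%N.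
  case/ksP => /andP[k1 k2] /andP[k3 k4].
  rewrite ltn_divLR; last by rewrite muln_gt0 H0 andbT (leq_trans N0).
  have g1 : (Q * k.1 * N < Q * (2 * H) * N)%N.
    by rewrite ltn_pmul2r // ltn_pmul2l.
  apply: (leq_trans g1).
  have -> : (Q * (2 * H) * N = 2 * Q * (N * H))%N by lia.
  by rewrite leq_mul // leq_mul.
pose v m (k : nat * nat) := if in_block D D' (m * k.2) then a k.1 k.2 else 0.
pose th m (k : nat * nat) := phase x e k.1 k.2 m.
have -> : \sum_(H <= h < 2 * H) \sum_(N <= n < 2 * N)
     \sum_(0 <= m < M | in_block D D' (m * n))
       a h n * b m * ce (phase x e h n m + c)
   = \sum_(0 <= m < M) b m * \sum_(k <- ks) v m k * ce (th m k + c).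
  under [RHS]eq_bigr do rewrite big_allpairs mulr_sumr.
  rewrite [RHS]exchange_big /=; apply: eq_bigr => h _.
  under [RHS]eq_bigr do rewrite mulr_sumr.
  rewrite [RHS]exchange_big /=; apply: eq_bigr => n _.
  rewrite big_mkcond /=; apply: eq_bigr => m _; rewrite /v /th /=.
  by case: ifP => _; [ring|rewrite mul0r mulr0].
apply: (le_trans (@bilinear_cauchy _ _ ks cl (2 * Q) M v th b c clP b1)).
have [D0r N0r] : 0 < D%:R :> R /\ 0 < N%:R :> R by rewrite !ltr0n.
have r0r : 0 < r%:R :> R by rewrite ltr0n.
have den0 : 0 < 256 * D%:R ^+ 3 :> R.
  by apply: mulr_gt0; [rewrite ltr0n|exact: exprn_gt0].
pose s1 := Num.sqrt (x * N%:R / (256 * D%:R ^+ 3)).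
pose sR := Num.sqrt (x * rad%:R * N%:R / (256 * D%:R ^+ 3)).
have rad0r : 0 < rad%:R :> R by rewrite ltr0n.
have w1 : 0 < x * N%:R / (256 * D%:R ^+ 3).
  by apply: divr_gt0 => //; exact: mulr_gt0.
have wR : 0 < x * rad%:R * N%:R / (256 * D%:R ^+ 3).
  by apply: divr_gt0 => //; apply: mulr_gt0 => //; exact: mulr_gt0.
have s10 : 0 < s1 by rewrite sqrtr_gt0.
have sR0 : 0 < sR by rewrite sqrtr_gt0.
have s1E : s1 ^+ 2 = x * N%:R / (256 * D%:R ^+ 3) := sqr_sqrtr (ltW w1).
have sRE : sR ^+ 2 = x * rad%:R * N%:R / (256 * D%:R ^+ 3) := sqr_sqrtr (ltW wR).
have sq_le (u w : R) : 0 <= u -> 0 <= w -> u ^+ 2 <= w ^+ 2 -> u <= w.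
  by move=> u0 w0; rewrite ler_pXn2r.
have M0r : 0 < M%:R :> R.
  by rewrite ltr0n lt0n; apply/eqP => M0; rewrite M0 muln0 in NM.
pose T := pair_const * (M%:R * sR + s1^-1).
have c0 : 0 <= pair_const :> R := pair_const_ge0.
have T0 : 0 <= T by rewrite mulr_ge0 // addr_ge0 ?invr_ge0 ?mulr_ge0 // ltW.
(* the two size conditions on r say that T = O (M / r) *)
have rsR : r%:R * sR <= 1.
  apply: sq_le; rewrite ?mulr_ge0 ?(ltW sR0) //.
  rewrite exprMn sRE expr1n mulrA ler_pdivrMr // mul1r.
  have rad8r : rad%:R <= 8 * r%:R :> R by rewrite -natrM ler_nat.
  have g : 0 <= r%:R ^+ 2 * x * N%:R by rewrite !mulr_ge0 ?exprn_ge0 // ltW.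
  have := ler_wpM2l g rad8r; have : 0 <= D%:R ^+ 3 :> R by rewrite exprn_ge0.
  have -> : r%:R ^+ 2 * x * N%:R * (8 * r%:R) = 8 * (r%:R ^+ 3 * x * N%:R) by ring.
  have -> : r%:R ^+ 2 * (x * rad%:R * N%:R) = r%:R ^+ 2 * x * N%:R * rad%:R by ring.
  by lra.
have rs1 : r%:R * s1^-1 <= 16 * M%:R.
  have g1 : r%:R * N%:R / (16 * D%:R) <= s1.
    apply: sq_le; rewrite ?divr_ge0 ?mulr_ge0 ?(ltW s10) //.
    rewrite s1E expr_div_n ler_pdivrMr ?exprn_gt0 ?mulr_gt0 //.
    have -> : x * N%:R / (256 * D%:R ^+ 3) * (16 * D%:R) ^+ 2 = x * N%:R / D%:R.
      by field; rewrite gt_eqF.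
    rewrite ler_pdivlMr //.
    have -> : (r%:R * N%:R) ^+ 2 * D%:R = (r%:R ^+ 2 * D%:R * N%:R) * N%:R :> R by ring.
    by rewrite ler_pM2r.
  have g2 : D%:R <= M%:R * N%:R :> R.
    by rewrite -natrM ler_nat mulnC (leq_trans _ (ltnW NM)) // leq_pmull.
  rewrite ler_pdivrMr //.
  have := ler_wpM2l (ltW M0r) g1.
  have -> : M%:R * (r%:R * N%:R / (16 * D%:R)) = r%:R / 16 * (M%:R * N%:R / D%:R) :> R.
    by field; rewrite gt_eqF.
  have g3 : 1 <= M%:R * N%:R / D%:R :> R by rewrite ler_pdivlMr // mul1r.
  have r16 : 0 <= r%:R / 16 :> R by [].
  have := ler_wpM2l r16 g3; lra.
have rT : r%:R * T <= pair_const * 17 * M%:R.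
  have := ler_wpM2l (ltW M0r) rsR => g1.
  have -> : r%:R * T = pair_const * (M%:R * (r%:R * sR) + r%:R * s1^-1) by rewrite /T; ring.
  by rewrite -mulrA ler_wpM2l //; lra.
have pairs : \sum_(k <- ks) \sum_(k' <- ks | cl k' == cl k)
       `|\sum_(0 <= m < M) v m k * v m k' * ce (th m k - th m k')|
   <= \sum_(k <- ks) \sum_(k' <- ks)
       ((natdist (k.1 * k'.2) (k'.1 * k.2) <= 0)%N%:R * M%:R
        + (natdist (k.1 * k'.2) (k'.1 * k.2) <= rad)%N%:R * T).
  rewrite big_seq [leRHS]big_seq; apply: ler_sum => k kks.
  have [k1 k2] := ksP k kks.
  rewrite big_mkcond big_seq [leRHS]big_seq; apply: ler_sum => k' kks'.
  have [k1' k2'] := ksP k' kks'.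
  case: eqP => [clE|_]; last first.
    by apply: addr_ge0; apply: mulr_ge0.
  have near := class_close H0 Q0 k2 k2' (esym clE).
  rewrite -/rad in near; rewrite near mul1r.
  have := @pair_sum_bound_uniform R x s1 sR e H N D D' k.1 k'.1 k.2 k'.2 M rad
    x0 e1 H0 N0 HND DD NM k1 k1' k2 k2' s10 s1E sR0 sRE near.
  apply: le_trans.
  have -> : \sum_(0 <= m < M) v m k * v m k' * ce (th m k - th m k')
    = a k.1 k.2 * a k'.1 k'.2 *
      \sum_(0 <= m < M | in_block D D' (m * k.2) && in_block D D' (m * k'.2))
      ce (th m k - th m k').
    rewrite mulr_sumr [RHS]big_mkcond /=; apply: eq_bigr => m _; rewrite /v.
    case: (in_block D D' (m * k.2)); case: (in_block D D' (m * k'.2)) => //=;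
      by rewrite ?mul0r ?mulr0 ?mul0r.
  rewrite normrM -[leRHS]mul1r ler_wpM2r // normrM -[leRHS]mul1r.
  by rewrite ler_pM.
have count rho : \sum_(k <- ks) \sum_(k' <- ks)
     ((natdist (k.1 * k'.2) (k'.1 * k.2) <= rho)%N%:R : R)
   <= (H * N)%:R * ((2 * rho).+1%:R * E).
  apply: le_trans (count_close_pairs rho H0 N0 E0 HE).
  rewrite big_allpairs; apply: ler_sum => h _; apply: ler_sum => n _.
  by rewrite big_allpairs.
have total : \sum_(k <- ks) \sum_(k' <- ks | cl k' == cl k)
       `|\sum_(0 <= m < M) v m k * v m k' * ce (th m k - th m k')|
   <= (H * N)%:R * E * (1 + 3 * 8 * (pair_const * 17)) * M%:R.
  apply: (le_trans pairs).
  under eq_bigr do rewrite big_split /= -!mulr_suml.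
  rewrite big_split /= -!mulr_suml.
  have q1 := ler_wpM2r (ltW M0r) (count 0%N).
  have q2 := ler_wpM2r T0 (count rad).
  apply: (le_trans (lerD q1 q2)); rewrite muln0 mul1r.
  have radr : (2 * rad).+1%:R <= 3 * 8 * r%:R :> R.
    rewrite -!natrM ler_nat; apply: (@leq_trans (3 * rad)).
      by rewrite -addn1 (_ : 3 = 2 + 1)%N // mulnDl mul1n leq_add2l.
    by rewrite -mulnA leq_mul.
  have q3 : (2 * rad).+1%:R * T <= 3 * 8 * (pair_const * 17 * M%:R).
    have := ler_wpM2r T0 radr; move: rT; lra.
  have HE0 : 0 <= (H * N)%:R * E by rewrite mulr_ge0.
  have := ler_wpM2l HE0 q3; lra.
have nq : (2 * Q)%:R <= 2 * (H * N)%:R / r%:R :> R.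
  by rewrite ler_pdivlMr // -!natrM ler_nat -mulnA leq_mul // leq_trunc_div.
have MN : M%:R * N%:R <= 3 * D%:R :> R by rewrite -!natrM ler_nat mulnC.
have MQ0 : 0 <= M%:R * (2 * Q)%:R :> R by rewrite mulr_ge0.
apply: (le_trans (ler_wpM2l MQ0 total)).
have C0 : 0 <= (H * N)%:R * E * (1 + 3 * 8 * (pair_const * 17)) * M%:R.
  rewrite !mulr_ge0 // addr_ge0 // mulr_ge0 // mulr_ge0 //.
have step := ler_wpM2r C0 (ler_wpM2l (ltW M0r) nq).
apply: (le_trans step).
have -> : M%:R * (2 * (H * N)%:R / r%:R) *
   ((H * N)%:R * E * (1 + 3 * 8 * (pair_const * 17)) * M%:R)
  = (2 * (1 + 3 * 8 * (pair_const * 17)) * E * H%:R ^+ 2 / r%:R) * (M%:R * N%:R) ^+ 2.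
  by rewrite natrM; ring.
have -> : type_two_const * E * (D%:R * H%:R) ^+ 2 / r%:R
  = (2 * (1 + 3 * 8 * (pair_const * 17)) * E * H%:R ^+ 2 / r%:R) * (3 * D%:R) ^+ 2.
  by rewrite /type_two_const; field; rewrite gt_eqF.
rewrite ler_wpM2l //.
  rewrite divr_ge0 // !mulr_ge0 ?exprn_ge0 // addr_ge0 // mulr_ge0 // mulr_ge0 //.
by rewrite lerXn2r ?nnegrE ?mulr_ge0.
Qed.

End TypeTwo.

(** * Type I sums and dyadic decompositions *)

Section TypeOne.
Context {R : realType}.

Definition type_one_const : R := 14 * 64 * 6.

Lemma type_one_const_gt0 : 0 < type_one_const. Proof. by rewrite /type_one_const !mulr_gt0. Qed.

(** Type I sums: a sum over consecutive multiples of [n], directly by the second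
    derivative test. *)
Lemma type_one (x c : R) (e h n D a b : nat) :
  0 < x -> (e <= 1)%N -> (0 < h)%N -> (0 < n)%N -> (3 * n <= D)%N ->
  (forall m, (a <= m < b)%N -> (D < m * n <= 2 * D)%N) ->
  `|\sum_(a <= m < b) ce (phase x e h n m + c)|
  <= type_one_const * (Num.sqrt (x * h%:R / D%:R) + Num.sqrt (D%:R ^+ 3 / x) / n%:R).
Proof.
move=> x0 e1 h0 n0 nD hm.
have D0 : (0 < D)%N by apply: leq_trans nD; rewrite muln_gt0.
have [D0r n0r] : 0 < D%:R :> R /\ 0 < n%:R :> R by rewrite !ltr0n.
have h0r : 0 < h%:R :> R by rewrite ltr0n.
pose w := x * h%:R * n%:R ^+ 2 / (32 * D%:R ^+ 3).
have D3 : 0 < D%:R ^+ 3 :> R by rewrite exprn_gt0.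
have w0 : 0 < w by rewrite divr_gt0 ?mulr_gt0 // exprn_gt0.
pose s := Num.sqrt w.
have s0 : 0 < s by rewrite sqrtr_gt0.
have sE : s ^+ 2 = w by rewrite sqr_sqrtr // ltW.
have sq_le (u v : R) : 0 <= u -> 0 <= v -> u ^+ 2 <= v ^+ 2 -> u <= v.
  by move=> u0 v0; rewrite ler_pXn2r.
case: (leqP b a) => [ba|ab].
  rewrite big_geq // normr0 mulr_ge0 ?mulr_ge0 // addr_ge0 ?divr_ge0 ?sqrtr_ge0 //.
have ban : ((b - a) * n <= 2 * D)%N.
  have /andP[a1 _] : (D < a * n <= 2 * D)%N by apply: hm; rewrite leqnn.
  have /andP[_ b1] : (D < b.-1 * n <= 2 * D)%N by apply: hm; lia.
  have -> : ((b - a) * n = (b.-1 * n + n) - a * n)%N.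
    by rewrite mulnBl; congr (_ - _)%N; case: b ab b1 {hm} => // b' _ _; rewrite mulSn addnC.
  by lia.
apply: (@le_trans _ _ (14 * 64 * ((b - a)%:R * s + s^-1))); last first.
  rewrite /type_one_const -[leRHS]mulrA ler_pM2l ?mulr_gt0 // mulrDr; apply: lerD.
    apply: (@le_trans _ _ (Num.sqrt (x * h%:R / D%:R))); last first.
      by have := sqrtr_ge0 (x * h%:R / D%:R); lra.
    apply: sq_le; rewrite ?sqrtr_ge0 ?mulr_ge0 ?(ltW s0) //.
    rewrite exprMn sE sqr_sqrtr ?divr_ge0 ?mulr_ge0 ?(ltW x0) //.
    have g : ((b - a)%:R * n%:R) ^+ 2 <= (2 * D%:R) ^+ 2 :> R.
      by rewrite -!natrM lerXn2r ?nnegrE // ler_nat.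
    have -> : (b - a)%:R ^+ 2 * w
      = x * h%:R / (32 * D%:R ^+ 3) * ((b - a)%:R * n%:R) ^+ 2 by rewrite /w; ring.
    have f0 : 0 <= x * h%:R / (32 * D%:R ^+ 3).
      by rewrite divr_ge0 ?mulr_ge0 ?(ltW x0) ?(ltW D3).
    apply: (le_trans (ler_wpM2l f0 g)).
    have -> : x * h%:R / (32 * D%:R ^+ 3) * (2 * D%:R) ^+ 2 = x * h%:R / D%:R / 8.
      by field; rewrite gt_eqF.
    have : 0 <= x * h%:R / D%:R by rewrite divr_ge0 ?mulr_ge0 ?(ltW x0).
    by lra.
  apply: sq_le; rewrite ?invr_ge0 ?(ltW s0) ?mulr_ge0 ?divr_ge0 ?sqrtr_ge0 //.
  rewrite exprVn sE !exprMn sqr_sqrtr ?divr_ge0 ?(ltW D3) ?(ltW x0) //.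
  have -> : w^-1 = 32 * (D%:R ^+ 3 / (x * n%:R ^+ 2)) / h%:R.
    by rewrite /w; field; rewrite !gt_eqF.
  have -> : 6 ^+ 2 * (D%:R ^+ 3 / x * n%:R^-1 ^+ 2)
    = 36 * (D%:R ^+ 3 / (x * n%:R ^+ 2)) by field; rewrite !gt_eqF.
  have g0 : 0 <= D%:R ^+ 3 / (x * n%:R ^+ 2).
    by rewrite divr_ge0 ?(ltW D3) // mulr_ge0 ?(ltW x0) // exprn_ge0.
  rewrite ler_pdivrMr //; have h1 : 1 <= h%:R :> R by rewrite ler1n.
  by have := ler_wpM2l g0 h1; lra.
apply: second_difference_test => //; first by lra.
move=> m mab; have /andP[m1 m2] := hm m mab.
have m1r : D%:R <= m%:R * n%:R :> R by rewrite -natrM ler_nat ltnW.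
have m2r : m%:R * n%:R <= 2 * D%:R :> R by rewrite -!natrM ler_nat.
have m3r : 3 <= m%:R :> R.
  by rewrite (ler_nat R 3) -(leq_pmul2r n0); apply: leq_trans nD _; apply: ltnW.
have m0r : 0 < m%:R :> R by lra.
have er : e%:R <= 1 :> R by rewrite lern1.
set al : R := e%:R / n%:R.
have al01 : 0 <= al <= 1.
  rewrite divr_ge0 //= ler_pdivrMr // mul1r.
  by apply: (le_trans er); rewrite ler1n.
have pE (j : nat) : phase x e h n (m + j) = x * h%:R / n%:R / (m%:R + al + j%:R).
  have p0 : 0 < (m%:R + j%:R) * n%:R + e%:R :> R.
    by rewrite ltr_wpDr // mulr_gt0 // ltr_wpDr.
  have -> : m%:R + al + j%:R = ((m%:R + j%:R) * n%:R + e%:R) / n%:R.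
    by rewrite /al; field; rewrite gt_eqF.
  by rewrite /phase natrD natrM natrD; field; rewrite !gt_eqF.
have := pE 0%N; have := pE 1%N; have := pE 2%N.
rewrite addn0 addn1 addn2 addr0 => -> -> ->.
have ma0 : 0 < m%:R + al by have /andP[? _] := al01; lra.
have sd := second_difference_inv ma0.
set q := x * h%:R / n%:R.
have q0 : 0 < q by rewrite divr_gt0 ?mulr_gt0.
have -> : q / (m%:R + al + 2) + c - 2 * (q / (m%:R + al + 1) + c)
   + (q / (m%:R + al) + c) = q * (2 / cubic (m%:R + al)).
  by rewrite -sd; ring.
have /andP[c1 c2] := cubic_bounds m3r al01.
have cu0 := cubic_gt0 ma0.
have mn3 : D%:R ^+ 3 <= (m%:R * n%:R) ^+ 3 :> R by rewrite lerXn2r ?nnegrE ?mulr_ge0.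
have mn3' : (m%:R * n%:R) ^+ 3 <= 8 * D%:R ^+ 3 :> R.
  have -> : 8 * D%:R ^+ 3 = (2 * D%:R) ^+ 3 :> R by ring.
  by rewrite lerXn2r ?nnegrE ?mulr_ge0.
have n3 : 0 < n%:R ^+ 3 :> R by rewrite exprn_gt0.
have k1 : D%:R ^+ 3 <= n%:R ^+ 3 * cubic (m%:R + al).
  apply: (le_trans mn3); rewrite exprMn mulrC; exact: (ler_wpM2l (ltW n3) c1).
have k2 : n%:R ^+ 3 * cubic (m%:R + al) <= 64 * D%:R ^+ 3.
  apply: (le_trans (ler_wpM2l (ltW n3) c2)).
  by move: mn3'; rewrite exprMn; lra.
have q20 : 0 < q * 2 by rewrite mulr_gt0.
rewrite sE; apply/andP; split.
  have -> : w = q * 2 * n%:R ^+ 3 / (64 * D%:R ^+ 3).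
    by rewrite /w /q; field; rewrite !gt_eqF.
  rewrite ler_pdivrMr ?mulr_gt0 //.
  have -> : q * (2 / cubic (m%:R + al)) * (64 * D%:R ^+ 3)
     = q * 2 / cubic (m%:R + al) * (64 * D%:R ^+ 3) by rewrite (mulrA q).
  by rewrite [leRHS]mulrAC ler_pdivlMr // -(mulrA (q * 2)) ler_pM2l.
have -> : 64 * w = q * 2 * n%:R ^+ 3 / D%:R ^+ 3.
  by rewrite /w /q; field; rewrite !gt_eqF.
rewrite ler_pdivlMr // (mulrA q) mulrAC ler_pdivrMr // -[leRHS](mulrA (q * 2)).
by rewrite ler_pM2l.
Qed.

Lemma dyadic_sum_bound (F : nat -> R) (B : R) (U J : nat) :
  (forall j, (j < J)%N -> `|\sum_(U * 2 ^ j <= n < 2 * (U * 2 ^ j)) F n| <= B) ->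
  `|\sum_(U <= n < U * 2 ^ J) F n| <= J%:R * B.
Proof.
elim: J => [|J IH] hB; first by rewrite muln1 big_geq // normr0 mul0r.
rewrite (big_cat_nat (n := (U * 2 ^ J)%N)) /=; first last.
- by rewrite leq_mul2l leq_exp2l // leqnSn orbT.
- by rewrite leq_pmulr // expn_gt0.
apply: (le_trans (ler_normD _ _)); rewrite -natr1 mulrDl mul1r; apply: lerD.
  by apply: IH => j jJ; apply: hB; rewrite ltnS ltnW.
have -> : (U * 2 ^ J.+1 = 2 * (U * 2 ^ J))%N by rewrite expnS; lia.
exact: hB.
Qed.

Lemma log2_le (n : nat) : (0 < n)%N ->
  (n < 2 ^ (trunc_log 2 n).+1)%N /\ (trunc_log 2 n).+1%:R <= 1 + 2 * ln n%:R :> R.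
Proof.
move=> n0; split; first exact: trunc_log_ltn.
set t := trunc_log 2 n.
have tn : (2 ^ t <= n)%N by rewrite trunc_logP.
rewrite -natr1 addrC lerD2l.
have l2 : 1 / 2 <= ln 2 :> R.
  have := @le_ln1Dx R (- 2^-1) ltac:(lra).
  have -> : 1 - 2^-1 = 2^-1 :> R by lra.
  by rewrite lnV ?posrE // => ?; lra.
have : t%:R * ln 2 <= ln n%:R :> R.
  rewrite mulr_natl -lnXn // ler_ln ?posrE ?exprn_gt0 ?ltr0n //.
  by rewrite -natrX ler_nat.
have : t%:R * (1 / 2) <= t%:R * ln 2 :> R by rewrite ler_wpM2l.
lra.
Qed.

End TypeOne.

(** * Sums over primes in a block *)

Section PrimeBlock.
Context {R : realType}.

Lemma sum_subrange (F : nat -> R) (a b L : nat) : (b <= L)%N ->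
  (forall n, ~~ (a <= n < b)%N -> F n = 0) ->
  \sum_(0 <= n < L) F n = \sum_(a <= n < b) F n.
Proof.
move=> bL F0; rewrite -(big_rmcond (fun n => a <= n < b)%N); last first.
  by move=> n; exact: F0.
rewrite -big_filter; apply: perm_big; apply: uniq_perm.
- by rewrite filter_uniq // iota_uniq.
- exact: iota_uniq.
- move=> n; rewrite mem_filter !mem_index_iota /=.
  by case: (boolP (a <= n < b)%N) => //= /andP[_ nb]; exact: leq_trans bL.
Qed.

Lemma sum_range_eq (F : nat -> R) (a b c d : nat) :
  (forall n, ~~ (a <= n < b)%N -> F n = 0) ->
  (forall n, ~~ (c <= n < d)%N -> F n = 0) ->
  \sum_(a <= n < b) F n = \sum_(c <= n < d) F n.
Proof.
move=> h1 h2; rewrite -(@sum_subrange F a b (b + d)) ?leq_addr //.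
by rewrite -(@sum_subrange F c d (b + d)) ?leq_addl.
Qed.

Lemma in_block_multiples (D D' n m : nat) : (0 < n)%N ->
  in_block D D' (m * n) = ((D %/ n).+1 <= m < (D' %/ n).+1)%N.
Proof. by move=> n0; rewrite /in_block !ltnS -ltn_divLR // leq_divRL. Qed.

(** Sizes are measured in powers of [z = x ^ (1 / 118)]: the target is
    [z ^ 56 = x ^ (28 / 59)] and a block [(D, D']] has [z ^ 56 <= D <= z ^ 62].
    The saving needed over the trivial bound is [P], about [D / z ^ 56]; the
    cut of Vaughan's identity is [U = P ^ 2], and [E] absorbs logarithms and
    the divisor function. *)
Variables (x z E c : R) (e D D' P H : nat).
Hypothesis e1 : (e <= 1)%N.
Hypothesis xz : x = z ^+ 118.
Hypothesis z_large : 2 ^+ 16 <= z.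
Hypothesis Dlo : z ^+ 56 <= D%:R.
Hypothesis Dup : D%:R <= z ^+ 62.
Hypothesis DD' : (D < D' <= 2 * D)%N.
Hypothesis P0 : (0 < P)%N.
Hypothesis Plo : D%:R <= P%:R * z ^+ 56.
Hypothesis Pup : P%:R * z ^+ 56 <= 2 * D%:R.
Hypothesis HP : (0 < H <= P)%N.
Hypothesis E_ln : 1 + 2 * ln x <= E.
Hypothesis E_div : forall v, (0 < v)%N -> v%:R <= x ->
  (size (divisors v))%:R <= E.

Definition block_phase (h d : nat) : R :=
  if in_block D D' d then ce (x * h%:R / (d + e)%:R + c) else 0.

Let G := block_phase.
Let U := (P ^ 2)%N.
Let K := D'.+1.

Lemma z_gt1 : 1 <= z.
Proof. by apply: le_trans z_large; rewrite exprn_ege1 // ler1n. Qed.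
Let z1 := z_gt1.
Let z0 : 0 < z. Proof. exact: lt_le_trans z1. Qed.
Let z00 : 0 <= z. Proof. exact: ltW z0. Qed.

Lemma zexp_le (i j : nat) : (i <= j)%N -> z ^+ i <= z ^+ j.
Proof. exact: ler_weXn2l. Qed.

Lemma zexp_gt0 (i : nat) : 0 < z ^+ i. Proof. exact: exprn_gt0. Qed.

(** One spare power of [z] absorbs any numerical constant. *)
Lemma zexp_absorb (k i : nat) : (k <= 16)%N -> 2 ^+ k * z ^+ i <= z ^+ i.+1.
Proof.
move=> k16; rewrite exprS ler_wpM2r ?exprn_ge0 ?(ltW z0) //.
by apply: le_trans z_large; rewrite ler_weXn2l // ler1n.
Qed.

Lemma x_gt0 : 0 < x. Proof. by rewrite xz zexp_gt0. Qed.
Let x0 := x_gt0.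

Lemma D_gt0 : (0 < D)%N.
Proof. by rewrite -(ltr0n R); apply: lt_le_trans Dlo; exact: zexp_gt0. Qed.
Let D0 := D_gt0.
Let D0r : 0 < D%:R :> R. Proof. by rewrite ltr0n. Qed.

Lemma P_le : P%:R <= 2 * z ^+ 6 :> R.
Proof.
rewrite -(ler_pM2r (zexp_gt0 56)) -mulrA -exprD.
apply: (le_trans Pup); rewrite ler_pM2l //; exact: Dup.
Qed.

Lemma K_le_x : K%:R <= x.
Proof.
apply: (@le_trans _ _ (4 * D%:R)).
  rewrite -natrM ler_nat /K; case/andP: DD' => _ DD.
  apply: (@leq_trans (3 * D)); last by rewrite leq_mul2r orbT.
  by rewrite -addn1 (mulnDl 2 1 D) mul1n leq_add // D_gt0.
apply: (@le_trans _ _ (2 ^+ 2 * z ^+ 62)).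
  by rewrite -natrX ler_pM2l.
by apply: (le_trans (@zexp_absorb 2 62 isT)); rewrite xz; exact: zexp_le.
Qed.

Lemma E_ge1 : 1 <= E.
Proof.
have : 1 <= x by rewrite xz exprn_ege1.
by move=> /ln_ge0 ?; apply: le_trans E_ln; lra.
Qed.
Let E1 := E_ge1.
Let E0 : 0 < E. Proof. exact: lt_le_trans E1. Qed.

Lemma E_log2 (v : nat) : (0 < v)%N -> v%:R <= x -> 1 + 2 * ln v%:R <= E.
Proof.
move=> v0 vx; apply: le_trans E_ln; rewrite lerD2l ler_pM2l //.
by rewrite ler_ln ?posrE // ltr0n.
Qed.

Lemma E_lnv (v : nat) : (0 < v)%N -> v%:R <= x -> 0 <= (ln v%:R : R) <= E.
Proof.
move=> v0 vx; have l0 : 0 <= ln v%:R :> R by rewrite ln_ge0 // ler1n.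
by rewrite l0 /=; have := E_log2 v0 vx; lra.
Qed.

Lemma E_harmonic (v : nat) : (0 < v)%N -> v%:R <= x -> harmonic_sum v <= E :> R.
Proof.
move=> v0 vx; apply: (le_trans (harmonic_sum_le v0)).
have /andP[l0 _] := E_lnv v0 vx.
by have := E_log2 v0 vx; lra.
Qed.

Lemma three_UU_le : (3 * (U * U) <= D)%N.
Proof.
rewrite -(ler_nat R); apply: le_trans Dlo.
have -> : (3 * (U * U))%:R = 3 * P%:R ^+ 4 :> R.
  by rewrite /U 2!natrM natrX -exprD.
have h : P%:R ^+ 4 <= (2 * z ^+ 6) ^+ 4 :> R.
  by apply: lerXn2r P_le; rewrite nnegrE ?mulr_ge0 // ltW // zexp_gt0.
apply: (@le_trans _ _ (2 ^+ 6 * z ^+ 24)).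
  apply: (@le_trans _ _ (3 * (2 * z ^+ 6) ^+ 4)); first by rewrite ler_pM2l.
  rewrite exprMn -exprM mulrA ler_pM2r ?zexp_gt0 // -!natrX -natrM ler_nat //.
by apply: (le_trans (@zexp_absorb 6 24 isT)); exact: zexp_le.
Qed.

Lemma U_gt0 : (0 < U)%N. Proof. by rewrite expn_gt0 P0. Qed.
Let U0 := U_gt0.

Lemma U_le_D : (3 * U <= D)%N.
Proof.
by apply: leq_trans three_UU_le; rewrite leq_mul2l leq_pmulr.
Qed.

Lemma U_lt_K : (U < K)%N.
Proof.
rewrite ltnS; apply: (@leq_trans D); last by case/andP: DD' => /ltnW.
by apply: leq_trans U_le_D; rewrite leq_pmull.
Qed.

Let Bn (n : nat) : R := type_one_const * (2 * z ^+ 31 + z ^+ 34 / n%:R).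

Lemma Bn_ge0 n : 0 <= Bn n.
Proof.
apply: mulr_ge0; first exact: ltW (type_one_const_gt0 (R := R)).
by apply: addr_ge0; [apply: mulr_ge0|apply: divr_ge0] => //; exact: ltW (zexp_gt0 _).
Qed.

Lemma multiples_partial (h n a b : nat) :
  (H <= h < 2 * H)%N -> (0 < n)%N -> (3 * n <= D)%N ->
  (forall m, (a <= m < b)%N -> in_block D D' (m * n)) ->
  `|\sum_(a <= m < b) ce (phase x e h n m + c)| <= Bn n.
Proof.
move=> hh n0 nD hm.
have h0 : (0 < h)%N by case/andP: hh => + _; apply: leq_trans; case/andP: HP.
apply: (le_trans (@type_one R x c e h n D a b x0 e1 h0 n0 nD _)).
  move=> m /hm /andP[-> mD] /=; apply: (leq_trans mD).
  by case/andP: DD'.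
rewrite /Bn ler_pM2l ?type_one_const_gt0 //; apply: lerD.
  rewrite -[2 * z ^+ 31]ger0_norm ?mulr_ge0 ?exprn_ge0 //.
  rewrite -sqrtr_sqr ler_wsqrtr // ler_pdivrMr // exprMn -exprM.
  have hP : h%:R <= 2 * P%:R :> R.
    by rewrite -natrM ler_nat; case/andP: hh => _ /ltnW /leq_trans; apply;
      rewrite leq_mul2l; case/andP: HP.
  have hz : h%:R * z ^+ 56 <= 4 * D%:R.
    have := ler_wpM2r (ltW (zexp_gt0 56)) hP; move: Pup; lra.
  have -> : x * h%:R = z ^+ 62 * (h%:R * z ^+ 56).
    by rewrite xz mulrCA -exprD mulrC.
  have := ler_wpM2l (ltW (zexp_gt0 62)) hz; lra.
rewrite ler_pM2r ?invr_gt0 ?ltr0n //.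
rewrite -[leRHS]ger0_norm ?exprn_ge0 // -sqrtr_sqr ler_wsqrtr //.
rewrite ler_pdivrMr // xz -exprM -exprD.
apply: (@le_trans _ _ ((z ^+ 62) ^+ 3)); last by rewrite -exprM.
by rewrite lerXn2r ?nnegrE ?exprn_ge0.
Qed.

Lemma multiples_weighted (g : nat -> R) (h n : nat) : (0 < n)%N ->
  \sum_(1 <= m < K) g m * G h (n * m)%N
  = \sum_((D %/ n).+1 <= m < (D' %/ n).+1) g m * ce (phase x e h n m + c).
Proof.
move=> n0; transitivity (\sum_((D %/ n).+1 <= m < (D' %/ n).+1) g m * G h (n * m)%N).
  have van m : ~~ ((D %/ n).+1 <= m < (D' %/ n).+1)%N -> g m * G h (n * m)%N = 0.
    by rewrite -in_block_multiples // mulnC /G /block_phase => /negbTE ->; rewrite mulr0.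
  apply: sum_range_eq => // m nm; apply: van; apply: contra nm => /andP[m1 m2].
  apply/andP; split; first exact: leq_ltn_trans m1.
  by apply: (leq_trans m2); rewrite /K ltnS leq_div.
apply: eq_big_nat => m; rewrite -in_block_multiples // => mb.
by rewrite /G /block_phase mulnC mb.
Qed.

Lemma multiples_sum (h n : nat) :
  (H <= h < 2 * H)%N -> (0 < n)%N -> (3 * n <= D)%N ->
  `|\sum_(1 <= m < K) G h (n * m)%N| <= Bn n.
Proof.
move=> hh n0 nD; under eq_bigr do rewrite -[G _ _]mul1r.
rewrite (multiples_weighted (fun=> 1)) //; under eq_bigr do rewrite mul1r.
by apply: multiples_partial => // m; rewrite in_block_multiples.
Qed.

Lemma multiples_log_sum (h n : nat) :
  (H <= h < 2 * H)%N -> (0 < n)%N -> (3 * n <= D)%N ->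
  `|\sum_(1 <= m < K) ln m%:R * G h (n * m)%N| <= 4 * (E * Bn n).
Proof.
move=> hh n0 nD; rewrite multiples_weighted //.
apply: abel_sum_bound; rewrite ?Bn_ge0 ?(ltW E0) //.
- move=> m /andP[m1 m2].
  have m0 : (0 < m)%N by exact: leq_ltn_trans m1.
  have mx : m%:R <= x.
    apply: le_trans K_le_x; rewrite ler_nat; apply: (leq_trans (ltnW m2)).
    by rewrite /K ltnS leq_div.
  by have /andP[l0 l1] := E_lnv m0 mx; rewrite ger0_norm.
- move=> m m1 _; have m0 : (0 < m)%N by exact: leq_ltn_trans m1.
  by rewrite ler_ln ?posrE ?ltr0n // ler_nat.
- move=> k /andP[k1 k2]; apply: multiples_partial => // m /andP[m1 m2].
  by rewrite in_block_multiples // m1 (leq_trans m2).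
Qed.

(** The two type I parts of Vaughan's identity. *)
Lemma type_one_part (h : nat) : (H <= h < 2 * H)%N ->
  `|\sum_(1 <= b < U.+1) moebius b *
      (\sum_(1 <= m < K) ln m%:R * G h (b * m)%N)
    - \sum_(1 <= b < U.+1) \sum_(1 <= d < U.+1)
        moebius b * vonMangoldt R d * (\sum_(1 <= m < K) G h (b * d * m)%N)|
  <= 200 * type_one_const * E ^+ 3 * z ^+ 56.
Proof.
move=> hh; apply: (le_trans (ler_normB _ _)).
have Ux : U%:R <= x.
  by apply: le_trans K_le_x; rewrite ler_nat ltnW // U_lt_K.
have hU : \sum_(1 <= b < U.+1) (b%:R^-1 : R) <= E.
  by rewrite big_add1 /=; exact: E_harmonic.
have Uz : (U * U)%:R <= 2 ^+ 4 * z ^+ 24 :> R.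
  have hP4 : P%:R ^+ 4 <= (2 * z ^+ 6) ^+ 4 :> R.
    by apply: lerXn2r P_le; rewrite nnegrE ?mulr_ge0 // ltW // zexp_gt0.
  by move: hP4; rewrite exprMn -exprM /U natrM natrX -exprD.
have c0 : 0 <= type_one_const :> R := ltW (type_one_const_gt0 (R := R)).
have Uz2 : U%:R * z ^+ 31 <= 2 ^+ 4 * z ^+ 55.
  apply: (@le_trans _ _ ((U * U)%:R * z ^+ 31)).
    by rewrite ler_pM2r ?zexp_gt0 // ler_nat leq_pmulr.
  by rewrite [z ^+ 55](exprD z 24 31) mulrA ler_pM2r ?zexp_gt0.
have UUz2 : (U * U)%:R * z ^+ 31 <= 2 ^+ 4 * z ^+ 55.
  by rewrite [z ^+ 55](exprD z 24 31) mulrA ler_pM2r ?zexp_gt0.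
have z5556 : z ^+ 55 <= z ^+ 56 by exact: zexp_le.
have z3456 : z ^+ 34 <= z ^+ 56 by exact: zexp_le.
have z560 := zexp_gt0 56.
have E2 : E <= E ^+ 2 by rewrite expr2 ler_peMr // ltW.
have E23 : E ^+ 2 <= E ^+ 3 by apply: ler_weXn2l.
have E12 : 1 <= E ^+ 2 := le_trans E1 E2.
have part1 : `|\sum_(1 <= b < U.+1) moebius b *
    (\sum_(1 <= m < K) ln m%:R * G h (b * m)%N)| <= 4 * E ^+ 3 * type_one_const * (33 * z ^+ 56).
  apply: (le_trans (ler_norm_sum _ _ _)).
  apply: (@le_trans _ _ (\sum_(1 <= b < U.+1) 4 * (E * Bn b))).
    rewrite big_nat [leRHS]big_nat; apply: ler_sum => b /andP[b0 bU].
    rewrite normrM -[leRHS]mul1r; apply: ler_pM => //; first exact: moebius_norm.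
    apply: multiples_log_sum => //; apply: leq_trans U_le_D.
    by rewrite leq_mul2l.
  have -> : \sum_(1 <= b < U.+1) 4 * (E * Bn b)
    = 4 * E * type_one_const * (2 * (U%:R * z ^+ 31) + z ^+ 34 * \sum_(1 <= b < U.+1) b%:R^-1).
    rewrite mulr_sumr (_ : U%:R = (U.+1 - 1)%:R); last by rewrite subSS subn0.
    have -> : 2 * ((U.+1 - 1)%:R * z ^+ 31) = \sum_(1 <= b < U.+1) 2 * z ^+ 31.
      by rewrite sumr_const_nat -[RHS]mulr_natl; ring.
    by rewrite -big_split mulr_sumr /=; apply: eq_bigr => b _; rewrite /Bn; ring.
  have k1 : z ^+ 34 * \sum_(1 <= b < U.+1) b%:R^-1 <= z ^+ 56 * E.
    by apply: ler_pM => //; [exact/ltW/zexp_gt0|refine (sumr_ge0 _ _)].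
  have k2 : 2 * (U%:R * z ^+ 31) + z ^+ 34 * \sum_(1 <= b < U.+1) b%:R^-1
      <= 33 * z ^+ 56 * E.
    have := ler_wpM2l (ltW z560) E1; rewrite mulr1; move: Uz2 k1 z5556.
    by rewrite (_ : 2 ^+ 4 = 16 :> R); [lra|rewrite -natrX].
  have f0 : 0 <= 4 * E * type_one_const by rewrite !mulr_ge0 // ltW.
  apply: (le_trans (ler_wpM2l f0 k2)).
  have -> : 4 * E * type_one_const * (33 * z ^+ 56 * E) = 4 * type_one_const * (33 * z ^+ 56) * E ^+ 2 by ring.
  have -> : 4 * E ^+ 3 * type_one_const * (33 * z ^+ 56) = 4 * type_one_const * (33 * z ^+ 56) * E ^+ 3 by ring.
  by apply: ler_wpM2l => //; rewrite !mulr_ge0 // ltW.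
have part2 : `|\sum_(1 <= b < U.+1) \sum_(1 <= d < U.+1)
   moebius b * vonMangoldt R d * (\sum_(1 <= m < K) G h (b * d * m)%N)|
   <= E ^+ 3 * type_one_const * (33 * z ^+ 56).
  apply: (le_trans (ler_norm_sum _ _ _)).
  apply: (@le_trans _ _ (\sum_(1 <= b < U.+1) \sum_(1 <= d < U.+1) E * Bn (b * d))).
    rewrite big_nat [leRHS]big_nat; apply: ler_sum => b /andP[b0 bU].
    apply: (le_trans (ler_norm_sum _ _ _)).
    rewrite big_nat [leRHS]big_nat; apply: ler_sum => d /andP[d0 dU].
    have dx : d%:R <= x by apply: le_trans Ux; rewrite ler_nat.
    rewrite !normrM; apply: ler_pM; rewrite ?mulr_ge0 //.
      rewrite -[leRHS]mul1r; apply: ler_pM => //; first exact: moebius_norm.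
      rewrite ger0_norm ?vonMangoldt_ge0 //.
      apply: (le_trans (vonMangoldt_le d0)).
      by have /andP[] := E_lnv d0 dx.
    apply: multiples_sum => //; first by rewrite muln_gt0 b0.
    by apply: leq_trans three_UU_le; rewrite leq_mul2l leq_mul.
  have -> : \sum_(1 <= b < U.+1) \sum_(1 <= d < U.+1) E * Bn (b * d)
    = E * type_one_const * (2 * ((U * U)%:R * z ^+ 31) + z ^+ 34 *
       ((\sum_(1 <= b < U.+1) b%:R^-1) * (\sum_(1 <= d < U.+1) d%:R^-1))).
    rewrite big_distrlr /= mulr_sumr.
    have -> : 2 * ((U * U)%:R * z ^+ 31)
       = \sum_(1 <= b < U.+1) \sum_(1 <= d < U.+1) 2 * z ^+ 31.
      by rewrite !sumr_const_nat subSS subn0 -mulrnA -[RHS]mulr_natl; ring.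
    rewrite -big_split mulr_sumr /=; apply: eq_bigr => b _.
    rewrite mulr_sumr -big_split mulr_sumr /=; apply: eq_bigr => d _.
    by rewrite /Bn natrM invfM; ring.
  have s0 : 0 <= \sum_(1 <= b < U.+1) (b%:R^-1 : R) by refine (sumr_ge0 _ _).
  have k1 : z ^+ 34 * ((\sum_(1 <= b < U.+1) b%:R^-1) * (\sum_(1 <= d < U.+1) d%:R^-1))
      <= z ^+ 56 * E ^+ 2.
    apply: ler_pM => //; [exact/ltW/zexp_gt0|by rewrite mulr_ge0|].
    by rewrite expr2; apply: ler_pM.
  have k2 : 2 * ((U * U)%:R * z ^+ 31) + z ^+ 34 *
       ((\sum_(1 <= b < U.+1) b%:R^-1) * (\sum_(1 <= d < U.+1) d%:R^-1))
      <= 33 * z ^+ 56 * E ^+ 2.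
    have := ler_wpM2l (ltW z560) E12; rewrite mulr1; move: UUz2 k1 z5556.
    by rewrite (_ : 2 ^+ 4 = 16 :> R); [lra|rewrite -natrX].
  have f0 : 0 <= E * type_one_const by rewrite mulr_ge0 // ltW.
  apply: (le_trans (ler_wpM2l f0 k2)).
  by rewrite le_eqVlt; apply/orP; left; apply/eqP; ring.
apply: (le_trans (lerD part1 part2)).
have X0 : 0 <= type_one_const * E ^+ 3 * z ^+ 56 by rewrite !mulr_ge0 ?exprn_ge0 // ltW.
lra.
Qed.

(** The square root of [D], which the smaller of two factors cannot exceed by
    more than a constant. *)
Let Y := Num.truncn (Num.sqrt D%:R : R).

Lemma Y_bounds : Y%:R ^+ 2 <= D%:R :> R /\ D%:R < (Y%:R + 1) ^+ 2 :> R.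
Proof.
have s0 : 0 <= Num.sqrt D%:R :> R := sqrtr_ge0 _.
have /andP[y1 y2] := truncn_itv s0.
rewrite -/Y in y1 y2.
have sE : Num.sqrt D%:R ^+ 2 = D%:R :> R by rewrite sqr_sqrtr.
split; rewrite -sE; first by rewrite lerXn2r ?nnegrE.
by rewrite natr1 ltrXn2r ?nnegrE.
Qed.

Lemma Y_le : Y%:R <= z ^+ 31.
Proof.
have [y1 _] := Y_bounds.
rewrite -(@ler_pXn2r _ 2) ?nnegrE ?exprn_ge0 // -exprM.
exact: le_trans Dup.
Qed.

Lemma Y_large : 2 ^+ 13 * z ^+ 6 <= Y%:R.
Proof.
have [_ y2] := Y_bounds.
have h1 : z ^+ 28 < Y%:R + 1.
  rewrite -(@ltr_pXn2r _ 2) ?nnegrE ?exprn_ge0 ?addr_ge0 // -exprM.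
  exact: le_lt_trans y2.
have h2 : 2 ^+ 13 * z ^+ 6 <= z ^+ 7 := @zexp_absorb 13 6 isT.
have h3 : 1 <= z ^+ 7 by rewrite exprn_ege1.
have h4 : 2 ^+ 1 * z ^+ 7 <= z ^+ 8 := @zexp_absorb 1 7 isT.
have h5 : z ^+ 8 <= z ^+ 28 by exact: zexp_le.
by rewrite expr1 in h4; lra.
Qed.

Lemma type_two_const_ge1 : 1 <= type_two_const :> R.
Proof.
have := pair_const_ge0 (R := R).
by rewrite /type_two_const; lra.
Qed.

Lemma block_bound_ge0 : 0 <= type_two_const * E * (H%:R * z ^+ 56).
Proof.
apply: mulr_ge0; last by rewrite mulr_ge0 // exprn_ge0.
by apply: mulr_ge0; [exact: le_trans ler01 type_two_const_ge1|exact: ltW].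
Qed.

(** For [U <= N <= 4 * Y], the hypotheses of [type_two] hold with [r = U]. *)
Section Conditions.
Variable N : nat.
Hypothesis UN : (U <= N)%N.
Hypothesis NY : (N <= 4 * Y)%N.

Let NYr : N%:R <= 4 * Y%:R :> R. Proof. by rewrite -natrM ler_nat. Qed.
Let Nz : N%:R <= 4 * z ^+ 31.
Proof. by apply: (le_trans NYr); rewrite ler_pM2l // Y_le. Qed.

Lemma type_two_size : (768 * H * N <= D)%N.
Proof.
rewrite -(ler_nat R) 2!natrM.
have [y1 _] := Y_bounds.
have HPr : H%:R <= P%:R :> R by rewrite ler_nat; case/andP: HP.
have Hz := le_trans HPr P_le.
have k0 : 0 <= 768%:R :> R by exact: ler0n.
have k1 : 768%:R <= 2 ^+ 10 :> R by rewrite -natrX ler_nat.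
move: (768%:R : R) k0 k1 => k k0 k1.
have h1 : k * H%:R <= 2 ^+ 10 * (2 * z ^+ 6) by exact: ler_pM.
have h2 : k * H%:R * N%:R <= 2 ^+ 10 * (2 * z ^+ 6) * (4 * Y%:R).
  by apply: ler_pM => //; rewrite mulr_ge0.
apply: (le_trans h2); apply: le_trans y1.
have -> : 2 ^+ 10 * (2 * z ^+ 6) * (4 * Y%:R) = (2 ^+ 13 * z ^+ 6) * Y%:R.
  by ring.
by rewrite expr2 ler_wpM2r // Y_large.
Qed.

Let Pup6 k : (P%:R * z ^+ 56) ^+ k <= (2 * D%:R) ^+ k :> R.
Proof. by apply: lerXn2r Pup; rewrite nnegrE mulr_ge0 // exprn_ge0. Qed.

Let D_pow k : D%:R ^+ k <= z ^+ (62 * k).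
Proof. by rewrite exprM; apply: lerXn2r Dup; rewrite nnegrE // exprn_ge0. Qed.

(** The second derivative test applied to the off-diagonal pairs is efficient as
    long as [D ^ 3 * N <= z ^ 218]; [N] is at most about [z ^ 31]. *)
Lemma type_two_main : U%:R ^+ 3 * x * N%:R <= D%:R ^+ 3.
Proof.
rewrite -(ler_pM2r (zexp_gt0 336)).
have -> : U%:R ^+ 3 * x * N%:R * z ^+ 336
   = (P%:R * z ^+ 56) ^+ 6 * z ^+ 118 * N%:R.
  by rewrite /U natrX -exprM exprMn -exprM xz; ring.
apply: (@le_trans _ _ ((2 * D%:R) ^+ 6 * z ^+ 118 * (4 * z ^+ 31))).
  rewrite ler_pM ?mulr_ge0 ?exprn_ge0 ?mulr_ge0 ?exprn_ge0 //.
  by rewrite ler_pM2r ?zexp_gt0.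
have -> : (2 * D%:R) ^+ 6 * z ^+ 118 * (4 * z ^+ 31)
   = D%:R ^+ 3 * (256 * (D%:R ^+ 3 * z ^+ 149)) :> R.
  by rewrite exprMn (exprD z 118 31) (exprD D%:R 3 3); ring.
rewrite ler_wpM2l ?exprn_ge0 //.
apply: (@le_trans _ _ (2 ^+ 8 * z ^+ 335)); last exact: zexp_absorb.
have -> : 256 = 2 ^+ 8 :> R by rewrite -natrX.
rewrite ler_pM2l ?exprn_gt0 // (exprD z 186 149) ler_pM2r ?zexp_gt0 //.
Qed.

Lemma type_two_secondary : U%:R ^+ 2 * D%:R * N%:R <= x.
Proof.
rewrite xz -(ler_pM2r (zexp_gt0 224)) -exprD.
have -> : U%:R ^+ 2 * D%:R * N%:R * z ^+ 224
   = (P%:R * z ^+ 56) ^+ 4 * D%:R * N%:R.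
  by rewrite /U natrX -exprM exprMn -exprM; ring.
apply: (@le_trans _ _ ((2 * D%:R) ^+ 4 * D%:R * (4 * z ^+ 31))).
  rewrite ler_pM ?mulr_ge0 ?exprn_ge0 ?mulr_ge0 ?exprn_ge0 //.
  by rewrite ler_pM2r.
have -> : (2 * D%:R) ^+ 4 * D%:R * (4 * z ^+ 31)
   = 2 ^+ 6 * (D%:R ^+ 5 * z ^+ 31) :> R by rewrite exprMn exprSr; ring.
apply: (@le_trans _ _ (2 ^+ 6 * z ^+ 341)); last exact: zexp_absorb.
rewrite ler_pM2l ?exprn_gt0 // (exprD z 310 31) ler_pM2r ?zexp_gt0 //.
Qed.

Lemma type_two_block (a : nat -> nat -> R) (b : nat -> R) :
  (forall h n, `|a h n| <= 1) -> (forall m, `|b m| <= 1) ->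
  `|\sum_(H <= h < 2 * H) \sum_(N <= n < 2 * N) \sum_(1 <= m < K)
      a h n * b m * G h (n * m)%N| <= type_two_const * E * (H%:R * z ^+ 56).
Proof.
move=> a1 b1; pose M := ((2 * D) %/ N).+1.
have N0 : (0 < N)%N := leq_trans U0 UN.
have H0 : (0 < H)%N by case/andP: HP.
have DD2 : (D' <= 2 * D)%N by case/andP: DD'.
have ND : (N <= D)%N.
  apply: leq_trans type_two_size; rewrite leq_pmull // muln_gt0 H0 //.
have NM : (2 * D < N * M)%N by rewrite (mulnC N) -ltn_divLR // ltnSn.
have NM3 : (N * M <= 3 * D)%N.
  rewrite mulnS addnC (mulnDl 2 1 D) mul1n leq_add // mulnC.
  exact: leq_trunc_div.
have -> : \sum_(H <= h < 2 * H) \sum_(N <= n < 2 * N) \sum_(1 <= m < K)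
      a h n * b m * G h (n * m)%N
   = \sum_(H <= h < 2 * H) \sum_(N <= n < 2 * N)
     \sum_(0 <= m < M | in_block D D' (m * n))
       a h n * b m * ce (phase x e h n m + c).
  apply: eq_bigr => h _; apply: eq_big_nat => n /andP[n1 _].
  have n0 : (0 < n)%N := leq_trans N0 n1.
  rewrite [RHS]big_mkcond /=.
  transitivity (\sum_(1 <= m < K) (if in_block D D' (m * n)
      then a h n * b m * ce (phase x e h n m + c) else 0)).
    apply: eq_bigr => m _; rewrite /G /block_phase (mulnC n m).
    by case: ifP => _ //; rewrite mulr0.
  have van m : ~~ ((D %/ n).+1 <= m < (D' %/ n).+1)%N ->
     (if in_block D D' (m * n)
      then a h n * b m * ce (phase x e h n m + c) else 0) = 0.
    by rewrite -in_block_multiples // => /negbTE ->.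
  apply: sum_range_eq => m nm; apply: van; apply: contra nm => /andP[m1 m2].
    rewrite (leq_ltn_trans _ m1) //= (leq_trans m2) //.
    by rewrite /K ltnS leq_div.
  rewrite /= (leq_trans m2) // /M ltnS.
  by apply: leq_trans (leq_div2r n DD2) _; apply: leq_div2l.
have Hr0 : 0 < H%:R :> R by rewrite ltr0n.
have sq := @type_two R x E c e H N D D' M U a b x0 e1 H0 U0 UN type_two_size DD2
  NM NM3 type_two_main type_two_secondary (ltW E0).
have {}sq := sq _ a1 b1.
have C0 : 0 <= type_two_const * E * (H%:R * z ^+ 56).
  exact: block_bound_ge0.
rewrite -(@ler_pXn2r _ 2) ?nnegrE // real_normK ?num_real //.
apply: (le_trans (sq _)).
  move=> v /andP[v0 vN]; apply: E_div => //.
  apply: le_trans K_le_x; rewrite ler_nat; apply: (leq_trans vN).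
  apply: (@leq_trans D); last by rewrite /K; case/andP: DD' => /ltnW /leqW.
  by apply: leq_trans type_two_size; rewrite -!mulnA leq_mul2r /= orbT.
have P0r : 0 < P%:R :> R by rewrite ltr0n.
have DP : D%:R / P%:R <= z ^+ 56 by rewrite ler_pdivrMr // mulrC.
have -> : type_two_const * E * (D%:R * H%:R) ^+ 2 / U%:R
   = (type_two_const * E) * (H%:R * (D%:R / P%:R)) ^+ 2 :> R.
  by rewrite /U natrX; field; rewrite gt_eqF.
have cE : 1 <= type_two_const * E by rewrite -[leLHS]mulr1 ler_pM // type_two_const_ge1.
have cE0 : 0 <= type_two_const * E by exact: le_trans cE.
rewrite [leRHS]exprMn; apply: ler_pM; rewrite ?sqr_ge0 //.
  by rewrite expr2 ler_peMr.
apply: lerXn2r; rewrite ?nnegrE ?mulr_ge0 ?exprn_ge0 //.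
by rewrite ler_pM2l.
Qed.

End Conditions.

(** Dyadic decomposition of the range of the short variable. *)
Lemma type_two_range (a : nat -> nat -> R) (b : nat -> R) (Z : nat) :
  (Z <= 4 * Y)%N -> (Z <= K)%N ->
  (forall h n, ~~ (U <= n < Z)%N -> a h n = 0) ->
  (forall h n, `|a h n| <= 1) -> (forall m, `|b m| <= 1) ->
  `|\sum_(H <= h < 2 * H) \sum_(1 <= n < K) \sum_(1 <= m < K)
      a h n * b m * G h (n * m)%N| <= E * (type_two_const * E * (H%:R * z ^+ 56)).
Proof.
move=> ZY ZK avan a1 b1.
pose F n := \sum_(H <= h < 2 * H) \sum_(1 <= m < K) a h n * b m * G h (n * m)%N.
pose J := (trunc_log 2 K).+1.
have [JK Jle] := @log2_le R K isT.
have Fvan n : ~~ (U <= n < Z)%N -> F n = 0.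
  move=> hn; rewrite /F big1 // => h _; rewrite big1 // => m _.
  by rewrite avan // !mul0r.
have -> : \sum_(H <= h < 2 * H) \sum_(1 <= n < K) \sum_(1 <= m < K)
      a h n * b m * G h (n * m)%N = \sum_(U <= n < U * 2 ^ J) F n.
  rewrite exchange_big /= -/F.
  apply: sum_range_eq => n nm; apply: Fvan; apply: contra nm => /andP[n1 n2].
    by rewrite (leq_trans U0 n1) (leq_trans n2).
  rewrite n1 /=; apply: (leq_trans n2); apply: (leq_trans ZK).
  by apply: (leq_trans (ltnW JK)); rewrite leq_pmull.
have B0 : 0 <= type_two_const * E * (H%:R * z ^+ 56).
  exact: block_bound_ge0.
apply: (@le_trans _ _ (J%:R * (type_two_const * E * (H%:R * z ^+ 56)))); last first.
  rewrite ler_wpM2r //; apply: (le_trans Jle); apply: E_log2 => //.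
  exact: K_le_x.
apply: dyadic_sum_bound => j _; set N := (U * 2 ^ j)%N.
have UN : (U <= N)%N by rewrite leq_pmulr // expn_gt0.
case: (leqP N (4 * Y)) => NY.
  by rewrite /F exchange_big /=; exact: type_two_block.
rewrite big_nat big1 ?normr0 // => n /andP[Nn _]; apply: Fvan.
apply/negP => /andP[_ nZ]; have := leq_trans nZ ZY.
by rewrite ltnNge => /negP; apply; apply: leq_trans Nn; exact: ltnW.
Qed.

Lemma moebius_tail_le (m : nat) : (0 < m)%N -> m%:R <= x ->
  `|moebius_tail U m : R| <= E.
Proof.
move=> m0 mx; apply: le_trans (E_div m0 mx).
apply: (le_trans (ler_norm_sum _ _ _)); rewrite big_mkcond /=.
rewrite -[leRHS]mulr1 mulr_natl.
have -> : 1 *+ size (divisors m) = \sum_(b <- divisors m) 1 :> R.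
  by rewrite big_const_seq count_predT iter_addr_0.
by apply: ler_sum => b _; case: ifP => _ //; exact: moebius_norm.
Qed.

(** The type II part of Vaughan's identity: one of the two variables is at most
    about the square root of [D], and that one is made the inner variable. *)
Lemma type_two_part (sg : nat -> R) : (forall h, `|sg h| <= 1) ->
  `|\sum_(H <= h < 2 * H) sg h * (\sum_(U.+1 <= d < K) \sum_(U.+1 <= m < K)
       vonMangoldt R d * moebius_tail U m * G h (d * m)%N)|
  <= 2 * type_two_const * E ^+ 4 * (H%:R * z ^+ 56).
Proof.
move=> sg1.
pose L d : R := if (U < d < K)%N then vonMangoldt R d / E else 0.
pose B m : R := if (U < m < K)%N then moebius_tail U m / E else 0.
have le_K m : (m < K)%N -> m%:R <= x.
  by move=> mK; apply: le_trans K_le_x; rewrite ler_nat ltnW.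
have L1 d : `|L d| <= 1.
  rewrite /L; case: ifP => [/andP[d0 dK]|_]; last by rewrite normr0.
  have dpos := leq_ltn_trans (leq0n U) d0.
  rewrite normrM normfV (gtr0_norm E0) ler_pdivrMr // mul1r.
  rewrite ger0_norm ?vonMangoldt_ge0 //; apply: (le_trans (vonMangoldt_le dpos)).
  by have /andP[] := E_lnv dpos (le_K _ dK).
have B1 m : `|B m| <= 1.
  rewrite /B; case: ifP => [/andP[m0 mK]|_]; last by rewrite normr0.
  have mpos := leq_ltn_trans (leq0n U) m0.
  rewrite normrM normfV (gtr0_norm E0) ler_pdivrMr // mul1r.
  exact: moebius_tail_le (le_K _ mK).
pose L1' d := if (d <= Y)%N then L d else 0.
pose L2' d := if (d <= Y)%N then 0 else L d.
pose B2 m := if (m < 2 * Y.+1)%N then B m else 0.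
have Ypos : (4 <= Y)%N.
  rewrite -(ler_nat R); apply: le_trans Y_large.
  have : 1 <= z ^+ 6 by rewrite exprn_ege1.
  by have : 4 <= 2 ^+ 13 :> R; [rewrite -natrX ler_nat|move=> ? ?; nra].
have [y1 y2] := Y_bounds.
have YD : (Y ^ 2 <= D)%N by rewrite -(ler_nat R) natrX.
have DY : (D < Y.+1 ^ 2)%N by rewrite -(ltr_nat R) natrX -natr1.
have Y4 : (2 * Y.+1 <= 4 * Y)%N.
  rewrite mulnS (_ : 4 * Y = 2 * Y + 2 * Y)%N; last by rewrite -mulnDl.
  by rewrite leq_add2r leq_pmulr // (leq_trans _ Ypos).
have YK : (2 * Y.+1 <= K)%N.
  apply: (leq_trans Y4); apply: (@leq_trans (Y ^ 2)).
    by rewrite -mulnn leq_mul2r Ypos orbT.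
  by apply: (leq_trans YD); rewrite /K; case/andP: DD' => /ltnW /leqW.
have split_h h : \sum_(U.+1 <= d < K) \sum_(U.+1 <= m < K)
       vonMangoldt R d * moebius_tail U m * G h (d * m)%N
   = E ^+ 2 * (\sum_(1 <= n < K) \sum_(1 <= m < K) L1' n * B m * G h (n * m)%N
      + \sum_(1 <= n < K) \sum_(1 <= m < K) B2 n * L2' m * G h (n * m)%N).
  have lift (F : nat -> R) : \sum_(U.+1 <= d < K) F d
      = \sum_(1 <= d < K) (if (U < d < K)%N then F d else 0).
    transitivity (\sum_(U.+1 <= d < K) (if (U < d < K)%N then F d else 0)).
      by apply: eq_big_nat => d ->.
    apply: sum_range_eq => d; first by move/negbTE ->.
    case: ifP => // /andP[Ud dK]; rewrite dK andbT.
    by rewrite (leq_ltn_trans _ Ud).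
  rewrite [X in _ = _ * (_ + X)]exchange_big /= -big_split mulr_sumr lift /=.
  apply: eq_big_nat => d /andP[d1 dK].
  rewrite -big_split mulr_sumr /=.
  case: ifP => Ud; last first.
    rewrite big1 // => m _; rewrite /L1' /L2' /L Ud.
    by case: ifP => _; ring.
  rewrite lift; apply: eq_big_nat => m /andP[m1 mK].
  rewrite (mulnC m d).
  have EE : E != 0 by rewrite gt_eqF.
  rewrite /L1' /L2'; case: (leqP d Y) => dY.
    rewrite mulr0 mul0r addr0 /L /B Ud.
    by case: ifP => _; [field|rewrite mulr0 mul0r mulr0].
  rewrite mul0r mul0r add0r /L Ud /B2.
  case: (ltnP m (2 * Y.+1)) => mY.
    by rewrite /B; case: ifP => _; [field|rewrite mul0r mul0r mulr0].
  (* both variables cannot exceed the square root of D *)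
  have -> : G h (d * m) = 0.
    rewrite /G /block_phase /in_block.
    case: ifP => // /andP[_ dmD]; have : (2 * D < 2 * D)%N; last by rewrite ltnn.
    apply: (@leq_trans (2 * Y.+1 ^ 2)); first by rewrite ltn_pmul2l.
    have DD2 : (D' <= 2 * D)%N by case/andP: DD'.
    apply: leq_trans DD2; apply: leq_trans dmD.
    by rewrite -mulnn mulnCA leq_mul.
  by rewrite !mulr0; case: ifP => _; rewrite ?mulr0.
have -> : \sum_(H <= h < 2 * H) sg h * (\sum_(U.+1 <= d < K) \sum_(U.+1 <= m < K)
       vonMangoldt R d * moebius_tail U m * G h (d * m)%N)
  = E ^+ 2 * (\sum_(H <= h < 2 * H) \sum_(1 <= n < K) \sum_(1 <= m < K)
        (sg h * L1' n) * B m * G h (n * m)%N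
      + \sum_(H <= h < 2 * H) \sum_(1 <= n < K) \sum_(1 <= m < K)
        (sg h * B2 n) * L2' m * G h (n * m)%N).
  rewrite -big_split mulr_sumr /=; apply: eq_bigr => h _.
  rewrite split_h mulrCA; congr (_ * _); rewrite mulrDr !mulr_sumr.
  by congr (_ + _); apply: eq_bigr => n _; rewrite mulr_sumr;
    apply: eq_bigr => m _; rewrite !mulrA.
have sg_mul h (u : R) : `|u| <= 1 -> `|sg h * u| <= 1.
  by move=> u1; rewrite normrM -[leRHS]mulr1 ler_pM.
have A1 : `|\sum_(H <= h < 2 * H) \sum_(1 <= n < K) \sum_(1 <= m < K)
        (sg h * L1' n) * B m * G h (n * m)%N| <= E * (type_two_const * E * (H%:R * z ^+ 56)).
  apply: (@type_two_range (fun h n => sg h * L1' n) B Y.+1) => //.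
  - by apply: leq_trans Y4; rewrite leq_pmull.
  - by apply: leq_trans YK; rewrite leq_pmull.
  - move=> h n nU; rewrite /L1'; case: leqP => nY; last by rewrite mulr0.
    rewrite /L; case: ifP => [/andP[Un _]|_]; last by rewrite mulr0.
    by move: nU; rewrite ltnS nY (ltnW Un).
  - by move=> h n; apply: sg_mul; rewrite /L1'; case: ifP => _ //; rewrite normr0.
have A2 : `|\sum_(H <= h < 2 * H) \sum_(1 <= n < K) \sum_(1 <= m < K)
        (sg h * B2 n) * L2' m * G h (n * m)%N| <= E * (type_two_const * E * (H%:R * z ^+ 56)).
  apply: (@type_two_range (fun h n => sg h * B2 n) L2' (2 * Y.+1)) => //.
  - move=> h n nU; rewrite /B2; case: ltnP => nY; last by rewrite mulr0.
    rewrite /B; case: ifP => [/andP[Un _]|_]; last by rewrite mulr0.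
    by move: nU; rewrite nY (ltnW Un).
  - by move=> h n; apply: sg_mul; rewrite /B2; case: ifP => _ //; rewrite normr0.
  - by move=> m; rewrite /L2'; case: ifP => _ //; rewrite normr0.
have E20 : 0 <= E ^+ 2 by rewrite exprn_ge0 // ltW.
rewrite normrM (ger0_norm E20).
apply: (le_trans (ler_wpM2l E20 (le_trans (ler_normD _ _) (lerD A1 A2)))).
by rewrite le_eqVlt; apply/orP; left; apply/eqP; ring.
Qed.

Definition vaughan_const : R := 200 * type_one_const + 2 * type_two_const.

(** Exponential sums over primes, for the frequencies [h] of a dyadic range.
    The signs of the sums for the various [h] are absorbed in the coefficients of
    the type II sums. *)
Lemma vaughan_block_sum :
  \sum_(H <= h < 2 * H) `|\sum_(1 <= d < K) vonMangoldt R d * G h d|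
  <= vaughan_const * E ^+ 4 * (H%:R * z ^+ 56).
Proof.
pose S h := \sum_(1 <= d < K) vonMangoldt R d * G h d.
pose sg h := Num.sg (S h).
have sg1 h : `|sg h| <= 1.
  by rewrite /sg normr_sg; case: (_ != 0).
pose T1 h := \sum_(1 <= b < U.+1) moebius b *
      (\sum_(1 <= m < K) ln m%:R * G h (b * m)%N)
    - \sum_(1 <= b < U.+1) \sum_(1 <= d < U.+1)
        moebius b * vonMangoldt R d * (\sum_(1 <= m < K) G h (b * d * m)%N).
pose T2 h := \sum_(U.+1 <= d < K) \sum_(U.+1 <= m < K)
       vonMangoldt R d * moebius_tail U m * G h (d * m)%N.
have SE h : S h = T1 h + T2 h.
  apply: vaughan; first exact: U_lt_K.
    move=> m mU; rewrite /G /block_phase /in_block ltnNge.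
    rewrite (leq_trans mU) //; apply: leq_trans U_le_D; exact: leq_pmull.
  by move=> m Km; rewrite /G /block_phase /in_block (leqNgt m D') -/K Km andbF.
have -> : \sum_(H <= h < 2 * H) `|\sum_(1 <= d < K) vonMangoldt R d * G h d|
   = \sum_(H <= h < 2 * H) sg h * T1 h + \sum_(H <= h < 2 * H) sg h * T2 h.
  rewrite -big_split /=; apply: eq_bigr => h _.
  by rewrite -/(S h) normrEsg -mulrDr -SE.
have A1 : \sum_(H <= h < 2 * H) sg h * T1 h
    <= H%:R * (200 * type_one_const * E ^+ 3 * z ^+ 56).
  have -> : H%:R * (200 * type_one_const * E ^+ 3 * z ^+ 56)
     = \sum_(H <= h < 2 * H) 200 * type_one_const * E ^+ 3 * z ^+ 56.
    by rewrite sumr_const_nat (mulnDl 1 1) mul1n addnK mulr_natl.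
  rewrite big_nat [leRHS]big_nat; apply: ler_sum => h hh.
  apply: (le_trans (ler_norm _)); rewrite normrM -[leRHS]mul1r.
  by apply: ler_pM => //; exact: type_one_part.
have A2 := le_trans (ler_norm _) (type_two_part sg1).
apply: (le_trans (lerD A1 A2)).
have E34 : E ^+ 3 <= E ^+ 4 by apply: ler_weXn2l.
have Hz : 0 <= 200 * type_one_const * (H%:R * z ^+ 56).
  apply: mulr_ge0; last by rewrite mulr_ge0 // exprn_ge0.
  apply: mulr_ge0; [exact: ler0n|exact: ltW (type_one_const_gt0 (R := R))].
have := ler_wpM2l Hz E34; rewrite /vaughan_const.
set u := _ ^+ 4; set v := _ ^+ 3; set w := z ^+ 56; set k := H%:R.
lra.
Qed.

End PrimeBlock.

Section BlockBound.
Context {R : realType}.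
Variables (x z E : R) (e D D' P : nat).
Hypothesis e1 : (e <= 1)%N.
Hypothesis xz : x = z ^+ 118.
Hypothesis z_large : 2 ^+ 16 <= z.
Hypothesis Dlo : z ^+ 56 <= D%:R.
Hypothesis Dup : D%:R <= z ^+ 62.
Hypothesis DD' : (D < D' <= 2 * D)%N.
Hypothesis P0 : (0 < P)%N.
Hypothesis Plo : D%:R <= P%:R * z ^+ 56.
Hypothesis Pup : P%:R * z ^+ 56 <= 2 * D%:R.
Hypothesis E_ln : 1 + 2 * ln x <= E.
Hypothesis E_div : forall v, (0 < v)%N -> v%:R <= x ->
  (size (divisors v))%:R <= E.

Definition block_const : R := 500 * (1 + 2 * vaughan_const).

Lemma vaughan_const_ge0 : 0 <= vaughan_const :> R.
Proof.
have := type_one_const_gt0 (R := R); have := type_two_const_ge1 (R := R); rewrite /vaughan_const; lra.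
Qed.

(** The exponential sums with [H <= h < 2 H] for [H <= P] are all admissible;
    the inequality for the sawtooth then loses [1 / P] on the trivial bound. *)
Lemma block_bound_P :
  `|\sum_(D.+1 <= d < D'.+1) vonMangoldt R d * sawtooth (x / (d + e)%:R)|
  <= block_const * E ^+ 6 * z ^+ 56.
Proof.
have x0 : 0 < x := x_gt0 xz z_large.
have z0 : 0 < z by apply: lt_le_trans z_large; rewrite exprn_gt0.
have z560 : 0 < z ^+ 56 by rewrite exprn_gt0.
have E1 : 1 <= E := E_ge1 xz z_large E_ln.
have E0 : 0 < E by exact: lt_le_trans E1.
have Kx : D'.+1%:R <= x := K_le_x xz z_large Dlo Dup DD'.
have P0r : 0 < P%:R :> R by rewrite ltr0n.
pose r := index_iota D.+1 D'.+1.
pose y (d : nat) : R := x / (d + e)%:R.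
have y0 d : 0 <= y d by rewrite divr_ge0 // ltW.
pose T h := weyl_sum r (vonMangoldt R) y h.
have T0 h : 0 <= T h by rewrite /T /weyl_sum addr_ge0.
have sum_phase c h : \sum_(d <- r) vonMangoldt R d * ce (h%:R * y d + c)
    = \sum_(1 <= d < D'.+1) vonMangoldt R d * block_phase x c e D D' h d.
  have van d : ~~ (D.+1 <= d < D'.+1)%N ->
      vonMangoldt R d * block_phase x c e D D' h d = 0.
    by rewrite ltnS /block_phase => /negbTE; rewrite /in_block => ->; rewrite mulr0.
  transitivity (\sum_(D.+1 <= d < D'.+1) vonMangoldt R d * block_phase x c e D D' h d).
    apply: eq_big_nat => d; rewrite ltnS => hd.
    rewrite /block_phase /in_block hd; congr (_ * ce (_ + _)).
    by rewrite /y mulrA (mulrC h%:R).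
  apply: sum_range_eq => // d nd; apply: van; apply: contra nd => /andP[d1 ->].
  by rewrite (leq_ltn_trans _ d1).
have TE h : T h
   = `|\sum_(1 <= d < D'.+1) vonMangoldt R d * block_phase x 0 e D D' h d|
   + `|\sum_(1 <= d < D'.+1) vonMangoldt R d * block_phase x (- (1 / 4)) e D D' h d|.
  rewrite -!sum_phase /T /weyl_sum; congr (_ + _); congr (Num.norm _); apply: eq_bigr => d _.
    by rewrite addr0.
  by rewrite seE.
have blocks H : (0 < H <= P)%N ->
    \sum_(H <= h < 2 * H) T h <= 2 * (vaughan_const * E ^+ 4 * (H%:R * z ^+ 56)).
  move=> HP; under eq_bigr do rewrite TE.
  rewrite big_split /=.
  have A c := @vaughan_block_sum R x z E c e D D' P H e1 xz z_large Dlo Dup DD'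
    P0 Plo Pup HP E_ln E_div.
  by have := lerD (A 0) (A (- (1 / 4))); lra.
pose CK := 2 * (vaughan_const * E ^+ 4 * z ^+ 56).
have CK0 : 0 <= CK.
  by rewrite !mulr_ge0 ?vaughan_const_ge0 ?exprn_ge0 // ltW.
have Px : (4 * P)%:R <= x.
  have h1 : P%:R <= 2 * z ^+ 6 := P_le z_large Dup Pup.
  have h2 : 2 ^+ 3 * z ^+ 6 <= z ^+ 7 := zexp_absorb z_large 6 (isT : (3 <= 16)%N).
  have h3 : z ^+ 7 <= x by rewrite xz; exact: (zexp_le z_large (isT : (7 <= 118)%N)).
  apply: le_trans h3; apply: le_trans h2; rewrite natrM !exprS expr0; lra.
pose F h := if (h < P)%N then T h / h%:R else 0.
pose J := (trunc_log 2 P).+1.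
have [PJ Jle] := @log2_le R P P0.
have JE : J%:R <= E.
  apply: (le_trans Jle); apply: (E_log2 xz z_large E_ln) => //.
  by apply: le_trans Px; rewrite ler_nat leq_pmull.
have sumF : \sum_(1 <= h < P) T h / h%:R <= E * CK.
  have -> : \sum_(1 <= h < P) T h / h%:R = \sum_(1 <= h < 1 * 2 ^ J) F h.
    transitivity (\sum_(1 <= h < P) F h).
      by apply: eq_big_nat => h /andP[_ hP]; rewrite /F hP.
    rewrite mul1n (big_cat_nat (n := P) (p := (2 ^ J)%N)) //=; last exact: ltnW.
    rewrite [X in _ + X]big_nat [X in _ + X]big1 ?addr0 // => h /andP[Ph _].
    by rewrite /F ltnNge Ph.
  apply: (le_trans (ler_norm _)).
  apply: (@le_trans _ _ (J%:R * CK)); last by rewrite ler_wpM2r.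
  apply: dyadic_sum_bound => j _; rewrite mul1n; set H := (2 ^ j)%N.
  have H0 : (0 < H)%N by rewrite expn_gt0.
  have H0r : 0 < H%:R :> R by rewrite ltr0n.
  case: (leqP P H) => PH.
    rewrite big_nat big1 ?normr0 // => h /andP[Hh _].
    by rewrite /F ltnNge (leq_trans PH Hh).
  have HP : (0 < H <= P)%N by rewrite H0 ltnW.
  apply: (le_trans (ler_norm_sum _ _ _)).
  apply: (@le_trans _ _ (\sum_(H <= h < 2 * H) T h / H%:R)).
    rewrite big_nat [leRHS]big_nat; apply: ler_sum => h /andP[Hh _].
    have h0r : 0 < h%:R :> R by rewrite ltr0n (leq_trans H0).
    rewrite /F; case: ifP => _; last by rewrite normr0 divr_ge0.
    rewrite ger0_norm ?divr_ge0 //; apply: ler_wpM2l => //.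
    by rewrite lef_pV2 ?posrE // ler_nat.
  rewrite -mulr_suml ler_pdivrMr //.
  by apply: (le_trans (blocks _ HP)); rewrite /CK; lra.
have W : (\sum_(d <- r) vonMangoldt R d) / P%:R <= E * z ^+ 56.
  rewrite ler_pdivrMr // -mulrA (mulrC _ P%:R).
  apply: (@le_trans _ _ (E * D%:R)); last by rewrite ler_pM2l.
  apply: (@le_trans _ _ (\sum_(D.+1 <= d < D'.+1) E)).
    rewrite /r big_nat [leRHS]big_nat; apply: ler_sum => d /andP[Dd dD].
    have d0 : (0 < d)%N by apply: leq_trans Dd.
    apply: (le_trans (vonMangoldt_le d0)).
    have dx : d%:R <= x by apply: le_trans Kx; rewrite ler_nat ltnW.
    by have /andP[] := E_lnv xz z_large E_ln d0 dx.
  rewrite sumr_const_nat subSS -[leLHS]mulr_natr ler_pM2l // ler_nat.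
  by rewrite leq_subLR addnn -mul2n; case/andP: DD'.
have hE : harmonic_sum (4 * P) <= E :> R.
  by apply: (E_harmonic xz z_large E_ln) => //; rewrite muln_gt0.
have h1 : 1 <= harmonic_sum (4 * P) :> R by apply: harmonic_sum_ge1; rewrite muln_gt0.
have := @erdos_turan R nat r (vonMangoldt R) (vonMangoldt_ge0 (R := R)) y P P0 y0.
move=> et; apply: (le_trans et).
have S0 : 0 <= (\sum_(d <- r) vonMangoldt R d) / P%:R
     + \sum_(1 <= h < P) weyl_sum r (vonMangoldt R) y h / h%:R.
  apply: addr_ge0.
    rewrite divr_ge0 //; refine (sumr_ge0 _ _) => d _; exact: vonMangoldt_ge0.
  by refine (sumr_ge0 _ _) => h _; rewrite divr_ge0 //; exact: T0.
have c500 : 0 < 500%:R :> R by rewrite ltr0n.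
have hE5 : 500 * harmonic_sum (4 * P) <= 500 * E :> R by rewrite (ler_pM2l c500).
apply: (le_trans (ler_wpM2r S0 hE5)).
have S1 : (\sum_(d <- r) vonMangoldt R d) / P%:R
     + \sum_(1 <= h < P) weyl_sum r (vonMangoldt R) y h / h%:R
    <= E * z ^+ 56 + E * CK := lerD W sumF.
have E50 : 0 <= 500 * E by exact: mulr_ge0 (ltW c500) (ltW E0).
apply: (le_trans (ler_wpM2l E50 S1)).
have E26 : E ^+ 2 <= E ^+ 6 by apply: ler_weXn2l.
have := ler_wpM2r (ltW z560) E26.
have -> : 500 * E * (E * z ^+ 56 + E * CK)
   = 500 * (E ^+ 2 * z ^+ 56) + 500 * (2 * vaughan_const) * (E ^+ 6 * z ^+ 56).
  by rewrite /CK; ring.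
rewrite /block_const; set u := E ^+ 2 * _; set v := E ^+ 6.
by move: (z ^+ 56) vaughan_const => w k; lra.
Qed.

End BlockBound.

(** * Floor sums *)

Section Assembly.
Context {R : realType}.

Lemma block_bound (x z E : R) (e D D' : nat) :
  (e <= 1)%N -> x = z ^+ 118 -> 2 ^+ 16 <= z -> z ^+ 56 <= D%:R ->
  D%:R <= z ^+ 62 -> (D < D' <= 2 * D)%N -> 1 + 2 * ln x <= E ->
  (forall v, (0 < v)%N -> v%:R <= x -> (size (divisors v))%:R <= E) ->
  `|\sum_(D.+1 <= d < D'.+1) vonMangoldt R d * sawtooth (x / (d + e)%:R)|
  <= block_const * E ^+ 6 * z ^+ 56.
Proof.
move=> e1 xz zl Dlo Dup DD' Eln Ediv.
have z0 : 0 < z by apply: lt_le_trans zl; rewrite exprn_gt0.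
have z560 : 0 < z ^+ 56 by rewrite exprn_gt0.
have q0 : 0 <= D%:R / z ^+ 56 by rewrite divr_ge0 // ltW.
have q1 : 1 <= D%:R / z ^+ 56 by rewrite ler_pdivlMr // mul1r.
have /andP[t1 t2] := truncn_itv q0.
apply: (@block_bound_P R x z E e D D' (Num.truncn (D%:R / z ^+ 56)).+1) => //.
  by rewrite -ler_pdivrMr // ltW.
by rewrite -ler_pdivlMr // -natr1 -mulrA; lra.
Qed.

Lemma sawtooth_norm (t : R) : 0 <= t -> `|sawtooth t| <= 1.
Proof.
move=> /truncn_itv /andP[h1 h2]; rewrite /sawtooth -natr1 in h2 *.
by rewrite ler_norml; apply/andP; split; lra.
Qed.

Lemma truncn_div_eq (x : R) (d n : nat) : 0 < x -> (0 < d)%N ->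
  (Num.truncn (x / d.+1%:R) < n <= Num.truncn (x / d%:R))%N ->
  Num.truncn (x / n%:R) = d.
Proof.
move=> x0 d0 /andP[n1 n2].
have n0 : (0 < n)%N by apply: leq_ltn_trans n1.
have [n0r d0r] : 0 < n%:R :> R /\ 0 < d%:R :> R by rewrite !ltr0n.
have q0 k : 0 <= x / k%:R by rewrite divr_ge0 // ltW.
have h1 : x / d.+1%:R < n%:R.
  by apply: lt_le_trans (truncnS_gt _) _; rewrite ler_nat.
have h2 : n%:R <= x / d%:R by rewrite -truncn_ge_nat.
apply: truncn_def; apply/andP; split.
  by rewrite ler_pdivlMr // mulrC -ler_pdivlMr.
by rewrite ltr_pdivrMr // mulrC -ltr_pdivrMr.
Qed.

Lemma sum_truncn_div (x : R) (g : nat -> R) (D : nat) : 0 < x ->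
  \sum_((Num.truncn (x / D.+1%:R)).+1 <= n < (Num.truncn x).+1)
     g (Num.truncn (x / n%:R))
  = \sum_(1 <= d < D.+1)
     g d * ((Num.truncn (x / d%:R))%:R - (Num.truncn (x / d.+1%:R))%:R).
Proof.
move=> x0; elim: D => [|D IH]; first by rewrite divr1 !big_geq.
have mono : (Num.truncn (x / D.+2%:R) <= Num.truncn (x / D.+1%:R))%N.
  apply: le_truncn; rewrite ler_pM2l // lef_pV2 ?posrE ?ltr0n // ler_nat //.
have top : (Num.truncn (x / D.+1%:R) <= Num.truncn x)%N.
  by apply: le_truncn; rewrite ler_pdivrMr ?ltr0n // ler_peMr ?(ltW x0) // ler1n.
rewrite (big_cat_nat (n := (Num.truncn (x / D.+1%:R)).+1)) //= IH.
rewrite [RHS]big_nat_recr //= addrC; congr (_ + _).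
rewrite -natrB // mulr_natr.
transitivity (\sum_((Num.truncn (x / D.+2%:R)).+1 <= n <
    (Num.truncn (x / D.+1%:R)).+1) g D.+1).
  by apply: eq_big_nat => n; rewrite ltnS => hn; rewrite (@truncn_div_eq x D.+1).
by rewrite sumr_const_nat subSS.
Qed.

Let term (n : nat) : R := vonMangoldt R n / (n%:R * (n%:R + 1)).

Lemma term_ge0 n : 0 <= term n.
Proof. by rewrite divr_ge0 ?vonMangoldt_ge0 // mulr_ge0 // addr_ge0. Qed.

(** Tail of the main series, by telescoping [(ln d + 1) / d]. *)
Lemma term_tail (A k : nat) : (0 < A)%N ->
  \sum_(A <= n < A + k) term n <= (ln A%:R + 1) / A%:R.
Proof.
move=> A0.
suff : \sum_(A <= n < A + k) term n
    <= (ln A%:R + 1) / A%:R - (ln (A + k)%:R + 1) / (A + k)%:R.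
  move=> h; apply: (le_trans h); rewrite gerBl divr_ge0 // addr_ge0 //.
  by rewrite ln_ge0 // ler1n addn_gt0 A0.
elim: k => [|k IH]; first by rewrite addn0 big_geq // subrr.
rewrite addnS big_nat_recr ?leq_addr //=; set d := (A + k)%N in IH *.
have d0 : 0 < d%:R :> R by rewrite ltr0n addn_gt0 A0.
apply: (le_trans (lerD IH (lexx _))).
have dp : (0 < d)%N by rewrite addn_gt0 A0.
have L := vonMangoldt_le (R := R) dp.
have d1 : 0 < d%:R + 1 :> R by rewrite addr_gt0.
have lnd : ln d.+1%:R <= ln d%:R + d%:R^-1 :> R.
  have -> : d.+1%:R = d%:R * (1 + d%:R^-1) :> R.
    by rewrite mulrDr mulr1 divff ?gt_eqF // natr1.
  have i0 : 0 < d%:R^-1 :> R by rewrite invr_gt0.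
  rewrite lnM ?posrE ?addr_gt0 // lerD2l le_ln1Dx //.
  by rewrite (lt_trans _ i0) // ltrN10.
have t1 : term d <= ln d%:R / (d%:R * (d%:R + 1)).
  by rewrite /term ler_pM2r // invr_gt0 mulr_gt0.
have t2 : (ln d.+1%:R + 1) / d.+1%:R
    <= (ln d%:R + d%:R^-1 + 1) / (d%:R + 1) :> R.
  by rewrite -natr1 ler_pM2r ?invr_gt0 // lerD2r natr1.
have t3 : ln d%:R / (d%:R * (d%:R + 1)) = (ln d%:R + 1) / d%:R
   - (ln d%:R + d%:R^-1 + 1) / (d%:R + 1) :> R.
  by field; rewrite !gt_eqF.
move: t1 t2; rewrite t3.
move: (term d) ((ln d.+1%:R + 1) / d.+1%:R) ((ln d%:R + 1) / d%:R)
  ((ln d%:R + d%:R^-1 + 1) / (d%:R + 1)) => a1 a2 a3 a4 t1 t2.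
by rewrite -addrA lerD2l; lra.
Qed.

Lemma series_truncation (A : nat) : (0 < A)%N ->
  0 <= limn (fun N => \sum_(1 <= n < N) term n) - \sum_(1 <= n < A) term n
    <= (ln A%:R + 1) / A%:R.
Proof.
move=> A0; set u := fun N => _.
have nd : nondecreasing_seq u.
  apply/nondecreasing_seqP => n; rewrite /u; case: n => [|n].
    by rewrite !big_geq.
  by rewrite [leRHS]big_nat_recr //= lerDl term_ge0.
have ub N : u N <= u A + (ln A%:R + 1) / A%:R.
  have b0 : 0 <= (ln A%:R + 1) / A%:R :> R.
    by rewrite divr_ge0 // addr_ge0 // ln_ge0 // ler1n.
  case: (leqP N A) => NA; first by apply: (le_trans (nd _ _ NA)); rewrite lerDl.
  rewrite /u (big_cat_nat (n := A)) //= ?(ltnW NA) // lerD2l.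
  by rewrite -(subnKC (ltnW NA)); exact: term_tail.
have cu : cvgn u.
  apply: nondecreasing_is_cvgn => //.
  by exists (u A + (ln A%:R + 1) / A%:R) => _ [N _ <-].
apply/andP; split; first by rewrite subr_ge0; exact: (nondecreasing_cvgn_le nd cu).
by rewrite lerBlDl; apply: limr_le => //; apply: nearW => N; exact: ub.
Qed.

End Assembly.

Section Final.
Context {R : realType}.
Variables (x z E : R).
Hypothesis xz : x = z ^+ 118.
Hypothesis z_large : 2 ^+ 16 <= z.
Hypothesis E_ln : 1 + 2 * ln x <= E.
Hypothesis E_div : forall v, (0 < v)%N -> v%:R <= x ->
  (size (divisors v))%:R <= E.

Let x0 : 0 < x := x_gt0 xz z_large.
Let z1 : 1 <= z := z_gt1 z_large.
Let z0 : 0 < z. Proof. exact: lt_le_trans z1. Qed.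
Let E1 : 1 <= E := E_ge1 xz z_large E_ln.
Let E0 : 0 < E. Proof. exact: lt_le_trans E1. Qed.
Let zk0 k : 0 < z ^+ k. Proof. by rewrite exprn_gt0. Qed.
Let zk1 k : 1 <= z ^+ k. Proof. by rewrite exprn_ege1. Qed.

Let D1 := Num.truncn (z ^+ 62).

Let D1_le : D1%:R <= z ^+ 62.
Proof. by have /andP[] := truncn_itv (ltW (zk0 62)). Qed.

Let D1_gt : z ^+ 62 < D1.+1%:R.
Proof. by have /andP[] := truncn_itv (ltW (zk0 62)). Qed.

Let z63 : z ^+ 62 + 1 <= x.
Proof.
have h1 : 2 ^+ 1 * z ^+ 62 <= z ^+ 63 := zexp_absorb z_large 62 (isT : (1 <= 16)%N).
have h2 : z ^+ 63 <= x by rewrite xz; exact: (zexp_le z_large (isT : (63 <= 118)%N)).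
by have := zk1 62; rewrite expr1 in h1; lra.
Qed.

Let le_D1_x d : (d <= D1.+1)%N -> d%:R <= x.
Proof.
move=> dD; apply: le_trans z63; apply: (@le_trans _ _ D1.+1%:R).
  by rewrite ler_nat.
by rewrite -natr1 lerD2r.
Qed.

Lemma vonMangoldt_leE d : d%:R <= x -> vonMangoldt R d <= E.
Proof.
move=> dx; case: (posnP d) => [->|d0]; first exact: ltW.
apply: (le_trans (vonMangoldt_le d0)).
by have /andP[] := E_lnv xz z_large E_ln d0 dx.
Qed.

(** Trivial bound up to [z ^ 56], and dyadic blocks from there to [z ^ 62]. *)
Lemma sawtooth_total (e : nat) : (e <= 1)%N ->
  `|\sum_(1 <= d < D1.+1) vonMangoldt R d * sawtooth (x / (d + e)%:R)|
  <= (block_const + 3) * E ^+ 7 * z ^+ 56.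
Proof.
move=> e1.
pose t d : R := vonMangoldt R d * sawtooth (x / (d + e)%:R).
have tE d : (d <= D1)%N -> `|t d| <= E.
  move=> dD; rewrite normrM -[leRHS]mulr1; apply: ler_pM => //.
    rewrite ger0_norm ?vonMangoldt_ge0 // vonMangoldt_leE // le_D1_x //.
    exact: leqW.
  by apply: sawtooth_norm; rewrite divr_ge0 // ltW.
pose A := (Num.truncn (z ^+ 56)).+1.
have /andP[A1 A2] := truncn_itv (ltW (zk0 56)).
have A56 : A%:R <= 2 * z ^+ 56.
  by rewrite /A -natr1; have := zk1 56; lra.
have AD1 : (A.+1 <= D1.+1)%N.
  rewrite -(ler_nat R); apply: le_trans (ltW D1_gt).
  rewrite -natr1; apply: (@le_trans _ _ (2 ^+ 2 * z ^+ 56)).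
    by have := zk1 56; rewrite expr2; lra.
  apply: (le_trans (zexp_absorb z_large 56 (isT : (2 <= 16)%N))).
  exact: (zexp_le z_large (isT : (57 <= 62)%N)).
have B0 : 0 <= block_const * E ^+ 6 * z ^+ 56.
  rewrite mulr_ge0 ?(ltW (zk0 _)) // mulr_ge0 ?exprn_ge0 ?(ltW E0) //.
  have := vaughan_const_ge0 (R := R); rewrite /block_const => h.
  by apply: mulr_ge0; [exact: ler0n|lra].
rewrite (big_cat_nat (n := A.+1)) //=; apply: (le_trans (ler_normD _ _)).
have low : `|\sum_(1 <= d < A.+1) t d| <= 2 * z ^+ 56 * E.
  apply: (le_trans (ler_norm_sum _ _ _)).
  apply: (@le_trans _ _ (\sum_(1 <= d < A.+1) E)).
    rewrite big_nat [leRHS]big_nat; apply: ler_sum => d /andP[_ dA].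
    by apply: tE; rewrite -ltnS (leq_trans dA).
  by rewrite sumr_const_nat subSS subn0 -[leLHS]mulr_natl ler_pM2r.
pose F d := if (d <= D1)%N then t d else 0.
pose J := (trunc_log 2 D1.+1).+1.
have [DJ Jle] := @log2_le R D1.+1 isT.
have JE : J%:R <= E.
  by apply: (le_trans Jle); apply: (E_log2 xz z_large E_ln) => //; exact: le_D1_x.
have high : `|\sum_(A.+1 <= d < D1.+1) t d| <= E * (block_const * E ^+ 6 * z ^+ 56 + E).
  have -> : \sum_(A.+1 <= d < D1.+1) t d = \sum_(A.+1 <= d < A.+1 * 2 ^ J) F d.
    transitivity (\sum_(A.+1 <= d < D1.+1) F d).
      by apply: eq_big_nat => d /andP[_]; rewrite ltnS /F => ->.
    rewrite [RHS](big_cat_nat (n := D1.+1)) //=; last first.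
      by apply: (leq_trans (ltnW DJ)); rewrite leq_pmull.
    rewrite [X in _ = _ + X]big_nat [X in _ = _ + X]big1 ?addr0 // => d /andP[Dd _].
    by rewrite /F leqNgt Dd.
  apply: (@le_trans _ _ (J%:R * (block_const * E ^+ 6 * z ^+ 56 + E))); last first.
    by rewrite ler_wpM2r // addr_ge0 // ltW.
  apply: dyadic_sum_bound => j _; set N := (A.+1 * 2 ^ j)%N.
  have AN : (A.+1 <= N)%N by rewrite leq_pmulr // expn_gt0.
  case: (leqP N D1) => ND; last first.
    rewrite big_nat big1 ?normr0 ?addr_ge0 ?(ltW E0) // => d /andP[Nd _].
    by rewrite /F leqNgt (leq_trans ND Nd).
  (* the block bound covers (D, 2 D] with D = N - 1, that is, all of
     [N, 2 N) but its last element *)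
  have [D NE] : exists D, N = D.+1 by exists N.-1; rewrite prednK // (leq_trans _ AN).
  have AD : (A <= D)%N by rewrite -ltnS -NE.
  have D0 : (0 < D)%N by apply: leq_trans AD.
  have E2 : (2 * D.+1 = (2 * D).+2)%N by rewrite mulnS addnC addn2.
  rewrite NE E2.
  rewrite big_nat_recr /=; last by rewrite ltnS -[X in (X <= _)%N]mul1n leq_mul2r orbT.
  apply: (le_trans (ler_normD _ _)); apply: lerD; last first.
    by rewrite /F; case: ifP => h; [exact: tE|rewrite normr0 ltW].
  pose D' := minn (2 * D) D1.
  have DD' : (D < D' <= 2 * D)%N.
    rewrite /D' leq_min geq_minl andbT -[X in (X < _)%N]mul1n ltn_mul2r D0 /=.
    by rewrite -NE.
  have -> : \sum_(D.+1 <= d < (2 * D).+1) F d = \sum_(D.+1 <= d < D'.+1) t d.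
    rewrite (big_cat_nat (n := D'.+1)) /=; first last.
    - by rewrite ltnS geq_minl.
    - by rewrite ltnS ltnW //; case/andP: DD'.
    rewrite [X in _ + X]big_nat [X in _ + X]big1 ?addr0; last first.
      move=> d /andP[Dd dD]; rewrite /F leqNgt; case: ltnP => // dD1.
      by move: Dd; rewrite ltnNge leq_min -ltnS dD dD1.
    apply: eq_big_nat => d /andP[_ dD']; rewrite /F.
    by rewrite (leq_trans (_ : d <= D')%N) // geq_minr.
  apply: block_bound => //.
    apply: (le_trans (ltW A2)); by rewrite ler_nat.
  by apply: le_trans D1_le; rewrite ler_nat ltnW // -NE.
apply: (le_trans (lerD low high)).
have z56 := zk0 56.
have E17 : E <= E ^+ 7 by rewrite -[leLHS]expr1; apply: ler_weXn2l.
have E27 : E ^+ 2 <= E ^+ 7 by apply: ler_weXn2l.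
have k1 := ler_wpM2l (ltW z56) E17.
have k2 := ler_pM (exprn_ge0 2 (ltW E0)) ler01 E27 (zk1 56).
have -> : E * (block_const * E ^+ 6 * z ^+ 56 + E)
  = block_const * (E ^+ 7 * z ^+ 56) + E ^+ 2 * 1 by ring.
have -> : (block_const + 3) * E ^+ 7 * z ^+ 56
  = block_const * (E ^+ 7 * z ^+ 56) + 3 * (E ^+ 7 * z ^+ 56) by ring.
by move: k1 k2; move: block_const (z ^+ 56) (E ^+ 7) (E ^+ 2) => u v w s; lra.
Qed.

(** The at most [z ^ 56] integers [n] with [floor (x / n) > z ^ 62] are bounded
    trivially; the others are grouped by the value [d] of the floor, and their
    number is [x / (d (d + 1))] up to two values of the sawtooth. *)
Lemma main_bound :
  `|\sum_(1 <= n < (Num.truncn x).+1) vonMangoldt R (Num.truncn (x / n%:R))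
    - x * limn (fun N => \sum_(1 <= n < N)
                           (vonMangoldt R n / (n%:R * (n%:R + 1))))|
  <= 2 * (block_const + 4) * E ^+ 7 * z ^+ 56.
Proof.
set L := limn _.
pose N1 := Num.truncn (x / D1.+1%:R).
have D1r : 0 < D1.+1%:R :> R by rewrite ltr0n.
have x62 : x / D1.+1%:R <= z ^+ 56.
  rewrite ler_pdivrMr //; apply: (@le_trans _ _ (z ^+ 56 * z ^+ 62)).
    by rewrite -exprD xz.
  by rewrite ler_pM2l // ltW.
have q0 : 0 <= x / D1.+1%:R by rewrite divr_ge0 // ltW.
have /andP[N1le _] := truncn_itv q0.
have N1X : (N1 <= Num.truncn x)%N.
  by apply: le_truncn; rewrite ler_pdivrMr // ler_peMr ?(ltW x0) // ler1n.
rewrite (big_cat_nat (n := N1.+1)) //= sum_truncn_div //.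
have -> : \sum_(1 <= d < D1.+1) vonMangoldt R d *
     ((Num.truncn (x / d%:R))%:R - (Num.truncn (x / d.+1%:R))%:R)
  = x * (\sum_(1 <= d < D1.+1) vonMangoldt R d / (d%:R * (d%:R + 1)))
  - \sum_(1 <= d < D1.+1) vonMangoldt R d * sawtooth (x / (d + 0)%:R)
  + \sum_(1 <= d < D1.+1) vonMangoldt R d * sawtooth (x / (d + 1)%:R).
  rewrite mulr_sumr -sumrB -big_split /=; apply: eq_big_nat => d /andP[d0 _].
  have d0r : 0 < d%:R :> R by rewrite ltr0n.
  have d1r : 0 < d%:R + 1 :> R by rewrite addr_gt0.
  rewrite addn0 addn1 /sawtooth -natr1.
  by field; rewrite !gt_eqF.
have few : `|\sum_(1 <= n < N1.+1) vonMangoldt R (Num.truncn (x / n%:R))|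
    <= z ^+ 56 * E.
  apply: (le_trans (ler_norm_sum _ _ _)).
  apply: (@le_trans _ _ (\sum_(1 <= n < N1.+1) E)).
    rewrite big_nat [leRHS]big_nat; apply: ler_sum => n /andP[n0 _].
    rewrite ger0_norm ?vonMangoldt_ge0 //; apply: vonMangoldt_leE.
    have n0r : 0 < n%:R :> R by rewrite ltr0n.
    have qn : 0 <= x / n%:R by rewrite divr_ge0 // ltW.
    have /andP[h _] := truncn_itv qn; apply: (le_trans h).
    by rewrite ler_pdivrMr // ler_peMr ?(ltW x0) // ler1n.
  rewrite sumr_const_nat subSS subn0 -[leLHS]mulr_natl ler_pM2r //.
  exact: le_trans x62.
have /andP[t0 t1] := series_truncation (R := R) (isT : (0 < D1.+1)%N).
rewrite -/L in t0 t1.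
have tail : x * (L - \sum_(1 <= d < D1.+1) vonMangoldt R d / (d%:R * (d%:R + 1)))
    <= z ^+ 56 * E.
  apply: (le_trans (ler_wpM2l (ltW x0) t1)).
  rewrite mulrCA mulrC; apply: ler_pM => //.
    by rewrite addr_ge0 // ln_ge0 // ler1n.
  have D1x : D1.+1%:R <= x by exact: le_D1_x.
  have := E_log2 xz z_large E_ln (isT : (0 < D1.+1)%N) D1x.
  have /andP[l0 _] := E_lnv xz z_large E_ln (isT : (0 < D1.+1)%N) D1x.
  lra.
have s0 := @sawtooth_total 0 isT.
have s1 := @sawtooth_total 1 isT.
have tail0 : 0 <= x * (L - \sum_(1 <= d < D1.+1) vonMangoldt R d / (d%:R * (d%:R + 1))).
  by rewrite mulr_ge0 // ltW.
have E17 : E <= E ^+ 7 by rewrite -[leLHS]expr1; apply: ler_weXn2l.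
have k1 := ler_wpM2l (ltW (zk0 56)) E17.
move: few s0 s1 tail tail0; rewrite mulrBr.
have -> : (block_const + 3) * E ^+ 7 * z ^+ 56
  = (block_const + 3) * (z ^+ 56 * E ^+ 7) by ring.
have -> : 2 * (block_const + 4) * E ^+ 7 * z ^+ 56
  = 2 * ((block_const + 3) * (z ^+ 56 * E ^+ 7)) + 2 * (z ^+ 56 * E ^+ 7) by ring.
move: k1; move: ((block_const + 3) * (z ^+ 56 * E ^+ 7)) (z ^+ 56 * E)
  (z ^+ 56 * E ^+ 7) => u v w.
set a := \sum_(1 <= n < N1.+1) _; set b := x * \sum_(_ <= _ < _) _.
set p := \sum_(_ <= _ < _) _; set q := \sum_(_ <= _ < _) _; set l := x * L.
move=> k1; rewrite !ler_norml => /andP[? ?] /andP[? ?] /andP[? ?] ? ?.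
by apply/andP; split; lra.
Qed.

End Final.

Lemma root_of_power (R : realType) (n : nat) (x : R) : (0 < n)%N -> 0 < x ->
  x = (x `^ n%:R^-1) ^+ n.
Proof.
move=> n0 x0; rewrite -powR_mulrn ?powR_ge0 // -powRrM mulVf ?powRr1 ?ltW //.
by rewrite pnatr_eq0 -lt0n.
Qed.

Lemma root_ge (R : realType) (n : nat) (b z : R) : 0 <= b -> 0 <= z ->
  (0 < n)%N -> b ^+ n <= z ^+ n -> b <= z.
Proof. by move=> b0 z0 n0; rewrite ler_pXn2r. Qed.

(** The bound with exponent [28 / 59 + eps = 56 / 118 + eps]; [eps] pays for the
    seven factors [E], each a small power of [x]. *)
Lemma unconditional_bound (R : realType) (eps : R) : 0 < eps ->
  exists2 A : R, 0 <= A & \forall x \near +oo_R, 1 <= x /\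
    `|\sum_(1 <= n < (Num.truncn x).+1) vonMangoldt R (Num.truncn (x / n%:R))
      - x * limn (fun N => \sum_(1 <= n < N)
                             (vonMangoldt R n / (n%:R * (n%:R + 1))))|
    <= A * x `^ (118%:R^-1 * 56%:R + eps).
Proof.
move=> heps; pose eta := eps / 7%:R.
have eta0 : 0 < eta by rewrite divr_gt0.
have [C C0 HC] := divisor_bound eta0.
pose CE := C + 1 + 2 / eta.
have ie0 : 0 < eta^-1 by rewrite invr_gt0.
have CE0 : 0 < CE by rewrite /CE; lra.
have cb0 : 0 <= 2 * (block_const + 4) :> R.
  have := vaughan_const_ge0 (R := R); rewrite /block_const => h.
  have : 0 <= 500 * (1 + 2 * vaughan_const) :> R by apply: mulr_ge0; [exact: ler0n|lra].
  lra.
exists (2 * (block_const + 4) * CE ^+ 7).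
  by apply: mulr_ge0 => //; apply: exprn_ge0; exact: ltW.
pose b : R := 2 ^+ 16.
have b1 : 1 <= b by rewrite exprn_ege1 // ler1n.
have b0 : 0 <= b by apply: le_trans b1.
near=> x.
have xlarge : b ^+ 118 <= x by near: x; apply: nbhs_pinfty_ge; exact: num_real.
have x1 : 1 <= x by apply: le_trans xlarge; rewrite exprn_ege1.
split => //.
have x0 : 0 < x by exact: lt_le_trans x1.
have z0 : 0 <= x `^ 118%:R^-1 := powR_ge0 _ _.
have xz := @root_of_power R 118 x isT x0.
have zl : b <= x `^ 118%:R^-1.
  by apply: (@root_ge R 118) => //; rewrite -xz.
pose E := CE * x `^ eta.
have xe1 : 1 <= x `^ eta by rewrite -[leLHS](powRr0 x) ler_powR // ltW.
have xe0 : 0 < x `^ eta by exact: lt_le_trans xe1.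
have E_ln : 1 + 2 * ln x <= E.
  have hl := ln_le_powR eta0 x0; rewrite /E /CE.
  have : 0 <= C * x `^ eta by rewrite mulr_ge0 // ltW.
  by move: xe1 hl; move: (x `^ eta) (ln x) => u v; lra.
have E_div v : (0 < v)%N -> v%:R <= x -> (size (divisors v))%:R <= E.
  move=> v0 vx; apply: (le_trans (HC v v0)); rewrite /E.
  apply: ler_pM; [exact: ltW|exact: powR_ge0|by rewrite /CE; lra|].
  exact: (ge0_ler_powR (ltW eta0) (ler0n R v) (ltW x0) vx).
apply: (le_trans (main_bound xz zl E_ln E_div)).
have -> : 2 * (block_const + 4) * E ^+ 7 * (x `^ 118%:R^-1) ^+ 56
  = 2 * (block_const + 4) * CE ^+ 7 * ((x `^ 118%:R^-1) ^+ 56 * (x `^ eta) ^+ 7).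
  rewrite /E exprMn; move: (CE ^+ 7) ((x `^ eta) ^+ 7)
    ((x `^ 118%:R^-1) ^+ 56) (2 * (block_const + 4)) => u v w c.
  by ring.
apply: ler_wpM2l.
  by apply: mulr_ge0 => //; apply: exprn_ge0; exact: ltW.
rewrite -(powR_mulrn 56) ?powR_ge0 // -(powR_mulrn 7) ?powR_ge0 // -!powRrM.
rewrite -powRD; last by rewrite (gt_eqF x0) implybT.
by rewrite /eta divfK // pnatr_eq0.
Unshelve. all: by end_near.
Qed.

Theorem theorem1p1 (R : realType) (k l : R) (hkl : exponent_pair k l)
    (hk : k <= 1 / 6) (h34 : 1 <= 3 * k + 4 * l)
    (hpos : 0 < l ^+ 2 + l + 3 - k * (5 - l) - 9 * k ^+ 2)
    (eps : R) (heps : 0 < eps) :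
  exists A : R, \forall x \near +oo_R,
    `|\sum_(1 <= n < (Num.truncn x).+1) vonMangoldt R (Num.truncn (x / n%:R))
      - x * limn (fun N => \sum_(1 <= n < N)
                             (vonMangoldt R n / (n%:R * (n%:R + 1))))|
    <= A * x `^ (14 * (k + 1) / (29 * k - l + 30) + eps).
Proof.
have [k0 _ l12 l1 _] := hkl.
(* the exponent is 14 / (29 + (1 - l) / (k + 1)), smallest at k = 0, l = 1 / 2 *)
have expo : 56 / 118 <= 14 * (k + 1) / (29 * k - l + 30).
  have d0 : 0 < 29 * k - l + 30 by lra.
  by rewrite ler_pdivlMr //; lra.
have expo' : 118%:R^-1 * 56%:R <= 14 * (k + 1) / (29 * k - l + 30) by rewrite mulrC.
have [A A0 HA] := unconditional_bound heps.
exists A; apply: filterS HA => x [x1 xA].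
apply: (le_trans xA); rewrite ler_wpM2l //.
by apply: ler_powR => //; rewrite lerD2r.
Qed.
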